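(* Let $X$ be a graded $U^+$-module with weight basis $\{x_i\}_{i\in I_X}$, such that the Hasse diagram $\mathfrak{H}(X)$ is a disjoint union of connected components each bounded from below, and let $\psi_X=\sum_{i\in I_X}x_i\otimes\psi_i\in X\otimes\mathcal V$ be the canonical invariant relative to $X$, where $\{\psi_i\}_{i\in I_X}\subset\mathcal V$ is the basis dual to $\{x_i\}$ of a copy $X'\subset \mathcal V$ of the left dual of $X$. For each $i\in I_X$ put $$z_i=\psi_i+\sum_{k\ge 1}\ \sum_{i\succ m_1\succ\cdots\succ m_k}\phi_{i m_1}\phi_{m_1m_2}\cdots\phi_{m_{k-1}m_k}\,\psi_{m_k}\,B^i_{m_1}\cdots B^i_{m_k}\ \in\ \mathcal V .$$ Then $z_i\in\mathcal V^+$ for every $i\in I_X$. Furthermore, $z_i=\wp\,\psi_i$.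
   Context: **Algebras.** $\mathfrak g=\mathfrak g_-\oplus\mathfrak h\oplus\mathfrak g_+$ is a complex semisimple Lie algebra with Cartan subalgebra $\mathfrak h$, simple roots $\Pi$, positive roots $\mathrm R^+$, $\rho=\frac12\sum_{\alpha\in \mathrm R^+}\alpha$, and a fixed invariant (Killing) form transferred to $\mathfrak h^*$; $h_\lambda\in\mathfrak h$ is defined by $\mu(h_\lambda)=(\mu,\lambda)$. $q\in\mathbb C^\times$ is not a root of unity and $[z]_q=\frac{q^z-q^{-z}}{q-q^{-1}}$ for $z\in\mathfrak h+\mathbb C$. $U$ is either $U_q(\mathfrak g)$ or $U(\mathfrak g)$. $U_q(\mathfrak g)$ has generators $e_\alpha,f_\alpha,q^{\pm h_\alpha}$ ($\alpha\in\Pi$) with $q^{h_\alpha}e_\beta=q^{(\alpha,\beta)}e_\beta q^{h_\alpha}$, $q^{h_\alpha}f_\beta=q^{-(\alpha,\beta)}f_\beta q^{h_\alpha}$, $[e_\alpha,f_\beta]=\delta_{\alpha\beta}[h_\alpha]_q$ and the quantum Serre relations, and coproduct $\Delta(f_\alpha)=f_\alpha\otimes1+q^{-h_\alpha}\otimes f_\alpha$, $\Delta(q^{\pm h_\alpha})=q^{\pm h_\alpha}\otimes q^{\pm h_\alpha}$, $\Delta(e_\alpha)=e_\alpha\otimes q^{h_\alpha}+1\otimes e_\alpha$. $U=U^-U^0U^+$ is the triangular factorization and $B^\pm=U^\pm U^0$. In the classical case $U=U(\mathfrak g)$, all formulas below are read with $q^{\pm h_\alpha}$ and other powers of $q$ replaced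 by $1$ and $[x]_q$ replaced by $x$. **The algebra $\mathcal A$.** $\mathcal A\supset U$ is an associative algebra, diagonalizable under the adjoint action of $U^0$ with integral weights, and a free $U^-$-$B^+$-bimodule under left-right multiplication. $\mathcal J_+=\mathcal A\mathfrak g_+$ is the left ideal generated by $e_\alpha$, $\alpha\in\Pi$; $\mathcal J_-=\mathfrak g_-\mathcal A$ is the right ideal generated by $f_\alpha$. $\hat U^0$ is the ring of fractions of $U^0$ over elements $[h_\mu-c]_q$ ($h_\mu-c$ classically), with $\mu$ nonzero integral weights and $c$ in a range (depending on the weights of $\mathcal A$) large enough to contain all denominators used, e.g. all $c\in\mathbb C$; $\hat{\mathcal A}=\mathcal A\otimes_{U^0}\hat U^0$ is the extended algebra and $\hat{\mathcal J}_\pm$ the extended ideals. $\mathcal V=\hat{\mathcal A}/\hat{\mathcal J}_+$ is a left $\mathcal A$-module and a $\hat U^0$-bimodule; $\mathcal V^+=\{v\in\mathcal V: e_\alpha v=0\ \forall\alpha\in\Pi\}$. It is assumed that there are further extensions $\hat U\subset\breve U$, $\hat{\mathcal A}\subset\breve{\mathcal A}$, $\hat{\mathcal J}_\pm\subset\breve{\mathcal J}_\pm$ (where $\breve{\mathcal J}_+$ is the left ideal of $\breve{\mathcal A}$ generated by $e_\alpha$, $\alpha\in\Pi$, and $\breve{\mathcal J}_-$ is the right ideal of $\breve{\mathcal A}$ generated by $f_\alpha$, $\alpha\in\Pi$) with $\mathcal J_\pm=\breve{\mathcal J}_\pm\cap\mathcal A$, and an element $\wp\in\breve U$ of zero weight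 (extremal projector) with $\wp\mathcal J_-=0=\mathcal J_+\wp$, $\wp^2=\wp$, $\wp-1\in\breve{\mathcal J}_-\cap\breve{\mathcal J}_+$. The equality $z_i=\wp\psi_i$ is understood modulo $\breve{\mathcal J}_+$. **Matrix $\phi$.** $\check{\mathcal R}$ is the element of the completed tensor product $U^+\otimes U^-$ with leading term $1\otimes1$ satisfying $\check{\mathcal R}\Delta(x)=\tilde\Delta(x)\check{\mathcal R}$, where $\tilde\Delta(f_\alpha)=f_\alpha\otimes1+q^{h_\alpha}\otimes f_\alpha$, $\tilde\Delta(q^{\pm h_\alpha})=q^{\pm h_\alpha}\otimes q^{\pm h_\alpha}$, $\tilde\Delta(e_\alpha)=e_\alpha\otimes q^{-h_\alpha}+1\otimes e_\alpha$ (equivalently $q^{\sum_i h_i\otimes h_i}\check{\mathcal R}$ is the universal R-matrix, $\{h_i\}$ an orthonormal basis of $\mathfrak h$). $\mathcal F=\frac1{q-q^{-1}}(\check{\mathcal R}-1\otimes1)$; classically $\mathcal F=\sum_{\alpha\in \mathrm R^+}e_\alpha\otimes f_\alpha$ with root vectors normalized by $(e_\alpha,f_\alpha)=1$. A $U^+$-module $X$ is graded if the action extends to a $B^+$-action, diagonalizable over $U^0$ with finite-dimensional weight spaces. Let $\pi:U^+\to\mathrm{End}(X)$ be the representation, $\{x_i\}_{i\in I_X}$ a weight basis, $x_i$ of weight $\nu_i$, and $\pi^\alpha_{ij}=\pi(e_\alpha)_{ij}$, so $e_\alpha x_j=\sum_i\pi^\alpha_{ij}x_i$. Define $\phi_{ij}\in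 U^-$ by $(\pi\otimes\mathrm{id})(\mathcal F)=\sum_{i,j}e_{ij}\otimes\phi_{ij}$ with matrix units $e_{ij}x_k=\delta_{jk}x_i$. **Hasse diagram.** $\mathfrak H(X)$ has node set $I_X$ and an arrow $i\stackrel{\alpha}{\longleftarrow}j$ ($\alpha\in\Pi$) whenever $\pi^\alpha_{ij}\ne0$; $i\succ j$ means there is a path of arrows of positive length from $j$ to $i$. A component is bounded from below if there is a weight $\lambda$ with $\nu_j-\lambda\in\mathbb Z_+\Pi$ for all its nodes $j$ (this makes the sum for $z_i$ finite). **Canonical invariant.** $X'\subset\mathcal V$ is isomorphic to the left dual of $X$ with respect to $\tilde\Delta$, with dual basis $\psi_i$; explicitly, the $\psi_i$ are linearly independent over $\mathbb C$, $\psi_i$ has (adjoint) weight $-\nu_i$, i.e. $q^{h_\alpha}\psi_i=q^{-(\alpha,\nu_i)}\psi_iq^{h_\alpha}$ (classically $h\psi_i=\psi_i(h-\nu_i(h))$), and $$e_\alpha\psi_i=-\sum_{k\in I_X}q^{-h_\alpha}\pi^\alpha_{ik}\psi_k,\qquad \alpha\in\Pi,\ i\in I_X .$$ **Cartan factors.** $\eta_\mu=h_\mu+(\mu,\rho)-\frac12(\mu,\mu)$, $\eta_i=\eta_{\nu_i}$, and for $i\succ j$, $B^i_j=\dfrac{q^{-(\eta_i-\eta_j)}}{[\eta_i-\eta_j]_q}\in\hat U^0$ (classically $B^i_j=\frac1{\eta_i-\eta_j}$). *)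

(* Defs.v *)
From HB Require Import structures.
From Stdlib Require Import Relations.
From mathcomp Require Import all_boot all_order all_algebra.
From mathcomp Require Import generic_quotient ring_quotient.
From mathcomp Require Import all_classical all_reals all_analysis.
From mathcomp Require Import complex.

Set Implicit Arguments.
Unset Strict Implicit.
Unset Printing Implicit Defensive.
Import GRing.Theory.
Local Open Scope ring_scope.
Local Open Scope classical_set_scope.

Section Generated.
Variables (C : comNzRingType) (A : algType C).

Definition gensub (G : set A) : {pred A} :=
  fun x => `[< forall S : {pred A},
    subalg_closed S -> (forall g, G g -> g \in S) -> x \in S >].

Lemma gensub_closed (G : set A) : subalg_closed (gensub G).
Proof.
split.
- by apply/asboolP => S [].
- move=> a x y /asboolP Gx /asboolP Gy; apply/asboolP => S cS GS.
  by have [_ lS _] := cS; apply: lS; [apply: Gx | apply: Gy].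
- move=> x y /asboolP Gx /asboolP Gy; apply/asboolP => S cS GS.
  by have [_ _ mS] := cS; apply: mS; [apply: Gx | apply: Gy].
Qed.

HB.instance Definition _ (G : set A) :=
  GRing.isSubalgClosed.Build C A (gensub G)
    (GRing.subalg_closed_semi (gensub_closed G)).

Record subalg (G : set A) : Type :=
  Subalg { sval_ : A; _ : sval_ \in gensub G }.

HB.instance Definition _ (G : set A) := [isSub for @sval_ G].
HB.instance Definition _ (G : set A) := [Choice of subalg G by <:].
HB.instance Definition _ (G : set A) :=
  [SubChoice_isSubAlgebra of subalg G by <:].

(* x as an element of subalg G; only meant for x \in gensub G *)
Definition insubalg (G : set A) (x : A) : subalg G := insubd (0 : subalg G) x.

End Generated.

Section Ideals.
Variables (A : nzRingType) (n : nat) (g : 'I_n -> A).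

Definition lideal : {pred A} :=
  fun x => `[< exists a : 'I_n -> A, x = \sum_i a i * g i >].

Definition rideal : {pred A} :=
  fun x => `[< exists a : 'I_n -> A, x = \sum_i g i * a i >].

Lemma lideal_closed : zmod_closed lideal.
Proof.
split=> [|x y /asboolP[a ->] /asboolP[b ->]].
  by apply/asboolP; exists (fun=> 0); rewrite big1 // => i _; rewrite mul0r.
apply/asboolP; exists (fun i => a i - b i).
by rewrite -sumrB; apply: eq_bigr => i _; rewrite mulrBl.
Qed.

HB.instance Definition _ := GRing.isZmodClosed.Build A lideal lideal_closed.

(* The left A-module A / lideal g, with its left action.  Right multiplication
   by b descends to it when (lideal g) b is contained in lideal g. *)
Definition lquot := Quotient.quot lideal.
Definition lclass (x : A) : lquot := \pi_(lquot)%qT x.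
Definition lact (a : A) (v : lquot) : lquot := lclass (a * repr v).
Definition ract (v : lquot) (b : A) : lquot := lclass (repr v * b).

End Ideals.

Section Tensors.
Variable C : comNzRingType.

Definition is_bilinear (V1 V2 W : lmodType C) (b : V1 -> V2 -> W) : Prop :=
  (forall y, linear (b^~ y)) /\ (forall x, linear (b x)).

(* A list of pairs stands for the sum of the corresponding simple tensors;
   two lists are equal in the tensor product V1 (x) V2 iff no bilinear map
   separates them (universal property of the tensor product). *)
Definition teq (V1 V2 : lmodType C) (s t : seq (V1 * V2)) : Prop :=
  forall (W : lmodType C) (b : V1 -> V2 -> W), is_bilinear b ->
    \sum_(p <- s) b p.1 p.2 = \sum_(p <- t) b p.1 p.2.

End Tensors.

Record lieAlg (F : fieldType) := LieAlg {
  lieV :> vectType F;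
  br : lieV -> lieV -> lieV;
  br_linl : forall y, linear (br^~ y);
  br_linr : forall x, linear (br x);
  br_alt : forall x, br x x = 0;
  br_jacobi : forall x y z,
    br x (br y z) + br y (br z x) + br z (br x y) = 0 }.

Section Lie.
Variables (F : fieldType) (L : lieAlg F).

Definition is_ideal (I : {vspace L}) : Prop :=
  forall x y : L, y \in I -> br x y \in I.

Definition br_vs (I J : {vspace L}) : {vspace L} :=
  <<[seq br x y | x <- vbasis I, y <- vbasis J]>>%VS.

Definition solvable_vs (I : {vspace L}) : Prop :=
  exists n, iter n (fun J => br_vs J J) I = 0%VS.

Definition semisimple_lie : Prop :=
  forall I : {vspace L}, is_ideal I -> solvable_vs I -> I = 0%VS.

(* The trace of ad x ad y, computed in a basis *)
Definition killing (x y : L) : F :=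
  let b := vbasis {:L} in
  \sum_(i < \dim {:L}) coord b i (br x (br y b`_i)).

Definition dualvs (H : {vspace L}) := 'Hom(subvs_of H, F^o).

Definition in_root_space (H : {vspace L}) (l : dualvs H) (x : L) : Prop :=
  forall t : subvs_of H, br (vsval t) x = (l t : F) *: x.

Definition is_root (H : {vspace L}) (l : dualvs H) : Prop :=
  l != 0 /\ exists2 x : L, x != 0 & in_root_space l x.

End Lie.

(* A semisimple Lie algebra g with a Cartan subalgebra h, simple roots
   alpha_i, positive roots, and root vectors eroot l in g_l, froot l in g_{-l}
   such that (eroot l, froot l) = 1 for the Killing form.
   The fields from ss_decomp on are standard facts of the structure theory:
   the triangular decomposition g = g_- + h + g_+ (which makes h abelian and
   self-normalizing), one-dimensional root spaces, integrality of the Cartan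
   matrix, and generation of g_+ and g_- by simple root vectors. *)
Record ssLie (F : fieldType) := SsLie {
  ssL :> lieAlg F;
  ss_semisimple : semisimple_lie ssL;
  cartan : {vspace ssL};
  cartan_ab : forall x y, x \in cartan -> y \in cartan -> br x y = 0;
  hvec : dualvs cartan -> subvs_of cartan;
  hvecP : forall (l : dualvs cartan) (t : subvs_of cartan),
    killing (vsval (hvec l)) (vsval t) = l t;
  rk : nat;
  alpha : 'I_rk -> dualvs cartan;
  alpha_basis : basis_of fullv [seq alpha i | i <- enum 'I_rk];
  posroots : seq (dualvs cartan);
  posroots_uniq : uniq posroots;
  posrootsP : forall l, l \in posroots <->
    is_root l /\ exists n : 'I_rk -> nat, l = \sum_i alpha i *+ n i;
  alpha_pos : forall i, alpha i \in posroots;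
  root_sign : forall l, is_root l -> l \in posroots \/ - l \in posroots;
  eroot : dualvs cartan -> ssL;
  froot : dualvs cartan -> ssL;
  ef_root : forall l, l \in posroots -> killing (eroot l) (froot l) = 1;
  ss_decomp : forall x : ssL, exists (t : subvs_of cartan) (a b : dualvs cartan -> F),
    x = vsval t + \sum_(l <- posroots) (a l *: eroot l + b l *: froot l);
  erootP : forall l, l \in posroots -> forall x,
    in_root_space l x <-> exists c, x = c *: eroot l;
  frootP : forall l, l \in posroots -> forall x,
    in_root_space (- l) x <-> exists c, x = c *: froot l;
  cmat : 'I_rk -> 'I_rk -> int;
  cmatP : forall i j,
    2%:R * killing (vsval (hvec (alpha i))) (vsval (hvec (alpha j)))
    = (cmat i j)%:~R
      * killing (vsval (hvec (alpha i))) (vsval (hvec (alpha i)));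
  e_gen : forall S : {vspace ssL}, (forall i, eroot (alpha i) \in S) ->
    (forall x y, x \in S -> y \in S -> br x y \in S) ->
    forall l, l \in posroots -> eroot l \in S;
  f_gen : forall S : {vspace ssL}, (forall i, froot (alpha i) \in S) ->
    (forall x y, x \in S -> y \in S -> br x y \in S) ->
    forall l, l \in posroots -> froot l \in S }.

Section Weights.
Variables (F : fieldType) (L : ssLie F).

Definition hstar := dualvs (cartan L).

Definition form (l m : hstar) : F :=
  killing (vsval (hvec l)) (vsval (hvec m)).

Definition rho : hstar := (2%:R : F)^-1 *: \sum_(l <- posroots L) l.

(* The root lattice, in coordinates on the simple roots *)
Definition rlat := {ffun 'I_(rk L) -> int}.

Definition wt_of (b : rlat) : hstar := \sum_i alpha i *~ b i.

Definition salpha (i : 'I_(rk L)) : rlat := [ffun j => (j == i)%:Z].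

(* Coordinates of an element of the root lattice; junk elsewhere *)
Definition rcoord (l : hstar) : rlat := xget 0 [set b : rlat | wt_of b = l].

Definition integral_wt (l : hstar) : Prop :=
  forall i, exists n : int,
    2%:R * form l (alpha i) = n%:~R * form (alpha i) (alpha i).

(* The pair (l, c) stands for the element h_l + c of h + F. *)
Definition affh := (hstar * F)%type.

Definition eta (m : hstar) : affh :=
  (m, form m rho - (2%:R : F)^-1 * form m m).

End Weights.

Section Envelope.
Variable R : realType.
Local Notation C := (R[i]).

Definition cexp (z : C) : C :=
  let: (a +i* b)%C := z in (expR a * cos b +i* (expR a * sin b))%C.

(* Powers and q-numbers for q = e^hbar; the choice of hbar fixes the
   meaning of q^z for complex z. *)
Definition qpw (hbar z : C) : C := cexp (hbar * z).

Definition qnum (hbar z : C) : C :=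
  (qpw hbar z - qpw hbar (- z)) / (qpw hbar 1 - qpw hbar (- 1)).

(* The Gaussian binomial coefficient for q_i = q^d *)
Definition qbinom (hbar d : C) (n k : nat) : C :=
  \prod_(j < k) (qnum hbar (d * (n - j)%N%:R) / qnum hbar (d * j.+1%:R)).

Variable L : ssLie C.
Local Notation I := 'I_(rk L).

Definition is_enveloping_map (B : algType C) (g : L -> B) : Prop :=
  linear g /\ forall x y, g (br x y) = g x * g y - g y * g x.

Definition is_enveloping (U : algType C) (iota : L -> U) : Prop :=
  is_enveloping_map iota /\
  forall (B : algType C) (g : L -> B), is_enveloping_map g ->
  exists h : {lrmorphism U -> B}, (forall x, h (iota x) = g x) /\
    forall h' : {lrmorphism U -> B}, (forall x, h' (iota x) = g x) -> h' =1 h.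

(* k i and k' i stand for q^{h_alpha} and q^{-h_alpha}, alpha = alpha i. *)
Definition Uq_relations (hbar : C) (B : algType C) (e f k k' : I -> B) : Prop :=
  [/\ (forall i, k i * k' i = 1 /\ k' i * k i = 1) /\
      (forall i j, k i * k j = k j * k i),
      forall i j,
        k i * e j = qpw hbar (form (alpha i) (alpha j)) *: (e j * k i),
      forall i j,
        k i * f j = qpw hbar (- form (alpha i) (alpha j)) *: (f j * k i),
      forall i j, e i * f j - f j * e i =
        if i == j then (qpw hbar 1 - qpw hbar (- 1))^-1 *: (k i - k' i) else 0 &
      forall i j, i != j -> let n := absz (1 - cmat i j) in
        let d := form (alpha i) (alpha i) / 2%:R in
        \sum_(r < n.+1) ((-1) ^+ r * qbinom hbar d n r) *:
            (e i ^+ (n - r) * e j * e i ^+ r) = 0 /\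
        \sum_(r < n.+1) ((-1) ^+ r * qbinom hbar d n r) *:
            (f i ^+ (n - r) * f j * f i ^+ r) = 0].

Definition is_Uq (hbar : C) (U : algType C) (e f k k' : I -> U) : Prop :=
  Uq_relations hbar e f k k' /\
  forall (B : algType C) (e1 f1 k1 k1' : I -> B),
  Uq_relations hbar e1 f1 k1 k1' ->
  let maps (h : U -> B) := forall i,
    [/\ h (e i) = e1 i, h (f i) = f1 i, h (k i) = k1 i & h (k' i) = k1' i] in
  exists h : {lrmorphism U -> B}, maps h /\
    forall h' : {lrmorphism U -> B}, maps h' -> h' =1 h.

(* Classical: the canonical map of g into U(g); Quantum: hbar, e, f, q^{h_alpha}
   and q^{-h_alpha}, for U_q(g) with q = e^hbar *)
Variant presentation (U : algType C) :=
  | Classical (iota : L -> U)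
  | Quantum (hbar : C) (e f k k' : I -> U).

Definition is_presentation (U : algType C) (D : presentation U) : Prop :=
  match D with
  | Classical iota => is_enveloping iota
  | Quantum hbar e f k k' =>
      (forall n : nat, qpw hbar 1 ^+ n.+1 != 1) /\ is_Uq hbar e f k k'
  end.

Record envelope := Envelope {
  envU :> algType C;
  pres : presentation envU;
  presP : is_presentation pres }.

Variable U : envelope.

Definition eU (i : I) : U :=
  match pres U with
  | Classical iota => iota (eroot (alpha i))
  | Quantum _ e _ _ _ => e i
  end.

Definition fU (i : I) : U :=
  match pres U with
  | Classical iota => iota (froot (alpha i))
  | Quantum _ _ f _ _ => f i
  end.

(* q^{h_alpha} and q^{-h_alpha}, which become 1 in the classical case *)
Definition kU (i : I) : U :=
  match pres U with Classical _ => 1 | Quantum _ _ _ k _ => k i end.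

Definition kVU (i : I) : U :=
  match pres U with Classical _ => 1 | Quantum _ _ _ _ k' => k' i end.

Definition gens0 : set U :=
  match pres U with
  | Classical iota => [set iota (vsval t) | t in [set: subvs_of (cartan L)]]
  | Quantum _ _ _ k k' => range k `|` range k'
  end.

Definition gensp : set U :=
  match pres U with
  | Classical iota => [set iota (eroot l) | l in [set l | l \in posroots L]]
  | Quantum _ e _ _ _ => range e
  end.

Definition gensm : set U :=
  match pres U with
  | Classical iota => [set iota (froot l) | l in [set l | l \in posroots L]]
  | Quantum _ _ f _ _ => range f
  end.

Definition U0 := subalg gens0.
Definition Up := subalg gensp.
Definition Um := subalg gensm.
Definition Bp := subalg (gensp `|` gens0).

Definition eUp (i : I) : Up := insubalg gensp (eU i).

(* q^{h_l} for l in the root lattice *)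
Definition kpow (k k' : I -> U) (b : rlat L) : U :=
  \prod_i (match b i with Posz n => k i ^+ n | Negz n => k' i ^+ n.+1 end).

(* q^{h_l + c} and [h_l + c]_q for l in the root lattice (respectively 1 and
   h_l + c, for any l, in the classical case) *)
Definition qexpU (x : affh L) : U :=
  match pres U with
  | Classical _ => 1
  | Quantum hbar _ _ k k' => qpw hbar x.2 *: kpow k k' (rcoord x.1)
  end.

Definition qbrU (x : affh L) : U :=
  match pres U with
  | Classical iota => iota (vsval (hvec x.1)) + x.2%:A
  | Quantum hbar _ _ _ _ =>
      (qpw hbar 1 - qpw hbar (- 1))^-1 *: (qexpU x - qexpU (- x))
  end.

Definition qexp0 (x : affh L) : U0 := insubalg gens0 (qexpU x).
Definition qbr0 (x : affh L) : U0 := insubalg gens0 (qbrU x).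

(* Weights of the denominators: nonzero integral weights l, with q^{h_l} in
   U^0 in the quantum case *)
Definition denom_wt (l : hstar L) : Prop :=
  l != 0 /\
  match pres U with
  | Classical _ => integral_wt l
  | Quantum _ _ _ _ _ => exists b : rlat L, l = wt_of b
  end.

(* y has weight l for a left action of U on M *)
Definition left_weight (M : lmodType C) (act : U -> M -> M)
    (l : hstar L) (y : M) : Prop :=
  match pres U with
  | Classical iota => forall t : subvs_of (cartan L),
      act (iota (vsval t)) y = (l t : C) *: y
  | Quantum hbar _ _ k _ => forall i,
      act (k i) y = qpw hbar (form (alpha i) l) *: y
  end.

(* m has adjoint weight l for a left and a right action of U^0 on M:
   h m = m (h + l(h)), respectively
   q^{h_alpha} m = q^{(alpha, l)} m q^{h_alpha} *)
Definition ad_weight (M : Type) (la : U -> M -> M) (ra : M -> U -> M)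
    (l : hstar L) (m : M) : Prop :=
  match pres U with
  | Classical iota => forall t : subvs_of (cartan L),
      la (iota (vsval t)) m = ra m (iota (vsval t) + (l t : C)%:A)
  | Quantum hbar _ _ k _ => forall i,
      la (k i) m = ra m (qpw hbar (form (alpha i) l) *: k i)
  end.

(* Elements of the completed tensor product of U^+ and U^- are families
   indexed by the degree b of the first factor: the b-th term lies in
   U^+_b (x) U^-. *)
Definition deg_part (b : rlat L) (x : Up) : Prop :=
  exists s : seq (C * seq I),
    (forall m, m \in s -> [ffun i => (count_mem i m.2)%:Z] = b) /\
    val x = \sum_(m <- s) m.1 *: \prod_(i <- m.2) eU i.

Definition ctens (V1 V2 : Type) := rlat L -> seq (V1 * V2).

Definition tval (s : seq (Up * Um)) : seq (U * U) :=
  [seq (val p.1, val p.2) | p <- s].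

(* D lists simple tensors together with the degree of their first factor. *)
Definition tmul (s t : seq (U * U)) : seq (U * U) :=
  [seq (p.1 * r.1, p.2 * r.2) | p <- s, r <- t].

Definition cmulr (T : ctens U U) (D : seq (rlat L * (U * U))) : ctens U U :=
  fun b => flatten [seq tmul (T (b - d.1)) [:: d.2] | d <- D].

Definition cmull (D : seq (rlat L * (U * U))) (T : ctens U U) : ctens U U :=
  fun b => flatten [seq tmul [:: d.2] (T (b - d.1)) | d <- D].

Definition intertwines (T : ctens U U) (D D' : seq (rlat L * (U * U))) : Prop :=
  forall b, teq (cmulr T D b) (cmull D' T b).

Definition is_Rcheck (T : ctens Up Um) : Prop :=
  let T' b := tval (T b) in
  [/\ forall b p, p \in T b -> deg_part b p.1,
      teq (T 0) [:: (1, 1)],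
      forall i, intertwines T'
        [:: (- salpha i, (fU i, 1)); (0, (kVU i, fU i))]
        [:: (- salpha i, (fU i, 1)); (0, (kU i, fU i))],
      forall i, intertwines T' [:: (0, (kU i, kU i))] [:: (0, (kU i, kU i))] /\
        intertwines T' [:: (0, (kVU i, kVU i))] [:: (0, (kVU i, kVU i))] &
      forall i, intertwines T'
        [:: (salpha i, (eU i, kU i)); (0, (1, eU i))]
        [:: (salpha i, (eU i, kVU i)); (0, (1, eU i))]].

Definition is_calF (T : ctens Up Um) : Prop :=
  match pres U with
  | Classical iota => forall b, teq (T b)
      [seq (insubalg gensp (iota (eroot l)), insubalg gensm (iota (froot l)))
         | l <- posroots L & l == wt_of b]
  | Quantum hbar _ _ _ _ => exists2 Rc : ctens Up Um, is_Rcheck Rc &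
      forall b, teq (T b)
        [seq ((qpw hbar 1 - qpw hbar (- 1))^-1 *: p.1, p.2)
           | p <- Rc b ++ (if b == 0 then [:: (-1, 1)] else [::])]
  end.

End Envelope.

Arguments gens0 {R L} U _.
Arguments gensp {R L} U _.
Arguments gensm {R L} U _.

Section Ambient.
Variables (R : realType) (L : ssLie R[i]) (U : envelope L).
Local Notation C := (R[i]).
Local Notation I := 'I_(rk L).

Definition free_bimodule (A : algType C) (iA : U -> A) : Prop :=
  exists (K : choiceType) (w : K -> A),
    (forall a, exists s : seq (K * (Um U * Bp U)),
       a = \sum_(p <- s) iA (val p.2.1) * w p.1 * iA (val p.2.2)) /\
    (forall s : seq (K * (Um U * Bp U)),
       \sum_(p <- s) iA (val p.2.1) * w p.1 * iA (val p.2.2) = 0 ->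
       forall c, teq [seq p.2 | p <- s & p.1 == c] [::]).

Record ambient := Ambient {
  amb :> algType C;
  iA : {lrmorphism U -> amb};
  iA_inj : injective iA;
  amb_diag : forall a : amb, exists s : seq (hstar L * amb),
    (forall p, p \in s -> integral_wt p.1 /\
       ad_weight (fun u x => iA u * x) (fun x u => x * iA u) p.1 p.2) /\
    a = \sum_(p <- s) p.2;
  amb_free : free_bimodule iA }.

(* Denominators are products of [h_l - c]_q, with c any complex number. *)
Inductive denom : U0 U -> Prop :=
  | denom1 : denom 1
  | denomM l c s : denom_wt U l -> denom s -> denom (qbr0 U (l, - c) * s).

Definition is_fractions (U0h : comUnitAlgType C) (j : U0 U -> U0h) : Prop :=
  [/\ forall s, denom s -> j s \is a GRing.unit,
      forall x, exists a s, denom s /\ x = j a / j s &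
      forall a, j a = 0 -> exists2 s, denom s & a * s = 0].

(* The tensor product of A and U0h over U^0, with a (x) x written jA a * jU x *)
Definition is_base_change (A : ambient) (U0h : comUnitAlgType C)
    (j : U0 U -> U0h) (Ah : algType C) (jA : A -> Ah) (jU : U0h -> Ah) : Prop :=
  [/\ forall u, jA (iA A (val u)) = jU (j u),
      forall y, exists s : seq (A * U0h),
        y = \sum_(p <- s) jA p.1 * jU p.2 &
      forall (W : lmodType C) (b : A -> U0h -> W), is_bilinear b ->
        (forall a u x, b (a * iA A (val u)) x = b a (j u * x)) ->
        exists g : {linear Ah -> W}, forall a x, g (jA a * jU x) = b a x].

Record extension (A : ambient) := Extension {
  U0hat : comUnitAlgType C;
  j0 : {lrmorphism (U0 U) -> U0hat};
  j0P : is_fractions j0;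
  Ahat :> algType C;
  jA : {lrmorphism A -> Ahat};
  jU : {lrmorphism U0hat -> Ahat};
  jAP : is_base_change j0 jA jU }.

Section Extended.
Variables (A : ambient) (H : extension A).

Definition hatU (u : U) : H := jA H (iA A u).

Definition ehat (i : I) : H := hatU (eU U i).
Definition Vmod := lquot ehat.

Definition Vlact (a : H) (v : Vmod) : Vmod := lact a v.
Definition Vract (v : Vmod) (x : U0hat H) : Vmod := ract v (jU H x).

Definition Vplus (v : Vmod) : Prop := forall i, Vlact (ehat i) v = 0.

Definition Vweight (l : hstar L) (v : Vmod) : Prop :=
  ad_weight (fun u => Vlact (hatU u))
    (fun w u => Vract w (j0 H (insubalg (gens0 U) u))) l v.

Record projector := Projector {
  Abrv :> algType C;
  kA : {lrmorphism H -> Abrv};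
  kA_inj : injective kA;
  Ubrv : set Abrv;
  Ubrv_alg : subalg_closed (fun x => `[< Ubrv x >]);
  Ubrv_U : forall u, Ubrv (kA (hatU u));
  Ubrv_U0 : forall x, Ubrv (kA (jU H x));
  brv_Jp : forall a : A,
    kA (jA H a) \in lideal (fun i => kA (hatU (eU U i))) <->
    a \in lideal (fun i => iA A (eU U i));
  brv_Jm : forall a : A,
    kA (jA H a) \in rideal (fun i => kA (hatU (fU U i))) <->
    a \in rideal (fun i => iA A (fU U i));
  wp : Abrv;
  wp_U : Ubrv wp;
  wp_weight : ad_weight (fun u x => kA (hatU u) * x)
                (fun x u => x * kA (hatU u)) 0 wp;
  wp_Jm : forall a : A, a \in rideal (fun i => iA A (fU U i)) ->
    wp * kA (jA H a) = 0;
  wp_Jp : forall a : A, a \in lideal (fun i => iA A (eU U i)) ->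
    kA (jA H a) * wp = 0;
  wp_idem : wp * wp = wp;
  wp_1 : (wp - 1 \in rideal (fun i => kA (hatU (fU U i)))) /\
         (wp - 1 \in lideal (fun i => kA (hatU (eU U i)))) }.

Definition ebrv (P : projector) (i : I) : P := kA P (ehat i).

(* Well defined on classes because kA maps lideal ehat into lideal ebrv *)
Definition Vbrv (P : projector) (v : Vmod) : lquot (ebrv P) :=
  lclass (ebrv P) (kA P (repr v)).

End Extended.
End Ambient.

Section Graded.
Variables (R : realType) (L : ssLie R[i]) (U : envelope L).
Local Notation C := (R[i]).
Local Notation I := 'I_(rk L).

Definition is_module (B : algType C) (X : lmodType C) (act : B -> X -> X) : Prop :=
  [/\ is_bilinear act, forall y, act 1 y = y &
      forall a b y, act (a * b) y = act a (act b y)].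

Definition is_basis (X : lmodType C) (J : choiceType) (x : J -> X)
    (coord : J -> X -> C) : Prop :=
  [/\ forall i, linear (coord i : X -> C^o),
      forall i j, coord i (x j) = (i == j)%:R,
      forall y, finite_set [set i | coord i y != 0] &
      forall y, y = \sum_(i \in [set: J]) coord i y *: x i].

(* A graded U^+-module with a weight basis; xcoord i y is the coefficient of
   x_i in y.  The B^+-module structure extends the U^+-action. *)
Record gradedMod := GradedMod {
  gmX :> lmodType C;
  piX : Up U -> gmX -> gmX;
  piX_mod : is_module piX;
  bpX : Bp U -> gmX -> gmX;
  bpX_mod : is_module bpX;
  bpX_ext : forall u b, val u = val b -> piX u =1 bpX b;
  gmI : choiceType;
  xvec : gmI -> gmX;
  xcoord : gmI -> gmX -> C;
  xbasis : is_basis xvec xcoord;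
  nu : gmI -> hstar L;
  Xwt := left_weight (fun u => bpX (insubalg (gensp U `|` gens0 U) u));
  xvec_wt : forall i, Xwt (nu i) (xvec i);
  (* The weight grading by h^*, for which e_alpha has degree alpha.  This is
     automatic classically; in the quantum case the eigenvalues of q^{h_alpha}
     determine the weights only up to periods of z |-> q^z. *)
  nu_e : forall a i j,
    xcoord i (piX (eUp U a) (xvec j)) != 0 -> nu i = nu j + alpha a;
  Xwt_fin : forall l : hstar L, exists s : seq gmX, forall y, Xwt l y ->
    exists c : 'I_(size s) -> C, y = \sum_(k < size s) c k *: s`_k }.

Variable X : gradedMod.
Local Notation IX := (gmI X).

Definition pimat (u : Up U) (i j : IX) : C := xcoord i (piX u (xvec j)).

(* There is an arrow from j to i in the Hasse diagram *)
Definition arrow (i j : IX) : Prop := exists a, pimat (eUp U a) i j != 0.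

Definition succ : IX -> IX -> Prop := clos_trans IX arrow.

Definition same_component : IX -> IX -> Prop := clos_refl_sym_trans IX arrow.

Definition bounded_below : Prop :=
  forall i, exists l : hstar L, forall j, same_component i j ->
    exists n : I -> nat, nu j - l = \sum_a alpha a *+ n a.

(* Entry (i, j) of (pi (x) id)(T); for fixed i, j only one degree contributes. *)
Definition phi (T : ctens L (Up U) (Um U)) (i j : IX) : Um U :=
  \sum_(b \in [set: rlat L]) \sum_(p <- T b) pimat p.1 i j *: p.2.

Variables (A : ambient U) (H : extension A).

Definition is_dual_basis (psi : IX -> Vmod H) : Prop :=
  [/\ forall (s : seq IX) (c : IX -> C), uniq s ->
        \sum_(i <- s) Vlact (c i)%:A (psi i) = 0 ->
        forall i, i \in s -> c i = 0,
      forall i, Vweight (- nu i) (psi i) &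
      forall a i, Vlact (ehat H a) (psi i) =
        - \sum_(k \in [set: IX])
            Vlact (hatU H (pimat (eUp U a) i k *: kVU U a)) (psi k)].

Definition Bfac (i j : IX) : U0hat H :=
  let x := eta (nu i) - eta (nu j) in
  j0 H (qexp0 U (- x)) / j0 H (qbr0 U x).

(* i > m_1 > ... > m_k for s = [:: m_1; ...; m_k] *)
Fixpoint chain (i : IX) (s : seq IX) : Prop :=
  if s is m :: s' then succ i m /\ chain m s' else True.

Definition zterm (T : ctens L (Up U) (Um U)) (psi : IX -> Vmod H)
    (i : IX) (s : seq IX) : Vmod H :=
  Vract (Vlact (hatU H (val (\prod_(u <- pairmap (phi T) i s) u)))
           (psi (last i s)))
        (\prod_(m <- s) Bfac i m).

Definition zvec (T : ctens L (Up U) (Um U)) (psi : IX -> Vmod H) (i : IX) : Vmod H :=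
  psi i + \sum_(s \in [set s | s != [::] /\ chain i s]) zterm T psi i s.

End Graded.

(* Main.v *)
(* Fix i, put e = e_alpha, and let Z_m be the analogue of z_i started at the node
   m, with the same Cartan factors B^i: Z_m = psi_m + sum_{j < m} phi_mj Z_j B^i_j.
   The intertwining property of the R-matrix (in the classical case, invariance of
   the Killing form) gives
     [e, phi_mj] = pi_mj [h_alpha] + sum_k phi_mk pi_kj q^{h_alpha}
                   - sum_k pi_mk q^{-h_alpha} phi_kj,
   and induction along the Hasse diagram then yields
     e Z_m = - sum_k pi_mk Z_k [eta_i - eta_m] / [eta_i - eta_k],
   because eta_k - eta_j = h_alpha - (alpha, nu_j) for an arrow from j to k.  The
   right-hand side vanishes for m = i.  Finally wp - 1 lies in the left ideal
   generated by the e_alpha, so wp z_i = z_i, while wp kills every phi_ij: this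
   element has nonzero weight, hence lies in the right ideal generated by the
   f_alpha up to a scalar that the weight forces to annihilate wp. *)
From HB Require Import structures.
From Stdlib Require Import Relations.
From mathcomp Require Import all_boot all_order all_algebra.
From mathcomp Require Import generic_quotient ring_quotient.
From mathcomp Require Import all_classical all_reals all_analysis.
From mathcomp Require Import complex ring.
Require Import Defs.

Set Implicit Arguments.
Unset Strict Implicit.
Unset Printing Implicit Defensive.
Import GRing.Theory Num.Theory.
Local Open Scope ring_scope.
Local Open Scope classical_set_scope.

(** * Linear algebra and ideals *)

(** The family Z_m keeps the factors of the fixed node i because e_alpha, applied to z_i, produces
    tails of chains that start at lower nodes but still carry B^i. Three facts shape the rest. The
    ring \hat U^0 is commutative, so its right action makes V a module over it and every Cartan
    element acts on a weight vector by a scalar of that ring; the recursion is then linear algebra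
    over a commutative ring. The matrix entries of X are defined on U^+ only, while the intertwining
    relation is an equality in the tensor square of U, some of whose terms leave U^+; the entries
    are therefore extended along a linear retraction of U onto U^+, obtained from Zorn's lemma.
    Finally, q^z means e^(hbar z), so that q is not a root of unity does not exclude q^z = 1 for
    irrational z. That the weight of phi_ij is visible to some q^{h_alpha} rests on the rationality
    of the form on the root lattice, extracted from the trace formula for the Killing form. *)

Section Retraction.
Variables (F : fieldType) (V W : lmodType F) (i : {linear W -> V}).
Hypothesis i_inj : injective i.

Let submod (S : set V) := S 0 /\ forall a x y, S x -> S y -> S (a *: x + y).

(* By Zorn's lemma: project along a maximal subspace S meeting the image of i
   trivially. *)
Lemma linear_retraction : exists p : {linear V -> W}, cancel i p.
Proof.
pose P (S : set V) := (forall x, ~ S x) \/ submod S /\ forall w, S (i w) -> w = 0.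
have [S [PS maxS]] : exists S, P S /\ forall B, S `<` B -> ~ P B.
  apply: Zorn_bigcup => G GP totG.
  have [[S0 [GS0 [S00 _]]]|none] :=
      pselect (exists S0, G S0 /\ submod S0); last first.
    left=> x [S GS Sx]; have [/(_ x)//|[sS _]] := GP _ GS.
    by apply: none; exists S.
  right; split; last first.
    move=> w [S GS Sw]; have [/(_ _ Sw)//|[_]] := GP _ GS; exact.
  split; first by exists S0.
  have sub S : G S -> forall x, S x -> submod S.
    by move=> GS x Sx; have [/(_ x)//|[]] := GP _ GS.
  move=> a x y [S GS Sx] [S' GS' Sy].
  have [SS'|S'S] := totG _ _ GS GS'.
    by exists S' => //; apply: (sub _ GS' _ Sy).2 => //; exact: SS'.
  by exists S => //; apply: (sub _ GS _ Sx).2 => //; exact: S'S.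
have [sS Si] : submod S /\ forall w, S (i w) -> w = 0.
  case: PS => // S0; exfalso; apply: (maxS [set 0]).
    by split=> [x /S0//|/(_ 0 erefl)/S0].
  right; split; first by split=> // a x y -> ->; rewrite scaler0 addr0.
  by move=> w /= iw0; apply: i_inj; rewrite iw0 raddf0.
have [S0 SL] := sS.
have SZ a x : S x -> S (a *: x) by move=> Sx; rewrite -[_ *: _]addr0; exact: SL.
have SD x y : S x -> S y -> S (x + y) by move=> Sx Sy; rewrite -[x]scale1r; exact: SL.
(* If no w works for v, then S + F v is strictly larger than S and still meets the image of i
   trivially: an i w in it with coefficient a != 0 at v would put v - i (w / a) in S. *)
have dec v : exists w, S (v - i w).
  apply: contrapT => nv.
  apply: (maxS [set x | exists a s, S s /\ x = a *: v + s]); first split.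
  - by move=> x Sx; exists 0, x; rewrite scale0r add0r.
  - move=> /(_ v) Sv; apply: nv; exists 0; rewrite raddf0 subr0; apply: Sv.
    by exists 1, 0; rewrite scale1r addr0.
  - right; split; first split.
    + by exists 0, 0; rewrite scale0r addr0.
    + move=> a x y [b [s [Ss ->]]] [c [t [St ->]]].
      exists (a * b + c), (a *: s + t); split; first exact: SL.
      by rewrite scalerDr scalerDl scalerA addrACA.
  - move=> w [a [s [Ss iwE]]].
    have [a0|a0] := eqVneq a 0.
      by apply: Si; rewrite iwE a0 scale0r add0r.
    exfalso; apply: nv; exists (a^-1 *: w).
    rewrite linearZ /= iwE scalerDr scalerA mulVf // scale1r opprD addNKr.
    by rewrite -scalerN; apply/SZ; rewrite -scaleN1r; apply: SZ.
pose p v := projT1 (cid (dec v)).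
have pS v : S (v - i (p v)) by rewrite /p; case: cid.
have p_uniq v w : S (v - i w) -> p v = w.
  move=> Sw; apply/subr0_eq/Si; rewrite raddfB /=.
  suff -> : i (p v) - i w = (v - i w) + (-1) *: (v - i (p v)) by exact/SD/SZ.
  by rewrite scaleN1r opprB [RHS]addrC addrA subrK.
have plin : linear p.
  move=> a x y; apply: p_uniq; rewrite linearP /=.
  suff -> : a *: x + y - (a *: i (p x) + i (p y))
    = a *: (x - i (p x)) + (y - i (p y)) by exact: SL.
  by rewrite scalerBr opprD addrACA.
pose pM := GRing.isLinear.Build F V W *:%R p plin.
pose p' : {linear V -> W} := HB.pack p pM.
exists p' => w /=; apply: p_uniq.
by rewrite subrr.
Qed.

End Retraction.

Section GensubTheory.
Variables (C : comNzRingType) (A : algType C) (G : set A).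

Lemma gensub_gen g : G g -> g \in gensub G.
Proof. by move=> Gg; apply/asboolP => S _; exact. Qed.

Lemma gensub_ind (Q : A -> Prop) :
    Q 1 -> (forall a x y, Q x -> Q y -> Q (a *: x + y)) ->
    (forall x y, Q x -> Q y -> Q (x * y)) -> (forall g, G g -> Q g) ->
  forall x, x \in gensub G -> Q x.
Proof.
move=> Q1 QL QM QG x /asboolP; move/(_ (fun x => `[< Q x >])) => Qx.
apply/asboolP/Qx => [|g /QG Qg]; last exact/asboolP.
split; first exact/asboolP.
  by move=> a u v /asboolP Qu /asboolP Qv; apply/asboolP/QL.
by move=> u v /asboolP Qu /asboolP Qv; apply/asboolP/QM.
Qed.

Lemma insubalgK x : x \in gensub G -> val (insubalg G x) = x.
Proof. by move=> Gx; rewrite /insubalg insubdK. Qed.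

Lemma val_insubalg (x : subalg G) : insubalg G (val x) = x.
Proof. by rewrite /insubalg valKd. Qed.

End GensubTheory.

Lemma gensub_sub (C : comNzRingType) (A : algType C) (G G' : set A) :
  G `<=` G' -> {subset gensub G <= gensub G'}.
Proof.
move=> GG'; apply: gensub_ind => [|a x y Gx Gy|x y Gx Gy|g /GG' Gg].
- exact: rpred1.
- by rewrite rpredD ?rpredZ.
- exact: rpredM.
- exact: gensub_gen.
Qed.

Section LquotTheory.
Variables (A : nzRingType) (n : nat) (g : 'I_n -> A).
Local Notation J := (lideal g).
Local Notation V := (lquot g).
Local Notation cl := (lclass g).

Lemma lideal_gen i : g i \in J.
Proof.
apply/asboolP; exists (fun j => (j == i)%:R).
rewrite (bigD1 i) //= eqxx mul1r big1 ?addr0 // => j /negPf->.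
by rewrite mul0r.
Qed.

Lemma lidealMl a x : x \in J -> a * x \in J.
Proof.
move=> /asboolP[b ->]; apply/asboolP; exists (fun i => a * b i).
by rewrite mulr_sumr; apply: eq_bigr => i _; rewrite mulrA.
Qed.

Lemma lidealP (Q : A -> Prop) : Q 0 -> (forall x y, Q x -> Q y -> Q (x + y)) ->
  (forall a i, Q (a * g i)) -> forall x, x \in J -> Q x.
Proof. by move=> Q0 QD Qg x /asboolP[a ->]; elim/big_ind: _. Qed.

Lemma lclass_eq x y : (cl x = cl y) <-> (x - y \in J).
Proof.
rewrite /lclass; split; first by move/eqP; rewrite -Quotient.idealrBE.
by rewrite Quotient.idealrBE => /eqP.
Qed.

Lemma lclass_repr (v : V) : cl (repr v) = v.
Proof. exact: reprK. Qed.

Lemma lclassD : {morph cl : x y / x + y}.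
Proof. by move=> x y; rewrite /lclass piE. Qed.

Lemma lclassN : {morph cl : x / - x}.
Proof. by move=> x; rewrite /lclass piE. Qed.

Lemma lclass0 : cl 0 = 0.
Proof. by rewrite /lclass piE. Qed.

Lemma lclass_eq0 x : (cl x = 0) <-> (x \in J).
Proof. by rewrite -lclass0 lclass_eq subr0. Qed.

Lemma lclassP (v : V) : exists x, v = cl x.
Proof. by exists (repr v); rewrite lclass_repr. Qed.

Lemma repr_lclass x : repr (cl x) - x \in J.
Proof. by apply/lclass_eq; rewrite lclass_repr. Qed.

Lemma lact_class a x : lact a (cl x) = cl (a * x).
Proof.
by apply/lclass_eq; rewrite -mulrBr; apply/lidealMl/repr_lclass.
Qed.

Lemma lactDr a : {morph @lact A n g a : u v / u + v}.
Proof.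
move=> u v; have [x ->] := lclassP u; have [y ->] := lclassP v.
by rewrite -lclassD !lact_class -lclassD mulrDr.
Qed.

Lemma lactDl (v : V) : {morph (@lact A n g)^~ v : a b / a + b}.
Proof.
by move=> a b; have [x ->] := lclassP v; rewrite !lact_class -lclassD mulrDl.
Qed.

Lemma lact0r a : lact a (0 : V) = 0.
Proof. by rewrite -lclass0 lact_class mulr0. Qed.

Lemma lact0l (v : V) : lact 0 v = 0.
Proof. by have [x ->] := lclassP v; rewrite lact_class mul0r lclass0. Qed.

Lemma lactNl a (v : V) : lact (- a) v = - lact a v.
Proof. by have [x ->] := lclassP v; rewrite !lact_class mulNr lclassN. Qed.

Lemma lact_sumr (T : Type) (r : seq T) (F : T -> V) a :
  lact a (\sum_(t <- r) F t) = \sum_(t <- r) lact a (F t).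
Proof. exact: (big_morph _ (lactDr a) (lact0r a)). Qed.

Lemma lact_suml (T : Type) (r : seq T) (F : T -> A) (v : V) :
  lact (\sum_(t <- r) F t) v = \sum_(t <- r) lact (F t) v.
Proof. exact: (big_morph _ (lactDl v) (lact0l v)). Qed.

Lemma lactM a b (v : V) : lact (a * b) v = lact a (lact b v).
Proof. by have [x ->] := lclassP v; rewrite !lact_class mulrA. Qed.

Lemma lact1 (v : V) : lact 1 v = v.
Proof. by have [x ->] := lclassP v; rewrite lact_class mul1r. Qed.

Definition rstable (b : A) := forall x, x \in J -> x * b \in J.

Lemma ract_class b x : rstable b -> ract (cl x) b = cl (x * b).
Proof.
by move=> sb; apply/lclass_eq; rewrite -mulrBl; apply/sb/repr_lclass.
Qed.

Lemma rstable_gen b : (forall i, g i * b \in J) -> rstable b.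
Proof.
move=> gb; apply: lidealP => [|x y|a i]; rewrite ?mul0r ?rpred0 //.
  by rewrite mulrDl => *; rewrite rpredD.
by rewrite -mulrA; apply/lidealMl/gb.
Qed.

End LquotTheory.

Section RidealTheory.
Variables (A : nzRingType) (n : nat) (g : 'I_n -> A).
Local Notation J := (rideal g).

Lemma rideal_gen i : g i \in J.
Proof.
apply/asboolP; exists (fun j => (j == i)%:R).
rewrite (bigD1 i) //= eqxx mulr1 big1 ?addr0 // => j /negPf->.
by rewrite mulr0.
Qed.

Lemma rideal0 : 0 \in J.
Proof. by apply/asboolP; exists (fun=> 0); rewrite big1 // => i _; rewrite mulr0. Qed.

Lemma ridealD x y : x \in J -> y \in J -> x + y \in J.
Proof.
move=> /asboolP[a ->] /asboolP[b ->]; apply/asboolP; exists (fun i => a i + b i).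
by rewrite -big_split; apply: eq_bigr => i _; rewrite mulrDr.
Qed.

Lemma ridealMr a x : x \in J -> x * a \in J.
Proof.
move=> /asboolP[b ->]; apply/asboolP; exists (fun i => b i * a).
by rewrite mulr_suml; apply: eq_bigr => i _; rewrite mulrA.
Qed.

End RidealTheory.

Lemma ridealZ (F : comNzRingType) (A : algType F) (n : nat) (g : 'I_n -> A) a x :
  x \in rideal g -> a *: x \in rideal g.
Proof. by move=> Jx; rewrite -mulr_algr; exact: ridealMr. Qed.

Lemma rideal_morph (A B : nzRingType) (h : {rmorphism A -> B}) (n : nat)
    (g : 'I_n -> A) x :
  x \in rideal g -> h x \in rideal (h \o g).
Proof.
move=> /asboolP[a ->]; apply/asboolP; exists (h \o a).
by rewrite rmorph_sum; apply: eq_bigr => i _; rewrite rmorphM.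
Qed.

Lemma lideal_morph (A B : nzRingType) (h : {rmorphism A -> B}) (n : nat)
    (g : 'I_n -> A) x :
  x \in lideal g -> h x \in lideal (h \o g).
Proof.
move=> /asboolP[a ->]; apply/asboolP; exists (h \o a).
by rewrite rmorph_sum; apply: eq_bigr => i _; rewrite rmorphM.
Qed.

(* The operators e, kk, k', b stand for e_alpha, q^{h_alpha}, q^{-h_alpha} and
   [h_alpha]_q; r m k is the ratio [eta_i - eta_m] / [eta_i - eta_k], which
   vanishes for m = i. *)
Lemma triangular_recursion (K : comNzRingType) (V : lmodType K) (T : eqType)
    (D : seq T) (M : pred T) (h : T -> nat)
    (e kk k' b : {linear V -> V}) (phi : T -> T -> {linear V -> V})
    (p r : T -> T -> K) (psi Z : T -> V) (B E E' G : T -> K) :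
  {subset D <= M} ->
  (forall m, M m -> Z m = psi m + \sum_(j <- D) B j *: phi m j (Z j)) ->
  (forall m, M m -> e (psi m) = - \sum_(k <- D) p m k *: k' (psi k)) ->
  (forall m j v, M m -> j \in D -> e (phi m j v) = phi m j (e v) + p m j *: b v
     + \sum_(k <- D) p k j *: phi m k (kk v)
     - \sum_(k <- D) p m k *: k' (phi k j v)) ->
  (forall m j v, M m -> j \in D -> (h m <= h j)%N -> phi m j v = 0) ->
  (forall j, j \in D -> kk (Z j) = E j *: Z j) ->
  (forall j, j \in D -> k' (Z j) = E' j *: Z j) ->
  (forall j, j \in D -> b (Z j) = G j *: Z j) ->
  (forall k j, k \in D -> j \in D -> p k j * (E j * B j) = p k j * (r k j * B k)) ->
  (forall m j, M m -> j \in D -> p m j * (G j * B j - E' j) = - (p m j * r m j)) ->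
  forall m, M m -> e (Z m) = - \sum_(k <- D) (p m k * r m k) *: Z k.
Proof.
move=> DM Zrec epsi ephi hphi kkZ k'Z bZ pr1 pr2 m.
have [N] := ubnP (h m); elim: N => // N IH in m * => hm Mm.
rewrite Zrec // linearD /= epsi //.
have -> : e (\sum_(j <- D) B j *: phi m j (Z j)) =
    \sum_(j <- D) (p m j * (G j * B j)) *: Z j
    - \sum_(k <- D) p m k *: k' (\sum_(j <- D) B j *: phi k j (Z j)).
  have -> : e (\sum_(j <- D) B j *: phi m j (Z j)) =
     \sum_(j <- D) (p m j * (G j * B j)) *: Z j
     - \sum_(j <- D) \sum_(k <- D) (B j * p m k) *: k' (phi k j (Z j))
     + (\sum_(j <- D) \sum_(k <- D) (B j * (p k j * E j)) *: phi m k (Z j)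
        - \sum_(j <- D) \sum_(k <- D) (B j * (p j k * r j k)) *: phi m j (Z k)).
    rewrite linear_sum -!sumrB -big_split /= !big_seq; apply: eq_bigr => j jD.
    rewrite linearZ /= ephi // bZ //.
    have -> : phi m j (e (Z j)) = - \sum_(k <- D) (p j k * r j k) *: phi m j (Z k).
      (* The induction hypothesis is available only for j of smaller height; otherwise [phi m j]
         vanishes on both sides. *)
      have [hmj|hjm] := leqP (h m) (h j).
        rewrite hphi // big_seq big1 ?oppr0 // => k kD.
        by rewrite hphi // scaler0.
      rewrite (IH j (leq_trans hjm hm) (DM j jD)).
      rewrite raddfN; congr -%R; rewrite raddf_sum /=.
      by apply: eq_bigr => k _; rewrite linearZ.
    rewrite kkZ // !scalerDr !scalerN [LHS](ACl (2*4*3*1)%AC) /= [RHS]addrA.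
    congr (_ + _); [congr (_ + _); [congr (_ + _)|]|]; rewrite ?scaler_sumr.
    - by rewrite !scalerA mulrCA [B j * _]mulrC.
    - by congr -%R; apply: eq_bigr => k _; rewrite scalerA.
    - apply: eq_bigr => k _.
      have -> : phi m k (E j *: Z j) = E j *: phi m k (Z j) by rewrite linearZ.
      by rewrite !scalerA mulrA.
    - by congr -%R; apply: eq_bigr => k _; rewrite scalerA.
  (* With the indices of the last double sum swapped, both double sums run over phi_mk Z_j, and the
     first scalar identity makes their coefficients equal. *)
  rewrite [X in _ + (_ - X)]exchange_big /= -[in X in _ + X]sumrB.
  rewrite [X in _ + X]big_seq [X in _ + X]big1 ?addr0 => [|j jD]; last first.
    rewrite -sumrB big_seq big1 // => k kD; rewrite -scalerBl.
    suff -> : B j * (p k j * E j) - B k * (p k j * r k j) = 0 by rewrite scale0r.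
    apply/eqP; rewrite subr_eq0; apply/eqP.
    by rewrite mulrCA [B j * _]mulrC pr1 // [RHS]mulrCA [B k * _]mulrC.
  congr (_ - _); rewrite exchange_big /=; apply: eq_bigr => k _.
  rewrite linear_sum scaler_sumr; apply: eq_bigr => j _.
  by rewrite linearZ /= scalerA mulrC.
rewrite addrCA -opprD -big_split /=.
(* Together psi_k and the inner sum form Z_k by the recursion, and on Z_k the operator k' is the
   scalar E' k. *)
have -> : \sum_(k <- D) (p m k *: k' (psi k) +
    p m k *: k' (\sum_(j <- D) B j *: phi k j (Z j))) =
    \sum_(k <- D) (p m k * E' k) *: Z k.
  rewrite !big_seq; apply: eq_bigr => k kD.
  rewrite -scalerDr; set S := \sum_(j <- D) _.
  have -> : k' (psi k) + k' S = k' (Z k) by rewrite (Zrec k (DM k kD)) raddfD.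
  by rewrite k'Z // scalerA.
rewrite -sumrB -sumrN !big_seq; apply: eq_bigr => k kD.
by rewrite -scalerBl -mulrBr pr2 // scaleNr.
Qed.

(** A subspace of maximal dimension inside Q absorbs every x satisfying Q, since adjoining x would
    enlarge it. This turns a linear predicate into a [vspace], the form in which [e_gen] and [f_gen]
    can be applied. *)
Lemma vspace_of_closed (F : fieldType) (V : vectType F) (Q : V -> Prop) :
  Q 0 -> (forall a x y, Q x -> Q y -> Q (a *: x + y)) ->
  exists S : {vspace V}, forall x, x \in S <-> Q x.
Proof.
move=> Q0 QL.
pose A n := `[< exists2 S : {vspace V}, \dim S = n & forall x, x \in S -> Q x >].
have A0 : exists n, A n.
  exists 0%N; apply/asboolP; exists 0%VS; first by rewrite dimv0.
  by move=> x; rewrite memv0 => /eqP->.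
have Ab n : A n -> (n <= \dim {:V})%N.
  by move=> /asboolP[S <- _]; rewrite dimvS // subvf.
case: (ex_maxnP A0 Ab) => n /asboolP[S dimS SQ] maxn.
exists S => x; split; first exact: SQ.
move=> Qx; apply: contraPT isT => xS.
have /maxn : A (\dim (S + <[x]>)%VS).
  apply/asboolP; exists (S + <[x]>)%VS => // _ /memv_addP[u uS [_ /vlineP[a ->] ->]].
  by rewrite addrC; apply: QL => //; exact: SQ.
rewrite -dimS => le_dim; move/negP: xS; case.
have /eqP-> : S == (S + <[x]>)%VS by rewrite eqEdim addvSl.
exact: (subvP (addvSr _ _)) (memv_line x).
Qed.

(** * Structure constants and the Killing form *)

Section Trace.
Variables (F : fieldType) (V : vectType F).

Definition vtrace (f : V -> V) : F :=
  \sum_(i < \dim {:V}) coord (vbasis {:V}) i (f (vbasis {:V})`_i).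

Let bE (x : V) : x = \sum_(i < \dim {:V}) coord (vbasis {:V}) i x *: (vbasis {:V})`_i.
Proof. by apply: coord_vbasis; exact: memvf. Qed.

(** The family need not be known to be free: any expansion of the identity as a sum of rank one maps
    computes the trace. This allows taking the trace over the root decomposition directly. *)
Lemma vtrace_resolution (K : Type) (r : seq K) (v : K -> V) (xi : K -> V -> F)
    (f : V -> V) :
  (forall k, linear (xi k : V -> F^o)) -> linear f ->
  (forall x, x = \sum_(k <- r) xi k x *: v k) ->
  vtrace f = \sum_(k <- r) xi k (f (v k)).
Proof.
move=> xiL fL res.
pose fM := GRing.isLinear.Build F V V *:%R f fL.
pose g : {linear V -> V} := HB.pack f fM.
have xiE k x : xi k x = \sum_(i < \dim {:V})
    coord (vbasis {:V}) i x * xi k (vbasis {:V})`_i.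
  pose xM := GRing.isLinear.Build F V F^o *:%R (xi k : V -> F^o) (xiL k).
  pose h : {linear V -> F^o} := HB.pack (xi k : V -> F^o) xM.
  rewrite {1}[x]bE -[xi k]/(h : V -> F^o) linear_sum.
  by apply: eq_bigr => i _; rewrite linearZ.
under [RHS]eq_bigr => k _ do rewrite xiE.
rewrite exchange_big; apply: eq_bigr => i _.
rewrite {1}[(vbasis _)`_i]res -[f]/(g : V -> V) !linear_sum.
by apply: eq_bigr => k _; rewrite !linearZ /= mulrC.
Qed.

Lemma vtrace_cyclic (f g : V -> V) : linear f -> linear g ->
  vtrace (f \o g) = vtrace (g \o f).
Proof.
move=> fL gL.
pose fM := GRing.isLinear.Build F V V *:%R f fL.
pose f' : {linear V -> V} := HB.pack f fM.
pose gM := GRing.isLinear.Build F V V *:%R g gL.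
pose g' : {linear V -> V} := HB.pack g gM.
have E (u w : {linear V -> V}) : vtrace (u \o w) =
    \sum_(i < \dim {:V}) \sum_(j < \dim {:V})
      coord (vbasis {:V}) j (w (vbasis {:V})`_i)
      * coord (vbasis {:V}) i (u (vbasis {:V})`_j).
  apply: eq_bigr => i _ /=; rewrite {1}[w _]bE !linear_sum.
  by apply: eq_bigr => j _; rewrite !linearZ.
rewrite -[f]/(f' : V -> V) -[g]/(g' : V -> V) !E exchange_big.
by apply: eq_bigr => i _; apply: eq_bigr => j _; rewrite mulrC.
Qed.

End Trace.

Section LieTheory.
Variables (F : fieldType) (L : lieAlg F).
Implicit Types x y z : L.

HB.instance Definition _ x := GRing.isLinear.Build F L L *:%R (br x) (br_linr x).

Lemma brC x y : br x y = - br y x.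
Proof.
apply/eqP; rewrite -addr_eq0; apply/eqP.
have Dl a b c : br (a + b) c = br a c + br b c.
  by have := br_linl c 1 a b; rewrite !scale1r.
by have := br_alt (x + y); rewrite Dl !raddfD /= !br_alt add0r addr0.
Qed.

Lemma brDl x y z : br (x + y) z = br x z + br y z.
Proof. by rewrite (brC (x + y)) (brC x) (brC y) raddfD opprD. Qed.

Lemma brZl a x z : br (a *: x) z = a *: br x z.
Proof. by rewrite (brC (a *: x)) (brC x) linearZ scalerN. Qed.

Lemma jacobi x y z : br x (br y z) = br (br x y) z + br y (br x z).
Proof.
rewrite (brC (br x y)) (brC x z) raddfN -opprD; apply/eqP.
by rewrite -addr_eq0 addrCA addrC br_jacobi.
Qed.

Lemma killingE x y : killing x y = vtrace (br x \o br y).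
Proof. by []. Qed.

Lemma comp_br_linear x y : linear (br x \o br y).
Proof. by move=> a u v /=; rewrite !linearP. Qed.

Lemma killingC x y : killing x y = killing y x.
Proof. by rewrite !killingE vtrace_cyclic //; exact: br_linr. Qed.

Lemma killing_linr x : linear (killing x : L -> F^o).
Proof.
move=> a y z; rewrite /killing scaler_sumr -big_split; apply: eq_bigr => i _.
by rewrite brDl brZl !linearP.
Qed.

HB.instance Definition _ x :=
  GRing.isLinear.Build F L F^o *:%R (killing x) (killing_linr x).

Lemma killingZl a x y : killing (a *: x) y = a * killing x y.
Proof. by rewrite killingC linearZ /= (killingC x). Qed.

Lemma killingDl x y z : killing (x + y) z = killing x z + killing y z.
Proof. by rewrite killingC raddfD /= !(killingC z). Qed.

Lemma killingZr a x y : killing x (a *: y) = a * killing x y.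
Proof. by rewrite linearZ. Qed.

Lemma killingDr x y z : killing x (y + z) = killing x y + killing x z.
Proof. by rewrite raddfD. Qed.

Lemma killingNr x y : killing x (- y) = - killing x y.
Proof. by rewrite raddfN. Qed.

Lemma killing_sumr (T : Type) (r : seq T) (Q : pred T) (f : T -> L) x :
  killing x (\sum_(t <- r | Q t) f t) = \sum_(t <- r | Q t) killing x (f t).
Proof. by rewrite raddf_sum. Qed.

(** Both sides contain tr(XYZ), and the remaining terms tr(YXZ) and tr(XZY) agree by cyclicity. *)
Lemma killing_br x y z : killing (br x y) z = killing x (br y z).
Proof.
have vB (f g : L -> L) : vtrace (fun t => f t - g t) = vtrace f - vtrace g.
  by rewrite /vtrace -sumrB; apply: eq_bigr => i _; rewrite raddfB.
rewrite !killingE.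
have -> : br (br x y) \o br z =
    (fun t => (br x \o (br y \o br z)) t - (br y \o (br x \o br z)) t).
  by apply: funext => t /=; rewrite (jacobi x y) addrK.
have -> : br x \o br (br y z) =
    (fun t => (br x \o (br y \o br z)) t - ((br x \o br z) \o br y) t).
  by apply: funext => t /=; rewrite -raddfB /= (jacobi y z) addrK.
rewrite !vB; congr (_ - _); apply: vtrace_cyclic; first exact: br_linr.
exact: comp_br_linear.
Qed.

Section RootSpaces.
Variable H : {vspace L}.
Implicit Types l m : dualvs H.

Lemma root_space_br l m x y : in_root_space l x -> in_root_space m y ->
  in_root_space (l + m) (br x y).
Proof.
by move=> xl ym t; rewrite jacobi xl ym brZl linearZ /= -scalerDl add_lfunE.
Qed.

Lemma root_space_orthogonal l m x y : in_root_space l x -> in_root_space m y ->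
  l + m != 0 -> killing x y = 0.
Proof.
move=> xl ym; apply: contraNeq => kn; apply/eqP/lfunP => t.
have : killing (br (vsval t) x) y = - killing x (br (vsval t) y).
  by rewrite brC -scaleN1r killingZl mulN1r killing_br.
rewrite xl ym killingZl killingZr add_lfunE zero_lfunE => /eqP.
rewrite -addr_eq0 -mulrDl mulf_eq0 (negPf kn) orbF => /eqP lm0.
exact: lm0.
Qed.

End RootSpaces.

End LieTheory.

Section SsLieTheory.
Variables (F : numFieldType) (L : ssLie F).
Local Notation I := 'I_(rk L).
Local Notation hs := (hstar L).
Local Notation P := (posroots L).
Implicit Types (l m : hs) (s t : subvs_of (cartan L)) (x y : L).

Lemma eroot_space l : l \in P -> in_root_space l (eroot l).
Proof. by move=> Pl; apply/(erootP Pl); exists 1; rewrite scale1r. Qed.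

Lemma froot_space l : l \in P -> in_root_space (- l) (froot l).
Proof. by move=> Pl; apply/(frootP Pl); exists 1; rewrite scale1r. Qed.

Lemma cartan_space t : in_root_space (0 : hs) (vsval t).
Proof. by move=> s; rewrite zero_lfunE scale0r cartan_ab // subvsP. Qed.

Lemma wt_of_is_additive : zmod_morphism (@wt_of F L).
Proof.
move=> a b; rewrite /wt_of -sumrB; apply: eq_bigr => i _.
by rewrite !ffunE mulrzBr.
Qed.

HB.instance Definition _ :=
  GRing.isZmodMorphism.Build (rlat L) hs (@wt_of F L) wt_of_is_additive.

Lemma wt_of_salpha i : wt_of (salpha i) = alpha i :> hs.
Proof.
rewrite /wt_of (bigD1 i) //= ffunE eqxx big1 ?addr0 // => j /negPf nji.
by rewrite ffunE nji.
Qed.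

Lemma wt_of_inj : injective (@wt_of F L).
Proof.
apply: raddf_inj => b wb0; apply/ffunP => i; rewrite ffunE.
pose X := [tuple of [seq @alpha F L j | j : I]].
have fX : free X by rewrite (basis_free (alpha_basis L)).
pose j0 := cast_ord (esym (card_ord (rk L))) i.
have nthX j : X`_(cast_ord (esym (card_ord (rk L))) j) = alpha j :> hs.
  by rewrite (nth_map j) -?enumT ?size_enum_ord ?ltn_ord //= nth_ord_enum.
have : \sum_(j < #|I|) ((b (cast_ord (card_ord _) j))%:~R : F) *: X`_j = 0.
  rewrite -[RHS]wb0 /wt_of (reindex (cast_ord (esym (card_ord (rk L))))) /=.
    by apply: eq_bigr => j _; rewrite nthX cast_ordKV scaler_int.
  by exists (cast_ord (card_ord _)) => j _; rewrite ?cast_ordK ?cast_ordKV.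
move/freeP: fX => /[apply] /(_ j0); rewrite cast_ordKV => /eqP.
by rewrite intr_eq0 => /eqP.
Qed.

Lemma rcoordK b : rcoord (@wt_of F L b) = b.
Proof.
rewrite /rcoord; by case: xgetP => [c _ /wt_of_inj|/(_ b erefl)].
Qed.

Definition rpos (n : I -> nat) : rlat L := [ffun i => (n i)%:Z].

Lemma wt_of_rpos n : wt_of (rpos n) = \sum_i alpha i *+ n i.
Proof. by apply: eq_bigr => i _; rewrite ffunE -pmulrn. Qed.

Lemma posrootE l : l \in P -> exists2 n, l = wt_of (rpos n) & exists i, n i != 0%N.
Proof.
move=> /posrootsP[[l0 _] [n lE]]; exists n; first by rewrite wt_of_rpos.
apply: contrapT => n0; move/eqP: l0; apply; rewrite lE big1 // => i _.
have [->|ni] := eqVneq (n i) 0%N; first by rewrite mulr0n.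
by case: n0; exists i.
Qed.

Lemma addr_roots_neq0 l m : l \in P -> m \in P -> l + m != 0.
Proof.
move=> /posrootE[n -> [i ni]] /posrootE[p -> _]; rewrite -raddfD raddf_eq0;
  last exact: wt_of_inj.
apply/eqP => /ffunP /(_ i); rewrite !ffunE -PoszD => /eqP.
by rewrite eqz_nat addn_eq0 (negPf ni).
Qed.

(** Each of l and m has a positive coordinate on the simple roots. For the sum to be alpha_i both
    must sit at i, where they add up to at least 2. *)
Lemma alpha_neq_add i l m : l \in P -> m \in P -> alpha i != l + m :> hs.
Proof.
move=> /posrootE[n -> [j nj]] /posrootE[p -> [k pk]].
rewrite -wt_of_salpha -raddfD (inj_eq wt_of_inj).
apply/eqP => /ffunP E.
have En h : (n h + p h = (h == i))%N.
  by have := E h; rewrite !ffunE -PoszD => -[].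
have [ji|nji] := eqVneq j i; have [ki|nki] := eqVneq k i.
- have := En i; rewrite eqxx -{1}ji -{1}ki; case: (n j) nj => // a _.
  by case: (p k) pk => // c _; rewrite addSn addnS.
- by have /eqP := En k; rewrite (negPf nki) addn_eq0 (negPf pk) andbF.
- by have /eqP := En j; rewrite (negPf nji) addn_eq0 (negPf nj).
- by have /eqP := En j; rewrite (negPf nji) addn_eq0 (negPf nj).
Qed.

Lemma killing_ee l m : l \in P -> m \in P -> killing (eroot l) (eroot m) = 0.
Proof.
move=> lP mP; apply: root_space_orthogonal (eroot_space lP) (eroot_space mP) _.
exact: addr_roots_neq0.
Qed.

Lemma killing_ff l m : l \in P -> m \in P -> killing (froot l) (froot m) = 0.
Proof.
move=> lP mP; apply: root_space_orthogonal (froot_space lP) (froot_space mP) _.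
by rewrite -opprD oppr_eq0 addr_roots_neq0.
Qed.

Lemma killing_ef l m : l \in P -> m \in P ->
  killing (eroot l) (froot m) = (l == m)%:R.
Proof.
move=> lP mP; have [<-|nlm] := eqVneq; first exact: ef_root.
apply: root_space_orthogonal (eroot_space lP) (froot_space mP) _.
by rewrite subr_eq0.
Qed.

Lemma posroot_neq0 l : l \in P -> l != 0.
Proof. by move=> /posrootsP[[]]. Qed.

Lemma killing_te t l : l \in P -> killing (vsval t) (eroot l) = 0.
Proof.
move=> lP; apply: root_space_orthogonal (cartan_space t) (eroot_space lP) _.
by rewrite add0r posroot_neq0.
Qed.

Lemma killing_tf t l : l \in P -> killing (vsval t) (froot l) = 0.
Proof.
move=> lP; apply: root_space_orthogonal (cartan_space t) (froot_space lP) _.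
by rewrite add0r oppr_eq0 posroot_neq0.
Qed.

(** [ss_decomp] gives some coefficients; pairing with the opposite root vectors identifies them as
    values of the Killing form, hence as linear functions of x. *)
Lemma root_decomposition x : exists t, x = vsval t +
  \sum_(l <- P) (killing x (froot l) *: eroot l + killing x (eroot l) *: froot l).
Proof.
have [t [a [b xE]]] := ss_decomp x; exists t.
rewrite {1}xE; congr (_ + _); apply: eq_big_seq => l lP.
have sumP (c : hs -> F) (g : hs -> F) :
    (forall m, m \in P -> g m = c m * (m == l)%:R) -> \sum_(m <- P) g m = c l.
  move=> gE; rewrite (bigD1_seq l) ?posroots_uniq //= gE // eqxx mulr1.
  rewrite big_seq_cond big1 ?addr0 // => m /andP[mP /negPf nml].
  by rewrite gE // nml mulr0.
congr (_ *: _ + _ *: _); rewrite killingC {1}xE killingDr killing_sumr; symmetry.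
  rewrite killingC killing_tf // add0r; apply: sumP => m mP.
  rewrite killingDr !killingZr killing_ff // mulr0 addr0 killingC.
  by rewrite killing_ef.
rewrite killingC killing_te // add0r; apply: sumP => m mP.
rewrite killingDr !killingZr killing_ee // mulr0 add0r.
by rewrite killing_ef // eq_sym.
Qed.

Lemma cartan_eq t s : (forall l, l t = l s) -> t = s.
Proof.
move=> E; rewrite [t](coord_vbasis (memvf t)) [s](coord_vbasis (memvf s)).
apply: eq_bigr => i _; congr (_ *: _).
by have := E (linfun (coord (vbasis fullv) i : _ -> F^o)); rewrite !lfunE.
Qed.

(** Every functional on the Cartan subalgebra is a Killing pairing with some [hvec l], and
    functionals separate points. *)
Lemma killing_cartan_inj t s :
  (forall u : subvs_of (cartan L), killing (vsval t) (vsval u) = killing (vsval s) (vsval u)) -> t = s.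
Proof.
move=> E; apply: cartan_eq => l.
by rewrite -!hvecP killingC E killingC.
Qed.

Lemma cartan_part x t l : in_root_space l x -> l != 0 ->
  x = vsval t +
  \sum_(l <- P) (killing x (froot l) *: eroot l + killing x (eroot l) *: froot l) ->
  t = 0.
Proof.
move=> xl l0 xE; apply: killing_cartan_inj => u.
have : killing (vsval u) x = 0.
  apply: root_space_orthogonal (cartan_space u) xl _.
  by rewrite add0r.
rewrite xE killingDr killing_sumr big_seq big1 ?addr0 => [ut0|m mP].
  by rewrite killingC ut0 [RHS]killingC !raddf0.
by rewrite killingDr !killingZr killing_te // killing_tf // !mulr0 addr0.
Qed.

End SsLieTheory.

(** * Brackets of root vectors and the form on weights *)

Section SsLieBrackets.
Variables (F : numFieldType) (L : ssLie F).
Local Notation I := 'I_(rk L).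
Local Notation hs := (hstar L).
Local Notation P := (posroots L).
Implicit Types (l m : hs) (s t : subvs_of (cartan L)) (x y : L).

Lemma root_decomposition0 x l : in_root_space l x -> l != 0 ->
  x = \sum_(l <- P) (killing x (froot l) *: eroot l + killing x (eroot l) *: froot l).
Proof.
move=> xl l0; have [t xE] := root_decomposition x.
by rewrite {1}xE (cartan_part xl l0 xE) raddf0 add0r.
Qed.

Lemma br_cartan_e t l : l \in P -> br (vsval t) (eroot l) = l t *: eroot l.
Proof. by move/eroot_space; exact. Qed.

Lemma br_cartan_f t l : l \in P -> br (vsval t) (froot l) = - l t *: froot l.
Proof. by move/froot_space => ->; rewrite opp_lfunE. Qed.

Lemma br_ef l : l \in P -> br (eroot l) (froot l) = vsval (hvec l).
Proof.
move=> lP; have x0 := root_space_br (eroot_space lP) (froot_space lP).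
rewrite subrr in x0; have [t xE] := root_decomposition (br (eroot l) (froot l)).
rewrite big_seq big1 ?addr0 in xE => [|m mP]; last first.
  rewrite (root_space_orthogonal x0 (froot_space mP)) ?add0r ?oppr_eq0 ?posroot_neq0 //.
  rewrite (root_space_orthogonal x0 (eroot_space mP)) ?add0r ?posroot_neq0 //.
  by rewrite !scale0r addr0.
rewrite xE; congr vsval; apply: killing_cartan_inj => u.
rewrite -xE hvecP killing_br brC br_cartan_f // scaleNr opprK killingZr.
by rewrite ef_root // mulr1.
Qed.

(** For l != alpha the difference alpha - l is not a positive root, alpha being simple, so only
    vectors [froot m] survive. Invariance rewrites their coefficients as the structure constants
    that occur in [br_e_alpha]; this coincidence is what makes the classical phi satisfy its
    commutation relation. *)
Lemma br_alpha_f i l : l \in P ->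
  br (eroot (alpha i)) (froot l) = (l == alpha i)%:R *: vsval (hvec (alpha i)) +
    \sum_(m <- P) killing (br (eroot m) (eroot (alpha i))) (froot l) *: froot m.
Proof.
move=> lP; have aP := @alpha_pos F L i.
have xl := root_space_br (eroot_space aP) (froot_space lP).
have K m : killing (br (eroot m) (eroot (alpha i))) (froot l) =
    killing (br (eroot (alpha i)) (froot l)) (eroot m).
  by rewrite killing_br killingC.
have [lE|nl] := eqVneq l (alpha i).
  rewrite lE br_ef // scale1r big_seq big1 ?addr0 // => m mP.
  by have := K m; rewrite lE => ->; rewrite br_ef // killing_te // scale0r.
rewrite scale0r add0r {1}[br _ _](root_decomposition0 xl) ?subr_eq0 1?eq_sym //.
apply: eq_big_seq => m mP; rewrite K (root_space_orthogonal xl (froot_space mP)).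
  by rewrite scale0r add0r.
by rewrite -addrA -opprD subr_eq0 alpha_neq_add.
Qed.

Lemma br_e_alpha i m : m \in P ->
  br (eroot m) (eroot (alpha i)) =
  \sum_(l <- P) killing (br (eroot m) (eroot (alpha i))) (froot l) *: eroot l.
Proof.
move=> mP; have aP := @alpha_pos F L i.
have xl := root_space_br (eroot_space mP) (eroot_space aP).
rewrite {1}[br _ _](root_decomposition0 xl) ?addr_roots_neq0 //.
apply: eq_big_seq => l lP; rewrite (root_space_orthogonal xl (eroot_space lP)).
  by rewrite scale0r addr0.
move/posrootE: mP => [p -> [k pk]]; move/posrootE: lP => [n -> [j nj]].
rewrite -wt_of_salpha -!raddfD raddf_eq0; last exact: wt_of_inj.
apply/eqP => /ffunP /(_ k); rewrite !ffunE -!PoszD => /eqP.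
by rewrite eqz_nat !addn_eq0 (negPf pk).
Qed.

Lemma hvec_is_linear : linear (@hvec F L).
Proof.
move=> a l m; apply: killing_cartan_inj => u.
rewrite hvecP linearP /= killingDl killingZl !hvecP.
by rewrite add_lfunE scale_lfunE.
Qed.

HB.instance Definition _ := GRing.isLinear.Build F (dualvs (cartan L))
  (subvs_of (cartan L)) *:%R (@hvec F L) hvec_is_linear.

Lemma formE l m : form l m = l (hvec m).
Proof. by rewrite /form hvecP. Qed.

Lemma formC l m : form l m = form m l.
Proof. exact: killingC. Qed.

Lemma form_linl m : linear ((fun l => form l m) : hs -> F^o).
Proof. by move=> a l l'; rewrite !formE add_lfunE scale_lfunE. Qed.

Lemma formDl l l' m : form (l + l') m = form l m + form l' m.
Proof. by have := form_linl m 1 l l'; rewrite !scale1r. Qed.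

Lemma form0l m : form 0 m = 0.
Proof. by rewrite formE zero_lfunE. Qed.

Lemma formNl l m : form (- l) m = - form l m.
Proof. by rewrite !formE opp_lfunE. Qed.

Lemma formDr l m m' : form l (m + m') = form l m + form l m'.
Proof. by rewrite formC formDl !(formC l). Qed.

Lemma formNr l m : form l (- m) = - form l m.
Proof. by rewrite formC formNl (formC l). Qed.

Lemma formZr a l m : form l (a *: m) = a * form l m.
Proof. by rewrite formC formE scale_lfunE -formE formC. Qed.

Lemma form_sumr (T : Type) (r : seq T) (g : T -> hs) l :
  form l (\sum_(t <- r) g t) = \sum_(t <- r) form l (g t).
Proof. by apply: (big_morph (form l)); [exact: formDr|rewrite formC form0l]. Qed.

Lemma form_wt_of l b : form l (wt_of b) = \sum_i form l (alpha i) *~ b i.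
Proof.
rewrite /wt_of form_sumr; apply: eq_bigr => i _.
by rewrite -scaler_int formZr mulrzl.
Qed.

Lemma form_nondegenerate l : (forall i : I, form (alpha i) l = 0) -> l = 0.
Proof.
move=> E; apply/lfunP => t; rewrite zero_lfunE -hvecP.
suff -> : hvec l = 0 by rewrite raddf0 killingC raddf0.
apply: cartan_eq => m; rewrite linear0 -formE.
have mE := memvf m; rewrite -(span_basis (alpha_basis L)) in mE.
rewrite (coord_span mE) formC form_sumr big1 // => i _; rewrite formZr.
set v := _`_i; have /mapP[k _ ->] : v \in [seq @alpha F L j | j <- enum I].
  by apply: mem_nth; rewrite size_map -cardE ltn_ord.
by rewrite formC E mulr0.
Qed.

End SsLieBrackets.

(** * Trace identities for the form *)

Section SsLieForm.
Variables (F : numFieldType) (L : ssLie F).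
Local Notation I := 'I_(rk L).
Local Notation hs := (hstar L).
Local Notation P := (posroots L).
Implicit Types (l m : hs) (s t : subvs_of (cartan L)) (x y : L).

(** The Cartan subalgebra contributes 0 to the trace because it is abelian, and [eroot l] and
    [froot l] contribute l(s) l(t) each. *)
Lemma killing_cartan s t :
  killing (vsval s) (vsval t) = 2%:R * \sum_(l <- P) l s * l t.
Proof.
pose root_part x :=
  \sum_(l <- P) (killing x (froot l) *: eroot l + killing x (eroot l) *: froot l).
have rpL : linear root_part.
  move=> a x y; rewrite /root_part scaler_sumr -big_split; apply: eq_bigr => l _.
  by rewrite !killingDl !killingZl !scalerDl scalerDr !scalerA addrACA.
pose n := \dim (cartan L).
pose v (k : 'I_n + (hs + hs)) : L :=
  match k with inl j => (vbasis (cartan L))`_j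
  | inr (inl l) => eroot l | inr (inr l) => froot l end.
pose xi (k : 'I_n + (hs + hs)) x : F :=
  match k with inl j => coord (vbasis (cartan L)) j (x - root_part x)
  | inr (inl l) => killing x (froot l) | inr (inr l) => killing x (eroot l) end.
pose r : seq ('I_n + (hs + hs)) := map inl (index_enum 'I_n) ++
  (map (fun l => inr (inl l)) P ++ map (fun l => inr (inr l)) P).
have rE (W : zmodType) (g : _ -> W) : \sum_(k <- r) g k =
    \sum_(j < n) g (inl j) + \sum_(l <- P) (g (inr (inl l)) + g (inr (inr l))).
  rewrite /r !big_cat !big_map. by rewrite big_split.
rewrite killingE (@vtrace_resolution _ _ _ r v xi); first last.
- move=> x; rewrite rE /=; have [u xE] := root_decomposition x.
  have -> : x - root_part x = vsval u by rewrite {1}xE addrK.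
  by rewrite {1}xE; congr (_ + _); apply: coord_vbasis; exact: subvsP.
- exact: comp_br_linear.
- move=> [j|[l|l]] a x y /=; last 2 first.
  + by rewrite killingDl killingZl.
  + by rewrite killingDl killingZl.
  by rewrite rpL opprD addrACA -scalerBr linearD linearZ.
rewrite rE big1 => [|j _] /=; last first.
  have vj : (vbasis (cartan L))`_j \in cartan L.
    by apply: vbasis_mem; apply: mem_nth; rewrite size_tuple.
  rewrite [br (vsval t) _](cartan_ab (subvsP t) vj).
  rewrite raddf0 /root_part big1 ?subr0 ?raddf0 // => l _.
  by rewrite ![killing 0 _]killingC !raddf0 !scale0r addr0.
rewrite add0r mulr_sumr; apply: eq_big_seq => l lP.
rewrite br_cartan_e // br_cartan_f // !linearZ /= br_cartan_e // br_cartan_f //.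
rewrite !killingZl [killing (froot l) _]killingC ef_root // !mulr1.
by rewrite mulrNN -mulr2n mulr_natl [l s * _]mulrC.
Qed.

(* The commutator [ad e, ad f] = ad h_alpha, with e and f the root vectors of
   alpha and - alpha, has trace 0 on the span of the eroot l for l != alpha, which
   both operators preserve because alpha is simple. *)
Lemma form_alpha_rho i : form (alpha i) (rho L) = 2%:R^-1 * form (alpha i) (alpha i).
Proof.
pose e := eroot (alpha i : hs); pose f := froot (alpha i : hs).
have aP := @alpha_pos F L i.
pose M l m := killing (br e (eroot l)) (froot m).
pose N l m := killing (br f (eroot l)) (froot m).
(* The summand alpha of rho already gives the claimed value, so the other positive roots must
   contribute 0 in total. *)
rewrite /rho formZr form_sumr (bigD1_seq _ aP (posroots_uniq L)) /=.
rewrite [X in _ + X](_ : _ = 0) ?addr0 //.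
have expand (g : L) (b : bool) : in_root_space (if b then alpha i else - alpha i : hs) g ->
    forall l, l \in P -> l != alpha i ->
    br g (eroot l) = \sum_(m <- P | m != alpha i) killing (br g (eroot l)) (froot m) *: eroot m.
  move=> gb l lP nl; have xl := root_space_br gb (eroot_space lP).
  rewrite {1}[br g _](root_decomposition0 xl); last first.
    case: b {gb xl}; first exact: addr_roots_neq0.
    by rewrite addrC subr_eq0.
  rewrite [RHS]big_mkcond; apply: eq_big_seq => m mP.
  rewrite (root_space_orthogonal xl (eroot_space mP)); last first.
    case: b {gb xl}.
      rewrite -addrA addrC; move/posrootE: mP => [p -> [k pk]].
      move/posrootE: lP => [n -> _]; rewrite -wt_of_salpha -!raddfD raddf_eq0.
        apply/eqP => /ffunP /(_ k); rewrite !ffunE -!PoszD => /eqP.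
        by rewrite eqz_nat !addn_eq0 (negPf pk) andbF.
      exact: wt_of_inj.
    by rewrite -addrA addrC subr_eq0 eq_sym alpha_neq_add.
  (* It remains to see that e_alpha has coefficient 0. For g of weight alpha, pairing with f_alpha
     leaves the weight l, which is nonzero; for g a multiple of f, invariance moves the bracket onto
     [f, f] = 0. *)
  rewrite scale0r addr0; case: eqP => [mE|//]; rewrite mE.
  case: b gb xl => gb xl.
    rewrite (root_space_orthogonal xl (froot_space aP)) ?scale0r //.
    by rewrite addrAC subrr add0r posroot_neq0.
  move/(frootP aP): gb => [c ->].
  rewrite brZl killingZl brC -scaleN1r killingZl killing_br br_alt.
  by rewrite raddf0 !mulr0 scale0r.
have eE := expand e true (eroot_space aP).
have fE := expand f false (froot_space aP).
have lE l : l \in P -> l != alpha i -> form (alpha i) l =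
    \sum_(m <- P | m != alpha i) (N l m * M m l - M l m * N m l).
  move=> lP nl; rewrite formC formE.
  have -> : l (hvec (alpha i)) = killing (br (vsval (hvec (alpha i))) (eroot l)) (froot l).
    by rewrite br_cartan_e // killingZl ef_root // mulr1.
  rewrite -br_ef // -/e -/f.
  have -> : br (br e f) (eroot l) = br e (br f (eroot l)) - br f (br e (eroot l)).
    by rewrite (jacobi e f) addrK.
  rewrite {1}(fE l lP nl) {1}(eE l lP nl) !raddf_sum -big_split /= killingC killing_sumr.
  apply: eq_bigr => m _; rewrite killingDr killingNr [br e (_ *: _)]linearZ [br f (_ *: _)]linearZ /= !killingZr.
  by rewrite ![killing (froot l) _]killingC.
rewrite big_seq_cond; under eq_bigr => l /andP[lP nl] do rewrite lE //.
rewrite -big_seq_cond.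
under eq_bigr => l nl do rewrite sumrB.
(* The two traces tr(MN) and tr(NM) differ only by the names of the indices. *)
rewrite sumrB [X in X - _]exchange_big /=; apply/eqP; rewrite subr_eq0; apply/eqP.
by apply: eq_bigr => l _; apply: eq_bigr => m _; rewrite mulrC.
Qed.

(** Were (alpha, alpha) zero, the Cartan integers would make alpha orthogonal to every simple root,
    hence zero by nondegeneracy. *)
Lemma form_alpha_neq0 i : form (alpha i) (alpha i : hs) != 0.
Proof.
apply/eqP => f0; have /eqP := posroot_neq0 (@alpha_pos F L i); apply.
apply: form_nondegenerate => j; rewrite formC.
have := cmatP (s := L) i j; rewrite -/(form _ _) -/(form _ _) f0 mulr0 => /eqP.
by rewrite mulf_eq0 pnatr_eq0 => /eqP.
Qed.

Lemma form_alpha_wt_of i (b : rlat L) : exists c : int,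
  2%:R * form (alpha i) (wt_of b) = c%:~R * form (alpha i) (alpha i : hs).
Proof.
exists (\sum_j cmat i j * b j); rewrite form_wt_of mulr_sumr rmorph_sum mulr_suml.
apply: eq_bigr => j _; rewrite -mulrzr mulrA [2%:R * _](cmatP i j).
by rewrite rmorphM /= mulrAC.
Qed.

Lemma wt_of_integral (b : rlat L) : integral_wt (wt_of b : hs).
Proof. by move=> i; rewrite formC; exact: form_alpha_wt_of. Qed.

(* With (alpha, l) = c_l (alpha, alpha) / 2, the trace formula
   (alpha, alpha) = 2 sum_l (alpha, l)^2 gives (alpha, alpha) sum_l c_l^2 = 2. *)
Lemma form_alpha_rational i (b : rlat L) : exists (c : int) (n : nat),
  (0 < n)%N /\ form (alpha i) (wt_of b : hs) * n%:R = c%:~R.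
Proof.
pose a := form (alpha i) (alpha i : hs); have a0 : a != 0 by exact: form_alpha_neq0.
have [n [n0 an]] : exists n : nat, (0 < n)%N /\ a * n%:R = 2%:R.
  have rt l : l \in P -> exists c : int, 2%:R * form (alpha i) l = c%:~R * a.
    by move=> /posrootE[p -> _]; exact: form_alpha_wt_of.
  pose c l := if pselect (l \in P) is left lP then projT1 (cid (rt l lP)) else 0.
  have cE l : l \in P -> 2%:R * form (alpha i) l = (c l)%:~R * a.
    by move=> lP; rewrite /c; case: pselect => // ?; case: cid.
  pose n := absz (\sum_(l <- P) c l ^+ 2).
  have nE : (n%:R : F) = \sum_(l <- P) (c l)%:~R ^+ 2.
    rewrite /n natr_absz ger0_norm ?sumr_ge0 // => [|l _]; last exact: sqr_ge0.
    by rewrite rmorph_sum; apply: eq_bigr => l _; rewrite rmorphXn.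
  have E : a * (a * n%:R) = a * 2%:R.
    have aE : 2%:R * a = \sum_(l <- P) (c l)%:~R ^+ 2 * a ^+ 2.
      have aE : a = 2%:R * \sum_(l <- P) form (alpha i) l ^+ 2.
        by rewrite {1}/a /form killing_cartan; congr (_ * _); apply: eq_bigr => l _;
          rewrite killingC hvecP expr2.
      rewrite {1}aE mulrA mulr_sumr; apply: eq_big_seq => l lP.
      by rewrite -exprMn -cE // exprMn expr2.
    by rewrite nE [RHS]mulrC aE mulr_sumr mulr_sumr; apply: eq_bigr => l _;
      rewrite mulrA -expr2 mulrC.
  exists n; split; last exact: (mulfI a0).
  rewrite lt0n; apply/eqP => n0; move: E; rewrite n0 !mulr0 => /esym/eqP.
  by rewrite mulf_eq0 (negPf a0) pnatr_eq0.
have [c cE] := form_alpha_wt_of i b; exists c, n; split=> //.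
have two0 : (2%:R : F) != 0 by rewrite pnatr_eq0.
by apply: (mulfI two0); rewrite mulrA cE -/a -mulrA an mulrC.
Qed.

Lemma exists_form_alpha_neq0 (b : rlat L) : b != 0 ->
  exists i, form (alpha i) (wt_of b : hs) != 0.
Proof.
move=> b0; apply: contrapT => nf; move/eqP: b0; apply; apply: wt_of_inj.
rewrite raddf0; apply: form_nondegenerate => i; apply: contrapT => /eqP fi.
by apply: nf; exists i.
Qed.

End SsLieForm.

(** * The Cartan part of the enveloping algebra *)

Section QuantumPowers.
Variable R : realType.
Local Notation C := (R[i]).

Lemma cexpD (z w : C) : cexp (z + w) = cexp z * cexp w.
Proof.
case: z w => [a b] [c d]; apply/eqP; rewrite eq_complex /=.
rewrite expRD cosD sinD; apply/andP; split; apply/eqP; ring.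
Qed.

Lemma cexp0 : cexp (0 : C) = 1.
Proof. by apply/eqP; rewrite eq_complex /= expR0 cos0 sin0 mulr1 mulr0 !eqxx. Qed.

Lemma qpwD (h z w : C) : qpw h (z + w) = qpw h z * qpw h w.
Proof. by rewrite /qpw mulrDr cexpD. Qed.

Lemma qpw0 (h : C) : qpw h 0 = 1.
Proof. by rewrite /qpw mulr0 cexp0. Qed.

Lemma qpwN (h z : C) : qpw h z * qpw h (- z) = 1.
Proof. by rewrite -qpwD subrr qpw0. Qed.

Lemma qpwMn (h z : C) n : qpw h (z * n%:R) = qpw h z ^+ n.
Proof.
elim: n => [|n IH]; first by rewrite mulr0 qpw0 expr0.
by rewrite -natr1 mulrDr mulr1 qpwD IH exprSr.
Qed.

(** If q^z = 1, then q^c = (q^z)^n = 1 with c = n z a nonzero integer, which makes q a root of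
    unity. *)
Lemma qpw_rational_neq1 (h z : C) (c : int) (n : nat) :
  (forall n : nat, qpw h 1 ^+ n.+1 != 1) -> (0 < n)%N -> z * n%:R = c%:~R ->
  z != 0 -> qpw h z != 1.
Proof.
move=> root1 n0 zc z0; apply/eqP => qz.
have : qpw h c%:~R = 1 by rewrite -zc qpwMn qz expr1n.
have c0 : c != 0.
  apply: contraNneq z0 => c0; move/eqP: zc; rewrite c0 mulf_eq0 pnatr_eq0.
  by case/orP => // /eqP n00; rewrite n00 in n0.
case: c c0 {zc} => [[//|m]|m] _.
  by rewrite -pmulrn => E; have := root1 m; rewrite -qpwMn mul1r E eqxx.
rewrite NegzE rmorphN /= => E; have := root1 m; rewrite -qpwMn mul1r.
by rewrite -[X in X != _]mulr1 -[X in _ * X]E -pmulrn qpwN eqxx.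
Qed.

Lemma q_diff_neq0 (h : C) : (forall n : nat, qpw h 1 ^+ n.+1 != 1) ->
  qpw h 1 - qpw h (- 1) != 0.
Proof.
move=> /(_ 1%N); apply: contraNneq => /eqP; rewrite subr_eq0 => /eqP E.
by rewrite expr2 {2}E qpwN.
Qed.

End QuantumPowers.

Section SubalgMorphism.
Variables (C : comNzRingType) (A : algType C) (G : set A).
Local Notation ins := (insubalg G).

Lemma subalg_valZ a (x : subalg G) : val (a *: x) = a *: val x.
Proof. exact: linearZ. Qed.

Lemma subalg_valM (x y : subalg G) : val (x * y) = val x * val y.
Proof. exact: rmorphM. Qed.

Lemma subalg_val0 : val (0 : subalg G) = 0.
Proof. exact: raddf0. Qed.

Lemma subalg_valB (x y : subalg G) : val (x - y) = val x - val y.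
Proof. exact: raddfB. Qed.

Lemma subalg_val_sum (T : Type) (r : seq T) (Q : pred T) (g : T -> subalg G) :
  val (\sum_(t <- r | Q t) g t) = \sum_(t <- r | Q t) val (g t).
Proof. exact: raddf_sum. Qed.

Lemma insubalg1 : ins 1 = 1.
Proof. by apply: val_inj; rewrite insubalgK ?rpred1 ?rmorph1. Qed.

Lemma insubalgM x y : x \in gensub G -> y \in gensub G -> ins (x * y) = ins x * ins y.
Proof. by move=> Gx Gy; apply: val_inj; rewrite rmorphM /= !insubalgK ?rpredM. Qed.

Lemma insubalgD x y : x \in gensub G -> y \in gensub G -> ins (x + y) = ins x + ins y.
Proof. by move=> Gx Gy; apply: val_inj; rewrite raddfD /= !insubalgK ?rpredD. Qed.

Lemma insubalgZ a x : x \in gensub G -> ins (a *: x) = a *: ins x.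
Proof. by move=> Gx; apply: val_inj; rewrite linearZ /= !insubalgK ?rpredZ. Qed.

Lemma insubalgB x y : x \in gensub G -> y \in gensub G -> ins (x - y) = ins x - ins y.
Proof. by move=> Gx Gy; apply: val_inj; rewrite raddfB /= !insubalgK ?rpredB. Qed.

End SubalgMorphism.

Section Cartan.
Variables (R : realType) (L : ssLie R[i]) (U : envelope L).
Local Notation C := (R[i]).
Local Notation I := 'I_(rk L).
Local Notation hs := (hstar L).
Local Notation aff := (affh L).

(** Outside the root lattice [rcoord], and with it [qexpU] in the quantum case, takes a junk value;
    the rules for powers of q are therefore stated under this predicate. *)
Definition root_lattice (x : aff) := exists b : rlat L, x.1 = wt_of b.

Lemma root_latticeN x : root_lattice x -> root_lattice (- x).
Proof. by move=> [b xb]; exists (- b); rewrite [RHS]raddfN /= -xb. Qed.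

Lemma root_lattice_alpha i c : root_lattice (alpha i : hs, c).
Proof. by exists (salpha i); rewrite wt_of_salpha. Qed.

Lemma kpow_single (k k' : I -> U) i (n : int) :
  kpow k k' [ffun j => if j == i then n else 0] =
  match n with Posz n => k i ^+ n | Negz n => k' i ^+ n.+1 end.
Proof.
rewrite /kpow.
have E (r : seq I) : uniq r ->
   \prod_(j <- r) (match [ffun j => if j == i then n else 0] j with
      Posz n => k j ^+ n | Negz n => k' j ^+ n.+1 end) =
   if i \in r then match n with Posz n => k i ^+ n | Negz n => k' i ^+ n.+1 end else 1.
  elim: r => [|j r IH] /=; first by rewrite big_nil.
  move=> /andP[jr ur]; rewrite big_cons {}IH // ffunE in_cons [i == j]eq_sym.
  case: eqVneq jr => [->|_] jr /=; last by rewrite expr0 mul1r.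
  by rewrite (negPf jr) mulr1.
by rewrite E ?index_enum_uniq // mem_index_enum.
Qed.

Lemma kpow_salpha (k k' : I -> U) i : kpow k k' (salpha i) = k i.
Proof.
rewrite -[RHS]expr1 -(kpow_single k k' i 1%:Z); congr kpow.
by apply/ffunP => j; rewrite !ffunE; case: eqP.
Qed.

Lemma kpow_salphaN (k k' : I -> U) i : kpow k k' (- salpha i) = k' i.
Proof.
rewrite -[RHS]expr1 -(kpow_single k k' i (Negz 0)); congr kpow.
by apply/ffunP => j; rewrite !ffunE; case: eqP.
Qed.

Section QuantumCase.
Variables (hb : C) (e f k k' : I -> U).
Hypothesis presE : pres U = Quantum hb e f k k'.

Lemma quantum_root1 n : qpw hb 1 ^+ n.+1 != 1.
Proof. by have := presP U; rewrite presE => -[+ _]; exact. Qed.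

Lemma quantum_rel : Uq_relations hb e f k k'.
Proof. by have := presP U; rewrite presE => -[_ []]. Qed.

Lemma kk' i : k i * k' i = 1.
Proof. by have [[+ _] _ _ _ _] := quantum_rel => /(_ i)[]. Qed.

Lemma k'k i : k' i * k i = 1.
Proof. by have [[+ _] _ _ _ _] := quantum_rel => /(_ i)[]. Qed.

Lemma ke i j : k i * e j = qpw hb (form (alpha i) (alpha j : hs)) *: (e j * k i).
Proof. by have [_ + _ _ _] := quantum_rel; exact. Qed.

Lemma k'e i j : k' i * e j = qpw hb (- form (alpha i) (alpha j : hs)) *: (e j * k' i).
Proof.
rewrite -[LHS]mulr1 -(kk' i) mulrA -[k' i * e j * k i]mulrA.
have -> : e j * k i = qpw hb (- form (alpha i) (alpha j : hs)) *: (k i * e j).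
  by rewrite ke scalerA mulrC qpwN scale1r.
by rewrite -scalerAr mulrA k'k mul1r scalerAl.
Qed.

Lemma eU_quantum i : eU U i = e i. Proof. by rewrite /eU presE. Qed.
Lemma fU_quantum i : fU U i = f i. Proof. by rewrite /fU presE. Qed.
Lemma kU_quantum i : kU U i = k i. Proof. by rewrite /kU presE. Qed.
Lemma kVU_quantum i : kVU U i = k' i. Proof. by rewrite /kVU presE. Qed.

Lemma qexpU_quantum b c : qexpU U (wt_of b, c) = qpw hb c *: kpow k k' b.
Proof. by rewrite /qexpU presE /= rcoordK. Qed.

Lemma qbrU_quantum x : qbrU U x =
  (qpw hb 1 - qpw hb (- 1))^-1 *: (qexpU U x - qexpU U (- x)).
Proof. by rewrite /qbrU presE. Qed.

Lemma k_gens0 i : k i \in gensub (gens0 U).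
Proof. by apply: gensub_gen; rewrite /gens0 presE; left; exists i. Qed.

Lemma k'_gens0 i : k' i \in gensub (gens0 U).
Proof. by apply: gensub_gen; rewrite /gens0 presE; right; exists i. Qed.

Lemma kpow_gens0 b : kpow k k' b \in gensub (gens0 U).
Proof.
by apply: rpred_prod => i _; case: (b i) => n; rewrite rpredX ?k_gens0 ?k'_gens0.
Qed.

Lemma e_kpow j b : e j * kpow k k' b =
  qpw hb (- form (wt_of b) (alpha j : hs)) *: (kpow k k' b * e j).
Proof.
have eX (u : I -> U) (s : C) i n : u i * e j = qpw hb s *: (e j * u i) ->
    e j * u i ^+ n = qpw hb (- (s * n%:R)) *: (u i ^+ n * e j).
  move=> ue; have eu : e j * u i = qpw hb (- s) *: (u i * e j).
    by rewrite ue scalerA mulrC qpwN scale1r.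
  elim: n => [|n IH]; first by rewrite mulr0 oppr0 qpw0 scale1r expr0 mulr1 mul1r.
  rewrite [in LHS]exprSr mulrA IH -scalerAl -[_ * e j * _]mulrA eu -scalerAr.
  rewrite scalerA mulrA -exprSr.
  by rewrite -qpwD -opprD -natr1 mulrDr mulr1.
rewrite /kpow formC form_wt_of.
elim: (index_enum _) => [|i r IH]; first by rewrite !big_nil oppr0 qpw0 scale1r mulr1 mul1r.
rewrite !big_cons mulrA.
have -> : e j * match b i with Posz n => k i ^+ n | Negz n => k' i ^+ n.+1 end =
    qpw hb (- (form (alpha j : hs) (alpha i) *~ b i)) *:
    (match b i with Posz n => k i ^+ n | Negz n => k' i ^+ n.+1 end * e j).
  rewrite formC; case: (b i) => n.
    by rewrite (eX _ _ _ _ (ke i j)) -pmulrn mulr_natr.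
  by rewrite (eX _ _ _ _ (k'e i j)) NegzE mulNr mulr_natr mulrNz.
by rewrite -scalerAl -[in LHS]mulrA IH -scalerAr scalerA mulrA -qpwD opprD.
Qed.

Lemma e_qexpU j x : root_lattice x ->
  e j * qexpU U x = qexpU U (x - (0, form x.1 (alpha j))) * e j.
Proof.
case: x => l c [b /= ->]; have -> : (wt_of b, c) - (0, form (wt_of b) (alpha j))
   = (wt_of b, c - form (wt_of b) (alpha j : hs)) :> aff.
  by apply: injective_projections => //; exact: subr0.
by rewrite !qexpU_quantum -scalerAr e_kpow scalerA -qpwD scalerAl.
Qed.

End QuantumCase.

Section ClassicalCase.
Variable iota : L -> U.
Hypothesis presE : pres U = Classical iota.

Lemma iota_linear : linear iota.
Proof. by have := presP U; rewrite presE => -[[]]. Qed.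

HB.instance Definition _ := GRing.isLinear.Build C L U *:%R iota iota_linear.

Lemma iota_br x y : iota (br x y) = iota x * iota y - iota y * iota x.
Proof. by have := presP U; rewrite presE => -[[_ +] _]; exact. Qed.

Lemma eU_classical i : eU U i = iota (eroot (alpha i)).
Proof. by rewrite /eU presE. Qed.
Lemma fU_classical i : fU U i = iota (froot (alpha i)).
Proof. by rewrite /fU presE. Qed.
Lemma kU_classical i : kU U i = 1. Proof. by rewrite /kU presE. Qed.
Lemma kVU_classical i : kVU U i = 1. Proof. by rewrite /kVU presE. Qed.
Lemma qexpU_classical x : qexpU U x = 1. Proof. by rewrite /qexpU presE. Qed.
Lemma qbrU_classical x : qbrU U x = iota (vsval (hvec x.1)) + x.2%:A.
Proof. by rewrite /qbrU presE. Qed.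

Lemma iota_cartan_gens0 (t : subvs_of (cartan L)) : iota (vsval t) \in gensub (gens0 U).
Proof. by apply: gensub_gen; rewrite /gens0 presE; exists t. Qed.

Lemma e_cartan j (t : subvs_of (cartan L)) : eU U j * iota (vsval t) =
  (iota (vsval t) - (alpha j t)%:A) * eU U j.
Proof.
have := iota_br (vsval t) (eroot (alpha j)).
rewrite br_cartan_e ?alpha_pos // linearZ /= eU_classical mulrBl => /eqP.
by rewrite eq_sym subr_eq addrC -subr_eq => /eqP <-; rewrite mulr_algl.
Qed.

End ClassicalCase.

Lemma qexpU_gens0 x : qexpU U x \in gensub (gens0 U).
Proof.
case E: (pres U) => [iota|hb e f k k'].
  by rewrite (qexpU_classical E) rpred1.
by rewrite /qexpU E; apply/rpredZ/(kpow_gens0 E).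
Qed.

Lemma qbrU_gens0 x : qbrU U x \in gensub (gens0 U).
Proof.
case E: (pres U) => [iota|hb e f k k'].
  by rewrite (qbrU_classical E) rpredD ?rpredZ ?rpred1 // (iota_cartan_gens0 E).
by rewrite (qbrU_quantum E); apply: rpredZ; apply: rpredB; exact: qexpU_gens0.
Qed.

Lemma qexpU_alpha i : qexpU U (alpha i, 0) = kU U i.
Proof.
case E: (pres U) => [iota|hb e f k k'].
  by rewrite (qexpU_classical E) (kU_classical E).
rewrite -[alpha i]wt_of_salpha (qexpU_quantum E) qpw0 scale1r kpow_salpha.
by rewrite (kU_quantum E).
Qed.

Lemma qexpU_alphaN i : qexpU U (- (alpha i, 0)) = kVU U i.
Proof.
case E: (pres U) => [iota|hb e f k k'].
  by rewrite (qexpU_classical E) (kVU_classical E).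
have -> : - (alpha i, 0) = (wt_of (- salpha i), 0) :> aff.
  apply: injective_projections; last exact: oppr0.
  by rewrite /= raddfN /= wt_of_salpha.
by rewrite (qexpU_quantum E) qpw0 scale1r kpow_salphaN (kVU_quantum E).
Qed.

(** Together with [eU_denom] this is the exchange rule that makes the left ideal generated by the
    e_alpha stable under right multiplication by fractions. *)
Lemma eU_gens0 j u : u \in gensub (gens0 U) ->
  exists2 u', u' \in gensub (gens0 U) & eU U j * u = u' * eU U j.
Proof.
move: u; apply: gensub_ind => [|a x y [x' Gx' ex] [y' Gy' ey]|x y [x' Gx' ex] [y' Gy' ey]|g].
- by exists 1; rewrite ?rpred1 // mulr1 mul1r.
- exists (a *: x' + y'); first by rewrite rpredD ?rpredZ.
  by rewrite mulrDr mulrDl -scalerAr -scalerAl ex ey.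
- by exists (x' * y'); rewrite ?rpredM // mulrA ex -[_ * eU U j * _]mulrA ey mulrA.
- case E: (pres U) => [iota|hb e f k k']; rewrite {1}/gens0 E /=.
    move=> [t _ <-]; rewrite (e_cartan E); eexists; last by [].
    by rewrite rpredB ?rpredZ ?rpred1 // (iota_cartan_gens0 E).
  rewrite (eU_quantum E) => -[[i _ <-]|[i _ <-]].
    exists (qpw hb (- form (alpha i) (alpha j : hs)) *: k i).
      by rewrite rpredZ // (k_gens0 E).
    by rewrite -scalerAl (ke E) scalerA mulrC qpwN scale1r.
  exists (qpw hb (form (alpha i) (alpha j : hs)) *: k' i).
    by rewrite rpredZ // (k'_gens0 E).
  by rewrite -scalerAl (k'e E) scalerA qpwN scale1r.
Qed.

Lemma eU_qbrU j l c : denom_wt U l ->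
  eU U j * qbrU U (l, c) = qbrU U (l, c - form l (alpha j)) * eU U j.
Proof.
case E: (pres U) => [iota|hb e f k k']; rewrite /denom_wt E => -[_ lP].
  rewrite !(qbrU_classical E) /= mulrDr (e_cartan E) -formE formC mulr_algr.
  by rewrite -[c *: eU U j]mulr_algl -mulrDl scalerBl addrAC addrA.
have lat : root_lattice (l, c) by case: lP => b ->; exists b.
have e1 := e_qexpU E j lat; have e2 := e_qexpU E j (root_latticeN lat).
rewrite !(qbrU_quantum E) -scalerAr -scalerAl; congr (_ *: _).
rewrite (eU_quantum E) mulrBr mulrBl e1 e2 /=; congr (qexpU U _ * _ - qexpU U _ * _).
  by apply: injective_projections => //; exact: subr0.
apply: injective_projections; first by rewrite /= subr0.
by rewrite /= formNl opprB opprK addrC.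
Qed.

(** Moving e_j past a factor [h_l - c] shifts its constant by (l, alpha_j). As c ranges over all
    complex numbers, the shifted product is again a denominator. *)
Lemma eU_denom j s : @denom _ _ U s ->
  exists2 s', denom s' & eU U j * val s = val s' * eU U j.
Proof.
elim=> [|l c {}s lP _ [s' ds' es]].
  by exists 1; [exact: denom1|rewrite rmorph1 mulr1 mul1r].
exists (qbr0 U (l, - c - form l (alpha j)) * s').
  by rewrite -opprD; exact: denomM.
rewrite !rmorphM /= !insubalgK ?qbrU_gens0 // mulrA eU_qbrU //.
by rewrite -[_ * eU U j * _]mulrA es mulrA.
Qed.

Lemma denom_wt_of (b : rlat L) : b != 0 -> denom_wt U (wt_of b).
Proof.
move=> b0; split; first by rewrite raddf_eq0 //; exact: wt_of_inj.
case E: (pres U) => [iota|hb e f k k']; last by exists b.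
exact: wt_of_integral.
Qed.

End Cartan.

(** * The quotient V as a module over the extended Cartan part *)

Section Hat.
Variables (R : realType) (L : ssLie R[i]) (U : envelope L) (A : ambient U).
Variable H : extension A.
Local Notation C := (R[i]).
Local Notation I := 'I_(rk L).
Local Notation hs := (hstar L).
Local Notation aff := (affh L).
Local Notation K := (U0hat H).

Definition qexph (x : aff) : K := j0 H (qexp0 U x).
Definition qbrh (x : aff) : K := j0 H (qbr0 U x).

Lemma qbrh_unit l c : denom_wt U l -> qbrh (l, c) \is a GRing.unit.
Proof.
move=> dl; have [jU _ _] := j0P H.
by have := jU _ (denomM (- c) dl (denom1 U)); rewrite opprK mulr1.
Qed.

(** Once k' is recognised as the inverse of k in \hat U^0, the case distinction in [kpow] becomes an
    integer power, and the exponent law yields [qexphD]. *)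
Lemma qexph_quantum hb e f k k' b c : pres U = Quantum hb e f k k' ->
  qexph (wt_of b, c) =
    qpw hb c *: \prod_i (j0 H (insubalg (gens0 U) (k i)) ^ b i).
Proof.
move=> E; rewrite /qexph /qexp0 (qexpU_quantum E) insubalgZ ?(kpow_gens0 E) //.
rewrite linearZ /=; congr (_ *: _).
have -> : insubalg (gens0 U) (kpow k k' b) = \prod_i
    (match b i with Posz n => insubalg (gens0 U) (k i) ^+ n
     | Negz n => insubalg (gens0 U) (k' i) ^+ n.+1 end).
  apply: val_inj; rewrite insubalgK ?(kpow_gens0 E) // rmorph_prod.
  apply: eq_bigr => i _; case: (b i) => n; rewrite rmorphXn /= insubalgK //.
    exact: (k_gens0 E).
  exact: (k'_gens0 E).
rewrite rmorph_prod; apply: eq_bigr => i _; case: (b i) => n; rewrite rmorphXn //=.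
rewrite NegzE -exprnN -exprVn; congr (_ ^+ _); apply: esym.
apply: mulr1_eq; rewrite -rmorphM -insubalgM ?(k_gens0 E) ?(k'_gens0 E) //.
by rewrite (kk' E) insubalg1 rmorph1.
Qed.

Lemma k_unit hb e f k k' i : pres U = Quantum hb e f k k' ->
  j0 H (insubalg (gens0 U) (k i)) \is a GRing.unit.
Proof.
move=> E; apply/unitrP; exists (j0 H (insubalg (gens0 U) (k' i))).
split; rewrite -rmorphM -insubalgM ?(k_gens0 E) ?(k'_gens0 E) //.
  by rewrite (k'k E) insubalg1 rmorph1.
by rewrite (kk' E) insubalg1 rmorph1.
Qed.

Lemma qexphD x y : root_lattice x -> root_lattice y ->
  qexph (x + y) = qexph x * qexph y.
Proof.
case E: (pres U) => [iota|hb e f k k'].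
  by rewrite /qexph /qexp0 !(qexpU_classical E) insubalg1 rmorph1 mulr1.
move: x y => [l c] [m d] [b /= ->] [b' /= ->].
have -> : (wt_of b, c) + (wt_of b', d) = (wt_of (b + b'), c + d) :> aff.
  by apply: injective_projections => //=; rewrite [RHS]raddfD.
rewrite !(qexph_quantum _ _ E) qpwD -scalerAl -scalerAr scalerA; congr (_ *: _).
rewrite -big_split; apply: eq_bigr => i _ /=; rewrite ffunE exprzDr //.
exact: (k_unit _ E).
Qed.

Lemma qexph0 : qexph 0 = 1.
Proof.
case E: (pres U) => [iota|hb e f k k'].
  by rewrite /qexph /qexp0 (qexpU_classical E) insubalg1 rmorph1.
have -> : 0 = (wt_of 0, 0) :> aff.
  by apply: injective_projections => //=; rewrite raddf0.
by rewrite (qexph_quantum _ _ E) qpw0 scale1r big1 // => i _; rewrite ffunE expr0z.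
Qed.

Lemma qexphN x : root_lattice x -> qexph x * qexph (- x) = 1.
Proof.
by move=> lx; rewrite -qexphD ?subrr ?qexph0 //; exact: root_latticeN.
Qed.

Lemma qbrh_quantum hb e f k k' x : pres U = Quantum hb e f k k' ->
  qbrh x = (qpw hb 1 - qpw hb (- 1))^-1 *: (qexph x - qexph (- x)).
Proof.
move=> E; rewrite /qbrh /qbr0 (qbrU_quantum E) insubalgZ; last first.
  by rewrite rpredB ?qexpU_gens0.
by rewrite insubalgB ?qexpU_gens0 // linearZ raddfB.
Qed.

(** The q-analogue of (x + y) - y = x, to which it reduces classically. Both [qbrh_ratio] and [0] =
    0 rest on it. *)
Lemma qbrhD x y : root_lattice x -> root_lattice y ->
  qbrh (x + y) - qexph (- x) * qbrh y = qexph y * qbrh x.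
Proof.
move=> lx ly; case E: (pres U) => [iota|hb e f k k'].
  have q1 z : qexph z = 1.
    by rewrite /qexph /qexp0 (qexpU_classical E) insubalg1 rmorph1.
  rewrite !q1 !mul1r; apply/eqP; rewrite subr_eq -rmorphD -insubalgD ?qbrU_gens0 //.
  rewrite !(qbrU_classical E) addrACA -scalerDl.
  have -> : iota (vsval (hvec x.1)) + iota (vsval (hvec y.1)) =
      iota (vsval (hvec (x + y).1)).
    rewrite (raddfD (@hvec _ L)).
    by have := iota_linear E 1 (vsval (hvec x.1)) (vsval (hvec y.1)); rewrite !scale1r.
  by rewrite -(qbrU_classical E (x + y)).
rewrite !(qbrh_quantum _ E) opprD !qexphD //; try exact: root_latticeN.
rewrite -!scalerAr -scalerBr; congr (_ *: _); ring.
Qed.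

Lemma qbrh0 : qbrh 0 = 0.
Proof.
have l0 : root_lattice (0 : aff) by exists 0; rewrite [RHS]raddf0.
by have := qbrhD l0 l0; rewrite oppr0 addr0 qexph0 !mul1r subrr.
Qed.

Lemma hatU_val (u : U0 U) : hatU H (val u) = jU H (j0 H u).
Proof. by have [+ _ _] := jAP H; exact. Qed.

Lemma hatUM u v : hatU H (u * v) = hatU H u * hatU H v.
Proof. by rewrite /hatU !rmorphM. Qed.

Lemma hatUD u v : hatU H (u + v) = hatU H u + hatU H v.
Proof. by rewrite /hatU !raddfD. Qed.

(** Write the fraction as a / s. From e a = a' e and e s = s' e follows e s^-1 = s'^-1 e, so e stays
    rightmost. *)
Lemma rstable_jU y : rstable (ehat H) (jU H y).
Proof.
apply: rstable_gen => i; have [unit_j0 frac _] := j0P H.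
have [a [s [ds ->]]] := frac y.
have [a' Ga' ea] := eU_gens0 i (valP a).
have [s' ds' es] := eU_denom i ds.
have jUV t : t \is a GRing.unit -> jU H t * jU H t^-1 = 1 /\ jU H t^-1 * jU H t = 1.
  by move=> ut; rewrite -!rmorphM mulrV ?mulVr ?rmorph1.
have [sV _] := jUV _ (unit_j0 _ ds); have [_ Vs'] := jUV _ (unit_j0 _ ds').
have eVs : ehat H i * jU H (j0 H s)^-1 = jU H (j0 H s')^-1 * ehat H i.
  rewrite -[RHS]mulr1 -sV mulrA -[_ * ehat H i * _]mulrA -hatU_val -hatUM es hatUM.
  by rewrite hatU_val [in RHS]mulrA Vs' mul1r.
rewrite rmorphM /= mulrA -hatU_val -hatUM ea hatUM.
by rewrite -mulrA -/(ehat H i) eVs mulrA; apply/lidealMl/lideal_gen.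
Qed.

HB.instance Definition _ := GRing.Zmodule.on (Vmod H).

Local Notation V := (Vmod H).

Lemma Vract_class x y : Vract (lclass (ehat H) x : V) y = lclass (ehat H) (x * jU H y).
Proof. by apply: ract_class; exact: rstable_jU. Qed.

Lemma VractA y z (v : V) : Vract (Vract v z) y = Vract v (y * z).
Proof.
have [x ->] := lclassP v; rewrite !Vract_class -mulrA -rmorphM.
by rewrite [z * y]mulrC.
Qed.

Lemma Vract1 : left_id 1 (fun y (v : V) => Vract v y).
Proof. by move=> v; have [x ->] := lclassP v; rewrite Vract_class rmorph1 mulr1. Qed.

Lemma VractDr : right_distributive (fun y (v : V) => Vract v y) +%R.
Proof.
move=> y v w; have [x ->] := lclassP v; have [z ->] := lclassP w.
by rewrite -lclassD !Vract_class -lclassD mulrDl.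
Qed.

Lemma VractDl (v : V) : {morph (fun y => Vract v y) : y z / y + z}.
Proof.
by move=> y z; have [x ->] := lclassP v; rewrite !Vract_class -lclassD raddfD mulrDr.
Qed.

(** The right action is declared as scaling, which is legitimate because \hat U^0 is commutative.
    The left action of \hat A is then linear, and the Cartan factors standing on the right in z_i
    become scalars. *)
HB.instance Definition _ := GRing.Zmodule_isLmodule.Build K V
  VractA Vract1 VractDr VractDl.

Lemma VractE (v : V) y : Vract v y = y *: v.
Proof. by []. Qed.

Lemma Vlact_linear (a : H) : linear (@Vlact _ _ _ _ H a).
Proof.
move=> y v w; rewrite -!VractE /Vlact lactDr; congr (_ + _).
by have [x ->] := lclassP v; rewrite Vract_class !lact_class Vract_class mulrA.
Qed.

HB.instance Definition _ a :=
  GRing.isLinear.Build K V V *:%R (@Vlact _ _ _ _ H a) (Vlact_linear a).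

Lemma VlactM a b (v : V) : Vlact (a * b) v = Vlact a (Vlact b v).
Proof. exact: lactM. Qed.

Lemma VlactDl a b (v : V) : Vlact (a + b) v = Vlact a v + Vlact b v.
Proof. exact: lactDl. Qed.

Lemma VlactNl a (v : V) : Vlact (- a) v = - Vlact a v.
Proof. exact: lactNl. Qed.

Lemma Vlact0l (v : V) : Vlact 0 v = 0.
Proof. exact: lact0l. Qed.

Lemma Vlact1 (v : V) : Vlact 1 v = v.
Proof. exact: lact1. Qed.

Lemma Vlact_suml (T : Type) (r : seq T) (F : T -> H) (v : V) :
  Vlact (\sum_(t <- r) F t) v = \sum_(t <- r) Vlact (F t) v.
Proof. exact: lact_suml. Qed.

Lemma VlactZl c a (v : V) : Vlact (c *: a) v = c%:A *: Vlact a v.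
Proof.
have [x ->] := lclassP v; rewrite -VractE /Vlact !lact_class Vract_class.
have -> : jU H c%:A = c%:A by rewrite linearZ /= rmorph1.
by rewrite mulr_algr scalerAl.
Qed.

End Hat.

(** * Weights *)

Definition Uweight (R : realType) (L : ssLie R[i]) (U : envelope L) (l : hstar L)
    (u : U) : Prop :=
  ad_weight (fun x y => x * y) (fun x y => x * y) l u.

Section Weights.
Variables (R : realType) (L : ssLie R[i]) (U : envelope L) (A : ambient U).
Variable H : extension A.
Local Notation C := (R[i]).
Local Notation I := 'I_(rk L).
Local Notation hs := (hstar L).
Local Notation aff := (affh L).
Local Notation K := (U0hat H).
Local Notation V := (Vmod H).
Implicit Types (l : hs) (v w : V).

Lemma VweightZ l v y : Vweight l v -> Vweight l (y *: v).
Proof.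
rewrite /Vweight /ad_weight; case: (pres U) => [iota|hb e f k k'] E t.
  by rewrite linearZ /= E !VractE !scalerA mulrC.
by rewrite linearZ /= E !VractE !scalerA mulrC.
Qed.

Lemma VweightD l v w : Vweight l v -> Vweight l w -> Vweight l (v + w).
Proof.
rewrite /Vweight /ad_weight; case: (pres U) => [iota|hb e f k k'] Ev Ew t.
  by rewrite raddfD /= Ev Ew !VractE scalerDr.
by rewrite raddfD /= Ev Ew !VractE scalerDr.
Qed.

Lemma Vweight0 l : Vweight l (0 : V).
Proof.
rewrite /Vweight /ad_weight; case: (pres U) => [iota|hb e f k k'] t;
by rewrite raddf0 /= VractE scaler0.
Qed.

Lemma Vweight_sum l (T : Type) (r : seq T) (g : T -> V) :
  (forall t, Vweight l (g t)) -> Vweight l (\sum_(t <- r) g t).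
Proof.
move=> wg; elim/big_ind: _ => [|v w|t _]; [exact: Vweight0|exact: VweightD|].
exact: wg.
Qed.

Lemma hatUZ c u : hatU H (c *: u) = c *: hatU H u.
Proof. by rewrite /hatU !linearZ. Qed.

Lemma hatU1 : hatU H 1 = 1.
Proof. by rewrite /hatU !rmorph1. Qed.

Lemma hatU0 : hatU H 0 = 0.
Proof. by rewrite /hatU !rmorph0. Qed.

Lemma hatU_sum (T : Type) (r : seq T) (g : T -> U) :
  hatU H (\sum_(t <- r) g t) = \sum_(t <- r) hatU H (g t).
Proof. by rewrite /hatU !rmorph_sum. Qed.

Lemma hatUN (x : U) : hatU H (- x) = - hatU H x.
Proof. by rewrite /hatU !rmorphN. Qed.

Lemma hatUB (x y : U) : hatU H (x - y) = hatU H x - hatU H y.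
Proof. by rewrite /hatU !rmorphB. Qed.

Lemma Vweight_mul l m u v : Uweight l u -> Vweight m v ->
  Vweight (l + m) (Vlact (hatU H u) v).
Proof.
rewrite /Vweight /Uweight /ad_weight.
case E: (pres U) => [iota|hb e f k k'] Eu Ev t.
  rewrite -VlactM -hatUM Eu hatUM VlactM hatUD VlactDl Ev hatUZ hatU1 VlactZl Vlact1.
  rewrite !VractE -scalerDl linearZ /= add_lfunE; congr (_ *: _).
  have Gt := iota_cartan_gens0 E t.
  rewrite !insubalgD ?rpredZ ?rpred1 // !insubalgZ ?rpred1 // insubalg1.
  rewrite [l t + m t]addrC scalerDl addrA [RHS]raddfD /=; congr (_ + _).
  by rewrite linearZ /= rmorph1.
rewrite -VlactM -hatUM Eu hatUM VlactM hatUZ VlactZl Ev !VractE scalerA.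
rewrite linearZ /=; congr (_ *: _); have Gk := k_gens0 E t.
by rewrite !insubalgZ // !linearZ /= mulr_algl scalerA formDr qpwD.
Qed.

(** A Cartan element crosses a weight vector from left to right at the price of a shift by the
    weight. This lemma and the next two supply the scalars E, E' and G of [triangular_recursion]. *)
Lemma Vweight_kU a l v : Vweight l v ->
  Vlact (hatU H (kU U a)) v = qexph H (alpha a, form (alpha a) l) *: v.
Proof.
rewrite /Vweight /ad_weight /qexph /qexp0.
case E: (pres U) => [iota|hb e f k k'] Ev.
  by rewrite (kU_classical E) (qexpU_classical E) hatU1 Vlact1 insubalg1 rmorph1 scale1r.
rewrite (kU_quantum E) Ev VractE; congr (j0 H (insubalg _ _) *: _).
by rewrite -wt_of_salpha (qexpU_quantum E) kpow_salpha.
Qed.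

Lemma Vweight_kVU a l v : Vweight l v ->
  Vlact (hatU H (kVU U a)) v = qexph H (- (alpha a, form (alpha a) l)) *: v.
Proof.
move=> wv; have lat := root_lattice_alpha a (form (alpha a) l).
have kv := Vweight_kU a wv.
have k'k1 : kVU U a * kU U a = 1.
  case E: (pres U) => [iota|hb e f k k'].
    by rewrite (kU_classical E) (kVU_classical E) mulr1.
  by rewrite (kU_quantum E) (kVU_quantum E) (k'k E).
have : Vlact (hatU H (kVU U a)) (Vlact (hatU H (kU U a)) v) = v.
  by rewrite -VlactM -hatUM k'k1 hatU1 Vlact1.
rewrite kv linearZ /= => {2}<-.
by rewrite scalerA mulrC qexphN // scale1r.
Qed.

Lemma Vweight_qbrU a l v : Vweight l v ->
  Vlact (hatU H (qbrU U (alpha a, 0))) v = qbrh H (alpha a, form (alpha a) l) *: v.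
Proof.
move=> wv; case E: (pres U) => [iota|hb e f k k'].
  move: (wv); rewrite /Vweight /ad_weight E => Ev.
  rewrite (qbrU_classical E) /= scale0r addr0 Ev VractE /qbrh /qbr0.
  by rewrite (qbrU_classical E) /= -formE formC.
rewrite (qbrU_quantum E) qexpU_alpha qexpU_alphaN hatUZ VlactZl hatUB VlactDl VlactNl.
rewrite (Vweight_kU a wv) (Vweight_kVU a wv) -scalerBl scalerA.
by rewrite (qbrh_quantum _ _ E) mulr_algl.
Qed.

(** The constant (mu, rho) - (mu, mu)/2 in eta is made for this: (alpha, rho) cancels (alpha,
    alpha)/2, and only - (alpha, l) is left. *)
Lemma eta_alpha l a : eta (l + alpha a) - eta l = (alpha a, form (alpha a) (- l)) :> aff.
Proof.
apply: injective_projections; first by rewrite /= addrC addKr.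
rewrite /= !formDl !formDr form_alpha_rho formNr [form l (alpha a)]formC.
by field.
Qed.

End Weights.

Lemma eq_sum_support (V : nmodType) (T : eqType) (s t : seq T) (f : T -> V) :
  uniq s -> uniq t -> (forall k, f k != 0 -> (k \in s) = (k \in t)) ->
  \sum_(k <- s) f k = \sum_(k <- t) f k.
Proof.
move=> us ut st; rewrite [LHS](bigID (fun k => f k != 0)) /=.
rewrite [RHS](bigID (fun k => f k != 0)) /=; congr (_ + _).
  rewrite -[LHS]big_filter -[RHS]big_filter; apply: perm_big.
  apply: uniq_perm; rewrite ?filter_uniq // => k; rewrite !mem_filter.
  by case: eqVneq => //= k0; exact: st.
by rewrite !big1 // => k; rewrite negbK => /eqP.
Qed.

(** A sum over all of T has its intended value only for finite support, which the inclusion in D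
    provides. *)
Lemma fsum_support (V : nmodType) (T : choiceType) (D : seq T) (f : T -> V) :
  uniq D -> (forall k, f k != 0 -> k \in D) ->
  \sum_(k \in [set: T]) f k = \sum_(k <- D) f k.
Proof.
move=> uD fD; apply: eq_sum_support => // k fk.
rewrite fD // in_finite_support; first by apply: mem_set; split=> //=; exact/eqP.
apply: (sub_finite_set _ (finite_seq D)) => j [_ /= /eqP].
by rewrite -[X in X -> _]/(is_true (f j != 0)) => /fD.
Qed.

(** * Matrix entries of a graded module *)

Section Pimat.
Variables (R : realType) (L : ssLie R[i]) (U : envelope L) (X : gradedMod U).
Local Notation C := (R[i]).
Local Notation I := 'I_(rk L).
Local Notation hs := (hstar L).
Local Notation IX := (gmI X).
Implicit Types (i j k : IX) (u v : Up U) (x y : gmX X).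

Lemma xcoord_linear i : linear (xcoord i : gmX X -> C^o).
Proof. by have [+ _ _ _] := xbasis X; exact. Qed.

HB.instance Definition _ i :=
  GRing.isLinear.Build C (gmX X) C^o *:%R (@xcoord _ _ _ X i) (xcoord_linear i).

Lemma xcoord_xvec i j : xcoord i (xvec j) = (i == j)%:R :> C.
Proof. by have [_ + _ _] := xbasis X; exact. Qed.

Lemma xcoord_finite y : exists2 D : seq IX, uniq D & forall i, xcoord i y != 0 -> i \in D.
Proof.
have [_ _ /(_ y) fin _] := xbasis X.
have [s sE] := fst (finite_seqP _) fin; exists (undup s); first exact: undup_uniq.
move=> i yi; rewrite mem_undup.
by have : [set i | xcoord i y != 0] i by []; rewrite sE.
Qed.

Lemma xvec_expand y (D : seq IX) : uniq D -> (forall i, xcoord i y != 0 -> i \in D) ->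
  y = \sum_(i <- D) xcoord i y *: xvec i.
Proof.
move=> uD yD; have [_ _ _ /(_ y) {1}->] := xbasis X.
apply: fsum_support => // i; apply: contraR => iD.
by have [->|/yD] := eqVneq (xcoord i y) 0; [rewrite scale0r|rewrite (negPf iD)].
Qed.

Lemma piX_linr u : linear (piX u : gmX X -> gmX X).
Proof. by have [[_ +] _ _] := piX_mod X; exact. Qed.

HB.instance Definition _ u :=
  GRing.isLinear.Build C (gmX X) (gmX X) *:%R (@piX _ _ _ X u) (piX_linr u).

Lemma piX_linl y : linear (fun u => piX u y).
Proof. by have [[+ _] _ _] := piX_mod X; exact. Qed.

Lemma piXM u v y : piX (u * v) y = piX u (piX v y).
Proof. by have [_ _ +] := piX_mod X; exact. Qed.

Lemma bpX_linr (b : Bp U) : linear (bpX b : gmX X -> gmX X).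
Proof. by have [[_ +] _ _] := bpX_mod X; exact. Qed.

HB.instance Definition _ b :=
  GRing.isLinear.Build C (gmX X) (gmX X) *:%R (@bpX _ _ _ X b) (bpX_linr b).

(** The argument u comes last and the codomain is [C^o], so that the entry can carry a linear
    structure in u. *)
Definition pientry i j u : C^o := pimat u i j.

Lemma pimat_linear i j : linear (pientry i j).
Proof. rewrite /pientry; by move=> a u v; rewrite /pimat piX_linl linearP. Qed.

HB.instance Definition _ i j := GRing.isLinear.Build C (Up U) C^o *:%R
  (pientry i j) (pimat_linear i j).

Lemma pimatZ a u i j : pimat (a *: u) i j = a * pimat u i j.
Proof. by rewrite -[LHS]/(pientry i j (a *: u)) linearZ. Qed.

Lemma pimatD u v i j : pimat (u + v) i j = pimat u i j + pimat v i j.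
Proof. exact: (raddfD (pientry i j)). Qed.

Lemma pimatB u v i j : pimat (u - v) i j = pimat u i j - pimat v i j.
Proof. exact: (raddfB (pientry i j)). Qed.

Lemma pimatN u i j : pimat (- u) i j = - pimat u i j.
Proof. exact: (raddfN (pientry i j)). Qed.

Lemma pimat_sum (T : Type) (r : seq T) (g : T -> Up U) i j :
  pimat (\sum_(t <- r) g t) i j = \sum_(t <- r) pimat (g t) i j.
Proof. exact: (raddf_sum (pientry i j)). Qed.

Lemma pimat1 i j : pimat 1 i j = (i == j)%:R.
Proof. by rewrite /pimat; have [_ -> _] := piX_mod X; exact: xcoord_xvec. Qed.

Lemma pimatM u v i j (D : seq IX) : uniq D ->
  (forall k, pimat u i k != 0 -> pimat v k j != 0 -> k \in D) ->
  pimat (u * v) i j = \sum_(k <- D) pimat u i k * pimat v k j.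
Proof.
move=> uD uvD; rewrite {1}/pimat piXM.
have [E uE vE] := xcoord_finite (piX v (xvec j)).
rewrite (xvec_expand uE vE) !linear_sum /=.
have E' k : xcoord i (piX u (pimat v k j *: xvec k)) = pimat u i k * pimat v k j.
  by rewrite !linearZ; exact: mulrC.
under eq_bigr => k _ do rewrite E'.
apply: eq_sum_support => // k; rewrite mulf_eq0 negb_or => /andP[uk vk].
by rewrite uvD // vE.
Qed.

Lemma pimatM_neq0 u v i j : pimat (u * v) i j != 0 ->
  exists k, pimat u i k != 0 /\ pimat v k j != 0.
Proof.
have [E uE vE] := xcoord_finite (piX v (xvec j)).
rewrite (pimatM (D := E)) // => [|k _ vk]; last exact: vE.
move=> s0; apply: contrapT => nk; move/eqP: s0; apply; apply: big1 => k _.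
have [->|uk] := eqVneq (pimat u i k) 0; first by rewrite mul0r.
have [->|vk] := eqVneq (pimat v k j) 0; first by rewrite mulr0.
by case: nk; exists k.
Qed.

Lemma eU_gensp a : eU U a \in gensub (gensp U).
Proof.
apply: gensub_gen; rewrite /eU /gensp; case: (pres U) => [iota|hb e f k k'].
  by exists (alpha a); rewrite //= alpha_pos.
by exists a.
Qed.

Lemma val_eUp a : val (eUp U a) = eU U a.
Proof. by rewrite insubalgK ?eU_gensp. Qed.

Lemma arrow_wt a i j : pimat (eUp U a) i j != 0 -> nu i = nu j + alpha a.
Proof. exact: nu_e. Qed.

Lemma arrow_succ a i j : pimat (eUp U a) i j != 0 -> succ i j.
Proof. by move=> aij; apply: t_step; exists a. Qed.

Lemma succ_trans i j k : succ i j -> succ j k -> succ i k.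
Proof. exact: t_trans. Qed.

Lemma succ_wt i j : succ i j ->
  exists n : I -> nat, (exists a, n a != 0%N) /\ nu i - nu j = wt_of (rpos n).
Proof.
elim=> {i j} [i j [a /arrow_wt ->]|i j k _ [n [[a na] nE]] _ [m [_ mE]]].
  exists (fun b => (b == a) : nat); split; first by exists a; rewrite eqxx.
  rewrite addrC addKr -wt_of_salpha; congr wt_of.
exists (fun b => n b + m b)%N; split; first by exists a; rewrite addn_eq0 (negPf na).
rewrite -[nu i](subrK (nu j)) nE -addrA mE -raddfD /=; congr wt_of.
by apply/ffunP => b; rewrite !ffunE PoszD.
Qed.

Lemma succ_irrefl i : ~ succ i i.
Proof.
move=> /succ_wt[n [[a na]]]; rewrite subrr -[LHS](raddf0 (@wt_of _ L)).
move=> /wt_of_inj /(congr1 (fun b : rlat L => b a)).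
by rewrite !ffunE => -[/esym/eqP]; rewrite (negPf na).
Qed.

Lemma pimat_path u : val u \in gensub (range (@eU _ _ U)) ->
  forall i j, pimat u i j != 0 -> i = j \/ succ i j.
Proof.
move=> Gu; pose Q (x : U) := x \in gensub (gensp U) /\
  forall u i j, val u = x -> pimat u i j != 0 -> i = j \/ succ i j.
(* The induction runs over elements of U, while [pimat] takes elements of U^+. So Q records
   membership in U^+ and quantifies over the lifts of x. The case i = j stems from the unit. *)
suff : Q (val u) by move=> [_ Qu] i j; exact: Qu.
move: (val u) Gu; apply: gensub_ind => [|a x y [Gx Qx] [Gy Qy]|x y [Gx Qx] [Gy Qy]|_ [a _ <-]].
- split; first exact: rpred1.
  move=> v i j v1; have -> : v = 1 by apply: val_inj; rewrite v1 rmorph1.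
  by rewrite pimat1; case: (eqVneq i j) => [->|_]; [left|rewrite eqxx].
- split; first by rewrite rpredD ?rpredZ.
  move=> v i j vE; have -> : v = a *: insubalg (gensp U) x + insubalg (gensp U) y.
    by rewrite -insubalgZ // -insubalgD ?rpredZ // -vE val_insubalg.
  rewrite pimatD pimatZ.
  have [x0|x0] := eqVneq (pimat (insubalg (gensp U) x) i j) 0.
    by rewrite x0 mulr0 add0r; apply: Qy; rewrite insubalgK.
  by move=> _; apply: (Qx (insubalg (gensp U) x)); rewrite ?insubalgK.
- split; first by rewrite rpredM.
  move=> v i j vE; have -> : v = insubalg (gensp U) x * insubalg (gensp U) y.
    by rewrite -insubalgM // -vE val_insubalg.
  move=> /pimatM_neq0[k [/(Qx _ i k) xik /(Qy _ k j) ykj]].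
  have [->|ik] := xik (insubalgK Gx); first by apply: ykj; rewrite insubalgK.
  have [<-|kj] := ykj (insubalgK Gy); first by right.
  by right; exact: succ_trans kj.
- split; first exact: eU_gensp.
  move=> v i j vE; have -> : v = eUp U a by apply: val_inj; rewrite vE val_eUp.
  by move=> /arrow_succ; right.
Qed.

End Pimat.

(** * The matrix phi *)

Section Phi.
Variables (R : realType) (L : ssLie R[i]) (U : envelope L) (X : gradedMod U).
Variable F : ctens L (Up U) (Um U).
Local Notation C := (R[i]).
Local Notation I := 'I_(rk L).
Local Notation hs := (hstar L).
Local Notation IX := (gmI X).
Implicit Types (i j k : IX) (b : rlat L).

Definition phi_term b i j : Um U := \sum_(p <- F b) pimat p.1 i j *: p.2.

Lemma phi_single b i j : (forall c, phi_term c i j != 0 -> nu i - nu j = wt_of c) ->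
  nu i - nu j = wt_of b -> phi F i j = phi_term b i j.
Proof.
move=> wt ijb; rewrite /phi (@fsum_support _ _ [:: b]) ?big_seq1 // => c.
by rewrite inE => /wt; rewrite ijb => /wt_of_inj->.
Qed.

Lemma phi_eq0 i j : (forall c, phi_term c i j != 0 -> nu i - nu j = wt_of c) ->
  (forall b, nu i - nu j <> wt_of b) -> phi F i j = 0.
Proof.
move=> wt nij; rewrite /phi (@fsum_support _ _ [::]) ?big_nil // => c /wt.
by move/nij.
Qed.

(** Equality of tensors is tested on the bilinear map sending x, y to pi(x)_ij h(y). *)
Lemma teq_entry (W : lmodType C) (h : {linear Um U -> W}) (s t : seq (Up U * Um U)) i j :
  teq s t -> \sum_(p <- s) pimat p.1 i j *: h p.2 = \sum_(p <- t) pimat p.1 i j *: h p.2.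
Proof.
move=> /(_ W (fun x y => pimat x i j *: h y)); apply; split=> [y|x] a u v.
  by rewrite pimatD pimatZ scalerDl scalerA.
by rewrite linearP scalerDr !scalerA mulrC.
Qed.

(* The commutation relation is stated over any finite set D of nodes that
   contains every k with m > k, so that all the sums are finite. *)
Definition phi_commutes (ph : IX -> IX -> U) := forall m j a (D : seq IX), uniq D ->
  (forall k, succ m k -> k \in D) ->
  eU U a * ph m j - ph m j * eU U a =
    pimat (eUp U a) m j *: qbrU U (alpha a, 0)
    + \sum_(k <- D) pimat (eUp U a) k j *: (ph m k * kU U a)
    - \sum_(k <- D) pimat (eUp U a) m k *: (kVU U a * ph k j).

Section ClassicalPhi.
Variable iota : L -> U.
Hypothesis presE : pres U = Classical iota.
Let iotaL := iota_linear presE.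
HB.instance Definition _ := GRing.isLinear.Build C L U *:%R iota iotaL.

Local Notation P := (posroots L).
Implicit Types (l : hs).
Let eup l : Up U := insubalg (gensp U) (iota (eroot l)).
Let fum l : Um U := insubalg (gensm U) (iota (froot l)).

Let val_eup l : l \in P -> val (eup l) = iota (eroot l).
Proof.
move=> lP; rewrite insubalgK //; apply: gensub_gen.
by rewrite /gensp presE; exists l.
Qed.

Let val_fum l : l \in P -> val (fum l) = iota (froot l).
Proof.
move=> lP; rewrite insubalgK //; apply: gensub_gen.
by rewrite /gensm presE; exists l.
Qed.

Let eup_alpha a : eup (alpha a) = eUp U a.
Proof. by rewrite /eup /eUp (eU_classical presE). Qed.

(** [nu_e] speaks of simple roots only. For a general positive root the relation [t, e_l] = l(t) e_l
    in B^+ shows that e_l x_j is an eigenvector of t, and its coefficient at x_i forces the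
    eigenvalue. *)
Lemma eup_weight l i j : l \in P -> pimat (eup l) i j != 0 -> nu i - nu j = l.
Proof.
move=> lP ne0; suff -> : nu i = nu j + l by rewrite addrC addKr.
apply/lfunP => t; rewrite add_lfunE.
pose G := gensp U `|` gens0 U.
have Gt : iota (vsval t) \in gensub G.
  by apply: gensub_sub (iota_cartan_gens0 presE t) => x Gx; right.
have Ge : iota (eroot l) \in gensub G.
  by apply: gensub_gen; left; rewrite /gensp presE; exists l.
pose bt : Bp U := insubalg G (iota (vsval t)).
pose be : Bp U := insubalg G (iota (eroot l)).
have btx k : bpX bt (xvec k) = (nu k t : C) *: xvec k :> gmX X.
  by have := xvec_wt k; rewrite /Xwt /left_weight presE; apply.
pose y : gmX X := piX (eup l) (xvec j).
have yE : y = bpX be (xvec j).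
  by apply: bpX_ext; rewrite val_eup // insubalgK.
have bty : bpX bt y = (l t + nu j t) *: y.
  have bb : bt * be = l t *: be + be * bt.
    rewrite -!insubalgM // -insubalgZ // -insubalgD ?rpredZ ?rpredM //.
    congr insubalg; apply/eqP; rewrite -subr_eq -(iota_br presE).
    by rewrite br_cartan_e // linearZ.
  have [[Bl _] _ BM] := bpX_mod X.
  by rewrite yE -BM bb Bl BM btx linearZ /= -scalerDl.
have [D uD yD] := xcoord_finite y.
have : xcoord i (bpX bt y) = nu i t * xcoord i y :> C.
  have := xvec_expand uD yD => yexp.
  rewrite {1}yexp linear_sum linear_sum /=.
  have E k : xcoord i (bpX bt (xcoord k y *: xvec k)) =
      nu i t * (xcoord k y * (i == k)%:R) :> C.
    rewrite linearZ /= btx !linearZ /= xcoord_xvec.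
    rewrite /GRing.scale /= mulrCA; case: eqVneq => [->|]; rewrite ?mulr0 //.
  under eq_bigr => k _ do rewrite E.
  rewrite -mulr_sumr; congr (_ * _).
  rewrite [in RHS]yexp linear_sum /=; apply: eq_bigr => k _.
  by rewrite linearZ /= xcoord_xvec.
rewrite bty linearZ /= /GRing.scale /= => /(mulIf ne0) <-.
by rewrite addrC.
Qed.

(** The root vector lies in the subalgebra generated by the simple ones, so a nonzero entry gives a
    path; a path of length 0 is excluded because it would make l zero. *)
Lemma eup_path l i j : l \in P -> pimat (eup l) i j != 0 -> succ i j.
Proof.
move=> lP ne0.
have [||S SP] := @vspace_of_closed _ L (fun x => iota x \in gensub (range (@eU _ _ U))).
- by rewrite raddf0 rpred0.
- by move=> a x y Gx Gy; rewrite linearP rpredD ?rpredZ.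
have Gl : iota (eroot l) \in gensub (range (@eU _ _ U)).
  apply/SP; apply: e_gen lP => [a|x y /SP Gx /SP Gy]; apply/SP.
    by apply: gensub_gen; exists a; rewrite ?(eU_classical presE).
  by rewrite (iota_br presE) rpredB ?rpredM.
have [] := pimat_path (u := eup l) _ ne0; rewrite ?val_eup //.
move=> ij; have := eup_weight lP ne0; rewrite ij subrr => /esym l0.
by have := posroot_neq0 lP; rewrite l0 eqxx.
Qed.

Hypothesis calF : is_calF F.

Lemma phi_term_classical b i j : phi_term b i j =
  \sum_(l <- P | l == wt_of b) pimat (eup l) i j *: fum l.
Proof.
move: calF; rewrite /is_calF presE => /(_ b) /(@teq_entry _ idfun _ _ i j) /= E.
by rewrite /phi_term E big_map big_filter.
Qed.

Lemma phi_classical i j :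
  val (phi F i j) = \sum_(l <- P) pimat (eup l) i j *: iota (froot l).
Proof.
have wt c : phi_term c i j != 0 -> nu i - nu j = wt_of c.
  rewrite phi_term_classical => n0; apply: contrapT => nij; move/eqP: n0; apply.
  rewrite big_seq_cond big1 // => l /andP[lP /eqP lc].
  have [->|/(eup_weight lP) ijl] := eqVneq (pimat (eup l) i j) 0; first by rewrite scale0r.
  by case: nij; rewrite ijl.
have valsum (Q : pred hs) : val (\sum_(l <- P | Q l) pimat (eup l) i j *: fum l) =
    \sum_(l <- P | Q l) pimat (eup l) i j *: iota (froot l).
  rewrite subalg_val_sum big_seq_cond [RHS]big_seq_cond.
  by apply: eq_bigr => l /andP[lP _]; rewrite subalg_valZ val_fum.
(* Positive roots lie in the root lattice, so if nu_i - nu_j does not, both sides vanish. *)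
have [[b ijb]|nij] := pselect (exists b, nu i - nu j = wt_of b).
  rewrite (phi_single wt ijb) phi_term_classical valsum.
  rewrite big_seq_cond [RHS]big_seq big_mkcondr; apply: eq_bigr => l lP.
  case: eqP => // nl.
  have [->|/(eup_weight lP) ijl] := eqVneq (pimat (eup l) i j) 0; first by rewrite scale0r.
  by case: nl; rewrite -ijl ijb.
rewrite (phi_eq0 wt) => [|b ijb]; last by apply: nij; exists b.
rewrite raddf0 big_seq big1 // => l lP.
have [->|/(eup_weight lP) ijl] := eqVneq (pimat (eup l) i j) 0; first by rewrite scale0r.
case: nij; have [n lE _] := posrootE lP; exists (rpos n).
by rewrite ijl.
Qed.

Lemma phi_classical_path i j : val (phi F i j) != 0 -> succ i j.
Proof.
rewrite phi_classical => n0; apply: contrapT => nij; move/eqP: n0; apply.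
rewrite big_seq big1 // => l lP.
have [->|/(eup_path lP)//] := eqVneq (pimat (eup l) i j) 0.
by rewrite scale0r.
Qed.

Lemma phi_classical_weight i j : Uweight (nu j - nu i) (val (phi F i j)).
Proof.
rewrite /Uweight /ad_weight presE phi_classical => t.
rewrite mulr_sumr mulr_suml !big_seq; apply: eq_bigr => l lP.
rewrite -scalerAr -scalerAl.
have [->|/(eup_weight lP) ijl] := eqVneq (pimat (eup l) i j) 0; first by rewrite !scale0r.
congr (_ *: _); rewrite -opprB ijl; apply/eqP; rewrite mulrDr addrC -subr_eq.
by rewrite -(iota_br presE) br_cartan_f // linearZ /= opp_lfunE mulr_algr.
Qed.

(** A right ideal is closed under commutators of its own elements, so containing the simple f_alpha
    it contains every [froot l]. *)
Lemma phi_classical_rideal i j : val (phi F i j) \in rideal (@fU _ _ U).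
Proof.
have [||S SP] := @vspace_of_closed _ L (fun x => iota x \in rideal (@fU _ _ U)).
- by rewrite raddf0 rideal0.
- by move=> a x y Gx Gy; rewrite linearP ridealD ?ridealZ.
have Gl l : l \in P -> iota (froot l) \in rideal (@fU _ _ U).
  move=> lP; apply/SP; apply: f_gen lP => [a|x y /SP Gx /SP Gy]; apply/SP.
    by rewrite -(fU_classical presE); exact: rideal_gen.
  by rewrite (iota_br presE) -mulrN ridealD ?mulrN -?mulNr ?ridealMr // -scaleN1r ridealZ.
rewrite phi_classical big_seq; elim/big_ind: _ => [|x y|l lP]; first exact: rideal0.
  exact: ridealD.
by apply: ridealZ; exact: Gl.
Qed.

(** Bracketing e_alpha with each f_l yields the Cartan term from l = alpha, and otherwise vectors
    f_g with the structure constants of [e_g, e_alpha]. Summed over l these constants give an entry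
    of the commutator of pi(e_g) and pi(e_alpha). *)
Lemma phi_classical_commutes : phi_commutes (fun i j => val (phi F i j)).
Proof.
move=> m j a D uD mD; cbv beta.
rewrite (kU_classical presE) (kVU_classical presE) (qbrU_classical presE).
rewrite [(_, _).1]/= [(_, _).2]/= scale0r addr0.
rewrite -[RHS]addrA -sumrB.
under [X in _ = _ + X]eq_bigr => k _ do rewrite mulr1 mul1r !phi_classical.
rewrite phi_classical (eU_classical presE) mulr_sumr mulr_suml -sumrB.
have E l : l \in P -> iota (eroot (alpha a)) * (pimat (eup l) m j *: iota (froot l))
   - (pimat (eup l) m j *: iota (froot l)) * iota (eroot (alpha a)) =
   pimat (eup l) m j *: ((l == alpha a)%:R *: iota (vsval (hvec (alpha a))))
   + \sum_(g <- P) pimat (eup l) m j *: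
      (killing (br (eroot g) (eroot (alpha a))) (froot l) *: iota (froot g)).
  move=> lP; rewrite -scalerAr -scalerAl -scalerBr -(iota_br presE) br_alpha_f //.
  rewrite linearD linearZ linear_sum /= scalerDr scaler_sumr; congr (_ + _).
  by apply: eq_bigr => g _; rewrite linearZ.
rewrite big_seq; under eq_bigr => l lP do rewrite E //.
rewrite -big_seq big_split /=; congr (_ + _).
  rewrite (bigD1_seq _ (@alpha_pos _ L a) (posroots_uniq L)) /= eqxx scale1r eup_alpha.
  by rewrite big1 ?addr0 // => l /negPf ->; rewrite scale0r scaler0.
rewrite exchange_big /=.
have -> : \sum_(k <- D) (pimat (eUp U a) k j *: (\sum_(l <- P) pimat (eup l) m k *: iota (froot l))
   - pimat (eUp U a) m k *: (\sum_(l <- P) pimat (eup l) k j *: iota (froot l))) =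
   \sum_(l <- P) (\sum_(k <- D) (pimat (eup l) m k * pimat (eUp U a) k j
     - pimat (eUp U a) m k * pimat (eup l) k j)) *: iota (froot l).
  under [RHS]eq_bigr => l _ do rewrite scaler_suml.
  rewrite exchange_big /=; apply: eq_bigr => k _.
  rewrite !scaler_sumr -sumrB; apply: eq_bigr => l _.
  by rewrite !scalerA -scalerBl mulrC.
rewrite !big_seq; apply: eq_bigr => g gP.
under eq_bigr => l _ do rewrite scalerA mulrC.
rewrite -scaler_suml; congr (_ *: _).
have comm : eup g * eUp U a - eUp U a * eup g =
    \sum_(l <- P) killing (br (eroot g) (eroot (alpha a))) (froot l) *: eup l.
  apply: val_inj; rewrite subalg_valB !subalg_valM subalg_val_sum !val_eup // val_eUp.
  rewrite (eU_classical presE) -(iota_br presE) [in LHS]br_e_alpha // linear_sum !big_seq.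
  by apply: eq_bigr => l lP; rewrite subalg_valZ linearZ val_eup.
have -> : \sum_(l <- P) killing (br (eroot g) (eroot (alpha a))) (froot l) * pimat (eup l) m j
    = pimat (eup g * eUp U a - eUp U a * eup g) m j.
  by rewrite comm pimat_sum; apply: eq_bigr => l _; rewrite pimatZ.
rewrite pimatB sumrB; congr (_ - _); apply: pimatM => // k.
  by move=> /(eup_path gP)/mD.
by move=> /arrow_succ/mD.
Qed.

End ClassicalPhi.

End Phi.

(** * The matrix phi in the quantum case *)

Section QuantumPhi.
Variables (R : realType) (L : ssLie R[i]) (U : envelope L) (X : gradedMod U).
Variable F : ctens L (Up U) (Um U).
Local Notation C := (R[i]).
Local Notation I := 'I_(rk L).
Local Notation hs := (hstar L).
Local Notation IX := (gmI X).
Implicit Types (i j : IX) (b : rlat L).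
Variables (hb : C) (e f k k' : I -> U).
Hypothesis presE : pres U = Quantum hb e f k k'.
Local Notation qd := (qpw hb 1 - qpw hb (- 1)).

Lemma sum_cmulr (W : nmodType) (B : U -> U -> W) T D b :
  \sum_(p <- cmulr T D b) B p.1 p.2 =
  \sum_(d <- D) \sum_(p <- T (b - d.1)) B (p.1 * d.2.1) (p.2 * d.2.2).
Proof.
rewrite /cmulr big_flatten big_map; apply: eq_bigr => d _.
rewrite /tmul big_flatten big_map; apply: eq_bigr => p _.
by rewrite big_map big_seq1.
Qed.

Lemma sum_cmull (W : nmodType) (B : U -> U -> W) T D b :
  \sum_(p <- cmull D T b) B p.1 p.2 =
  \sum_(d <- D) \sum_(p <- T (b - d.1)) B (d.2.1 * p.1) (d.2.2 * p.2).
Proof.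
rewrite /cmull big_flatten big_map; apply: eq_bigr => d _.
by rewrite /tmul big_flatten big_map big_seq1 big_map.
Qed.

(* The matrix entries of X are functions on U^+ only; a linear retraction p of U
   onto U^+ extends them, so that they can be applied to equalities in the tensor
   square of U. *)
Lemma entry_bilinear (p : {linear U -> Up U}) (g : {linear U -> U}) i j :
  is_bilinear (fun x y : U => pimat (p (g x)) i j *: y).
Proof.
split=> [y|x] a u v; last by rewrite scalerDr !scalerA mulrC.
by rewrite !linearP pimatD pimatZ scalerDl scalerA.
Qed.

Lemma pimat_monomial (w : seq I) i j : pimat (\prod_(a <- w) eUp U a) i j != 0 ->
  nu i - nu j = wt_of [ffun a => (count_mem a w)%:Z].
Proof.
elim: w i => [|a w IH] i.
  rewrite big_nil pimat1; have [->|] := eqVneq i j; last by rewrite eqxx.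
  have -> : [ffun a => (count_mem a [::])%:Z] = 0 :> rlat L.
    by apply/ffunP => b; rewrite !ffunE.
  by rewrite subrr raddf0.
rewrite big_cons => /pimatM_neq0[h [/arrow_wt -> /IH wh]].
rewrite addrAC wh -wt_of_salpha -raddfD; congr wt_of.
by apply/ffunP => b; rewrite !ffunE /= PoszD addrC eq_sym.
Qed.

Lemma deg_part_expand b (x : Up U) : deg_part b x ->
  exists s : seq (C * seq I),
    (forall m, m \in s -> [ffun a => (count_mem a m.2)%:Z] = b) /\
    x = \sum_(m <- s) m.1 *: \prod_(a <- m.2) eUp U a.
Proof.
move=> [s [sb xE]]; exists s; split=> //; apply: val_inj.
rewrite xE subalg_val_sum; apply: eq_bigr => m _; rewrite subalg_valZ; congr (_ *: _).
elim: (m.2) => [|a w IH]; first by rewrite !big_nil.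
by rewrite !big_cons subalg_valM val_eUp IH.
Qed.

Lemma deg_part_wt b (x : Up U) i j : deg_part b x -> pimat x i j != 0 ->
  nu i - nu j = wt_of b.
Proof.
move=> /deg_part_expand[s [sb ->]] n0; apply: contrapT => nij; move/eqP: n0; apply.
rewrite pimat_sum big_seq big1 // => m ms; rewrite pimatZ.
have [->|/pimat_monomial] := eqVneq (pimat (\prod_(a <- m.2) eUp U a) i j) 0.
  by rewrite mulr0.
by rewrite sb.
Qed.

Lemma k'_deg_part b (x : Up U) a : deg_part b x ->
  k' a * val x = qpw hb (- form (alpha a) (wt_of b : hs)) *: (val x * k' a).
Proof.
move=> [s [sb ->]]; rewrite mulr_sumr mulr_suml scaler_sumr !big_seq.
apply: eq_bigr => m ms; rewrite -(sb m ms) -scalerAr -scalerAl scalerA mulrC -scalerA.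
congr (_ *: _); elim: (m.2) => [|c w IH].
  rewrite !big_nil mulr1 mul1r.
  have -> : [ffun a0 => (count_mem a0 [::])%:Z] = 0 :> rlat L.
    by apply/ffunP => d; rewrite !ffunE.
  by rewrite raddf0 formC form0l oppr0 qpw0 scale1r.
rewrite !big_cons mulrA (eU_quantum presE) (k'e presE) -scalerAl -[in LHS]mulrA IH.
rewrite -scalerAr scalerA mulrA -qpwD -opprD -formDr -[alpha c]wt_of_salpha -raddfD.
congr (qpw hb (- form _ (wt_of _)) *: _).
by apply/ffunP => d; rewrite !ffunE /= PoszD eq_sym.
Qed.

Variable Rc : ctens L (Up U) (Um U).
Hypothesis RcP : is_Rcheck Rc.
Hypothesis FP : forall b, teq (F b)
  [seq (qd^-1 *: p.1, p.2) | p <- Rc b ++ (if b == 0 then [:: (-1, 1)] else [::])].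

Definition Rentry b i j : U := \sum_(p <- Rc b) pimat p.1 i j *: val p.2.

Lemma Rentry0 i j : Rentry 0 i j = (i == j)%:R *: 1.
Proof.
have [_ + _ _ _] := RcP; rewrite -[_ (Rc 0) _]/(teq (Rc 0) [:: (1, 1)]).
move=> /(@teq_entry _ _ _ _ _ (val : Um U -> U) _ _ i j).
by rewrite /Rentry => ->; rewrite big_seq1 /= pimat1.
Qed.

Lemma Rentry_wt b i j : Rentry b i j != 0 -> nu i - nu j = wt_of b.
Proof.
move=> n0; apply: contrapT => nij; move/eqP: n0; apply.
have [dR _ _ _ _] := RcP; rewrite /Rentry big_seq big1 // => p /dR dp.
have [->|/(deg_part_wt dp)//] := eqVneq (pimat p.1 i j) 0.
by rewrite scale0r.
Qed.

Lemma pimat_succ (u : Up U) i j : pimat u i j != 0 -> i = j \/ succ i j.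
Proof.
apply: pimat_path; apply: gensub_sub (valP u) => t.
by rewrite /gensp presE => -[a _ <-]; exists a => //; rewrite (eU_quantum presE).
Qed.

Lemma phi_term_quantum b i j :
  val (phi_term (X := X) F b i j) = qd^-1 *: (Rentry b i j - ((b == 0) && (i == j))%:R *: 1).
Proof.
have := teq_entry (val : Um U -> U) i j (FP b).
rewrite subalg_val_sum; under eq_bigr => p _ do rewrite -subalg_valZ.
move=> ->; rewrite big_map big_cat /=.
under eq_bigr => p _ do rewrite pimatZ -scalerA.
rewrite -scaler_sumr -/(Rentry b i j) scalerDr; congr (_ + _).
have [b0|_] /= := eqVneq b 0; last by rewrite big_nil scale0r oppr0 scaler0.
by rewrite big_seq1 /= pimatZ -scalerA pimatN pimat1 scaleNr.
Qed.

Lemma phi_term_wt b i j : phi_term (X := X) F b i j != 0 -> nu i - nu j = wt_of b.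
Proof.
move=> n0; have [b0|b0] := eqVneq b 0.
  case/eqP: n0; apply: val_inj; rewrite phi_term_quantum b0 eqxx /= Rentry0 subrr.
  by rewrite scaler0.
apply: Rentry_wt; apply: contraNneq n0 => R0; apply/eqP/val_inj.
by rewrite phi_term_quantum R0 (negPf b0) scale0r subrr scaler0 subalg_val0.
Qed.

Lemma phi_term0 i j : phi_term (X := X) F 0 i j = 0.
Proof.
by apply: val_inj; rewrite phi_term_quantum eqxx /= Rentry0 subrr scaler0.
Qed.

Lemma phi_term_path b i j : phi_term (X := X) F b i j != 0 -> succ i j.
Proof.
move=> n0; have [ij|nij] := eqVneq i j.
  have := phi_term_wt n0; rewrite ij subrr -[LHS](raddf0 (@wt_of _ L)) => /wt_of_inj b0.
  by move/eqP: n0; rewrite -b0 phi_term0.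
have [p pn0] : exists p, pimat (p : Up U * Um U).1 i j != 0.
  apply: contrapT => np; move/eqP: n0; apply; apply: big1 => p _.
  have [->|pn0] := eqVneq (pimat p.1 i j) 0; first by rewrite scale0r.
  by case: np; exists p.
by have [ij|//] := pimat_succ pn0; rewrite ij eqxx in nij.
Qed.

(** This is the (m, j) entry, in degree b, of the intertwining relation for e_alpha. The list D1
    contains m because U^+ may act diagonally in the first factor; on the other side e_alpha comes
    first and leads strictly below m, so D suffices. *)
Lemma Rentry_commutes m j a b (D1 D : seq IX) :
  uniq D1 -> (forall h, m = h \/ succ m h -> h \in D1) ->
  uniq D -> (forall h, succ m h -> h \in D) ->
  \sum_(h <- D1) pimat (eUp U a) h j *: (Rentry (b - salpha a) m h * kU U a)
    + Rentry b m j * eU U a =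
  \sum_(h <- D) pimat (eUp U a) m h *: (kVU U a * Rentry (b - salpha a) h j)
    + eU U a * Rentry b m j.
Proof.
move=> uD1 mD1 uD mD.
have [p pK] := linear_retraction (i := (val : Up U -> U)) val_inj.
have [_ _ _ _ /(_ a b)] := RcP.
move=> /(_ U _ (entry_bilinear p idfun m j)).
rewrite (sum_cmulr (fun x y => pimat (p x) m j *: y)).
rewrite (sum_cmull (fun x y => pimat (p x) m j *: y)).
rewrite !big_cons !big_nil /= !addr0 !subr0 !big_map /=.
have -> : \sum_(q <- Rc (b - salpha a)) pimat (p (val q.1 * eU U a)) m j *: (val q.2 * kU U a) =
    \sum_(h <- D1) pimat (eUp U a) h j *: (Rentry (b - salpha a) m h * kU U a).
  under [RHS]eq_bigr => h _ do rewrite mulr_suml scaler_sumr.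
  rewrite exchange_big /=; apply: eq_bigr => q _.
  rewrite -val_eUp -subalg_valM pK (pimatM uD1) => [|h mh _]; last exact: mD1 (pimat_succ mh).
  rewrite scaler_suml; apply: eq_bigr => h _.
  by rewrite -scalerAl scalerA mulrC.
have -> : \sum_(q <- Rc (b - salpha a)) pimat (p (eU U a * val q.1)) m j *: (kVU U a * val q.2) =
    \sum_(h <- D) pimat (eUp U a) m h *: (kVU U a * Rentry (b - salpha a) h j).
  under [RHS]eq_bigr => h _ do rewrite mulr_sumr scaler_sumr.
  rewrite exchange_big /=; apply: eq_bigr => q _.
  rewrite -val_eUp -subalg_valM pK (pimatM uD) => [|h mh _]; last exact/mD/arrow_succ/mh.
  rewrite scaler_suml; apply: eq_bigr => h _.
  by rewrite -scalerAr scalerA.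
have -> : \sum_(q <- Rc b) pimat (p (val q.1 * 1)) m j *: (val q.2 * eU U a) =
    Rentry b m j * eU U a.
  by rewrite mulr_suml; apply: eq_bigr => q _; rewrite mulr1 pK scalerAl.
suff -> : \sum_(q <- Rc b) pimat (p (1 * val q.1)) m j *: (eU U a * val q.2) =
    eU U a * Rentry b m j by [].
by rewrite mulr_sumr; apply: eq_bigr => q _; rewrite mul1r pK scalerAr.
Qed.

(** The relation for k tensor k has first factors outside U^+. Multiplying them by k' on the left,
    which is the map g, brings them back to U^+, where p is exact, and the degree b of the first
    factor turns into the weight of the second. *)
Lemma Rentry_weight a b i j :
  k a * Rentry b i j = qpw hb (- form (alpha a) (wt_of b : hs)) *: (Rentry b i j * k a).
Proof.
have [p pK] := linear_retraction (i := (val : Up U -> U)) val_inj.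
have k'L : linear (fun x : U => k' a * x) by move=> c x y; rewrite mulrDr scalerAr.
pose k'M := GRing.isLinear.Build C U U *:%R (fun x : U => k' a * x) k'L.
pose g : {linear U -> U} := HB.pack (fun x : U => k' a * x) k'M.
have [dR _ _ /(_ a)[/(_ b) + _] _] := RcP.
move=> /(_ U _ (entry_bilinear p g i j)).
rewrite (sum_cmulr (fun x y => pimat (p (g x)) i j *: y)).
rewrite (sum_cmull (fun x y => pimat (p (g x)) i j *: y)).
rewrite !big_cons !big_nil /= !addr0 !subr0 !big_map /= (kU_quantum presE).
move=> E; rewrite [LHS]mulr_sumr mulr_suml scaler_sumr.
transitivity (\sum_(q <- Rc b) pimat (p (k' a * (k a * val q.1))) i j *: (k a * val q.2)).
  apply: eq_bigr => q _.
  by rewrite mulrA (k'k presE) mul1r pK scalerAr.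
rewrite -E !big_seq; apply: eq_bigr => q qR.
rewrite mulrA (k'_deg_part a (dR _ _ qR)) -scalerAl -mulrA (k'k presE) mulr1.
by rewrite linearZ /= pK pimatZ -scalerA -scalerAl.
Qed.

Let qd0 : qd != 0. Proof. by apply: q_diff_neq0; exact: (quantum_root1 presE). Qed.

Let phi_term_single b i j := @phi_single _ _ _ X F b i j (fun c => @phi_term_wt c i j).
Let phi_term_none i j := @phi_eq0 _ _ _ X F i j (fun c => @phi_term_wt c i j).

Lemma phi_quantum_path i j : val (phi F i j : Um U) != 0 -> succ i j.
Proof.
have [[b ijb]|nij] := pselect (exists b, nu i - nu j = wt_of b).
  rewrite (phi_term_single ijb) => n0; apply: (@phi_term_path b).
  by apply: contraNneq n0 => ->; rewrite subalg_val0.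
by rewrite phi_term_none ?subalg_val0 ?eqxx // => b ijb; apply: nij; exists b.
Qed.

Lemma Rentry_phi b i j :
  Rentry b i j = qd *: val (phi_term (X := X) F b i j) + ((b == 0) && (i == j))%:R *: 1.
Proof. by rewrite phi_term_quantum scalerA mulfV // scale1r subrK. Qed.

Lemma phi_quantum_weight i j : Uweight (nu j - nu i) (val (phi F i j : Um U)).
Proof.
rewrite /Uweight /ad_weight presE => a; rewrite -scalerAr.
have [[b ijb]|nij] := pselect (exists b, nu i - nu j = wt_of b); last first.
  rewrite phi_term_none ?subalg_val0 ?mulr0 ?mul0r ?scaler0 // => b ijb.
  by apply: nij; exists b.
rewrite (phi_term_single ijb) -opprB ijb formNr.
have [->|b0] := eqVneq b 0.
  by rewrite phi_term0 subalg_val0 mulr0 mul0r scaler0.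
rewrite phi_term_quantum (negPf b0) scale0r subr0 -scalerAr Rentry_weight.
by rewrite -scalerAl scalerA mulrC -scalerA.
Qed.

(** Substitute R = 1 + (q - q^-1) F into [Rentry_commutes]. The unit terms next to e_alpha cancel,
    and the others leave pi_mj (k - k'), which is (q - q^-1) pi_mj [h_alpha]. *)
Lemma phi_quantum_commutes : phi_commutes (X := X) (fun i j => val (phi F i j : Um U)).
Proof.
move=> m j a D uD mD; cbv beta.
(* Arrows and entries of phi change weights by elements of the root lattice, so outside the lattice
   every term is zero. *)
have [[b mjb]|nmj] := pselect (exists b, nu m - nu j = wt_of b); last first.
  rewrite phi_term_none => [|b mjb]; last by apply: nmj; exists b.
  rewrite subalg_val0 mulr0 mul0r subrr.
  have -> : pimat (eUp U a) m j = 0.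
    apply: contrapT => /eqP /arrow_wt mj; apply: nmj; exists (salpha a).
    by rewrite mj wt_of_salpha addrC addKr.
  rewrite scale0r add0r !big1 ?subr0 // => h _.
    have [->|/arrow_wt mh] := eqVneq (pimat (eUp U a) m h) 0; first by rewrite scale0r.
    rewrite (@phi_term_none h j) ?subalg_val0 ?mulr0 ?scaler0 // => b hjb.
    apply: nmj; exists (b + salpha a).
    by rewrite [RHS]raddfD /= wt_of_salpha -hjb mh addrAC.
  have [->|/arrow_wt hj] := eqVneq (pimat (eUp U a) h j) 0; first by rewrite scale0r.
  rewrite (@phi_term_none m h) ?subalg_val0 ?mul0r ?scaler0 // => b mhb.
  apply: nmj; exists (b + salpha a).
  by rewrite [RHS]raddfD /= wt_of_salpha -mhb hj opprD addrA subrK.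
have uD1 := undup_uniq (m :: D).
have mD1 h : m = h \/ succ m h -> h \in undup (m :: D).
  by rewrite mem_undup inE => -[->|/mD ->]; rewrite ?eqxx ?orbT.
have := Rentry_commutes j a b uD1 mD1 uD mD.
have Rphi h l : nu h - nu l = wt_of (b - salpha a) -> Rentry (b - salpha a) h l =
    qd *: val (phi F h l : Um U) + ((b == salpha a) && (h == l))%:R *: 1.
  by move=> hl; rewrite Rentry_phi -(phi_term_single hl) subr_eq0.
have E1 h : pimat (eUp U a) h j *: (Rentry (b - salpha a) m h * kU U a) =
    qd *: (pimat (eUp U a) h j *: (val (phi F m h : Um U) * kU U a)) +
    ((b == salpha a) && (m == h))%:R *: (pimat (eUp U a) h j *: kU U a).
  have [->|/arrow_wt hj] := eqVneq (pimat (eUp U a) h j) 0.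
    by rewrite !scale0r !scaler0 addr0.
  rewrite Rphi; last first.
    by rewrite [RHS]raddfB /= wt_of_salpha -mjb hj opprD addrA.
  rewrite mulrDl -!scalerAl mul1r scalerDr !scalerA; congr (_ + _).
    by rewrite mulrC.
  by rewrite mulrC.
have E2 h : pimat (eUp U a) m h *: (kVU U a * Rentry (b - salpha a) h j) =
    qd *: (pimat (eUp U a) m h *: (kVU U a * val (phi F h j : Um U))) +
    ((b == salpha a) && (h == j))%:R *: (pimat (eUp U a) m h *: kVU U a).
  have [->|/arrow_wt mh] := eqVneq (pimat (eUp U a) m h) 0.
    by rewrite !scale0r !scaler0 addr0.
  rewrite Rphi; last first.
    by rewrite [RHS]raddfB /= wt_of_salpha -mjb mh addrAC addrK.
  rewrite mulrDr -!scalerAr mulr1 scalerDr !scalerA; congr (_ + _).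
    by rewrite mulrC.
  by rewrite mulrC.
under eq_bigr => h _ do rewrite E1.
under [X in _ = X + _ -> _]eq_bigr => h _ do rewrite E2.
rewrite !big_split /= -!scaler_sumr.
(* The unit part is seen only in degree 0, that is for b = alpha, and a nonzero pi_mj forces exactly
   this b. *)
have S1 : \sum_(h <- undup (m :: D)) ((b == salpha a) && (m == h))%:R *:
    (pimat (eUp U a) h j *: kU U a) = pimat (eUp U a) m j *: kU U a.
  rewrite (bigD1_seq m) ?mD1 //=; last by left.
  rewrite eqxx andbT big1 ?addr0 => [|h /negPf hm]; last first.
    by rewrite [m == h]eq_sym hm andbF scale0r.
  have [//|nb] := eqVneq b (salpha a); first by rewrite scale1r.
  have [->|/arrow_wt mj] := eqVneq (pimat (eUp U a) m j) 0; first by rewrite !scale0r ?scaler0.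
  move: mjb; rewrite mj addrC addKr -wt_of_salpha => /wt_of_inj ba.
  by rewrite ba eqxx in nb.
have S2 : \sum_(h <- D) ((b == salpha a) && (h == j))%:R *:
    (pimat (eUp U a) m h *: kVU U a) = pimat (eUp U a) m j *: kVU U a.
  have [p0|p0] := eqVneq (pimat (eUp U a) m j) 0.
    rewrite p0 scale0r big1 // => h _.
    by case: (eqVneq h j) => [->|_]; rewrite ?p0 ?scale0r ?scaler0 // andbF scale0r.
  have jD : j \in D by apply/mD/arrow_succ/p0.
  have mj := arrow_wt p0.
  move: mjb; rewrite mj addrC addKr -wt_of_salpha => /wt_of_inj ba.
  rewrite (bigD1_seq j) //= ba !eqxx scale1r big1 ?addr0 // => h /negPf ->.
  by rewrite scale0r.
rewrite S1 S2.
(* The additional node m drops out since phi_mm = 0. *)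
have -> : \sum_(h <- undup (m :: D)) pimat (eUp U a) h j *: (val (phi F m h : Um U) * kU U a) =
    \sum_(h <- D) pimat (eUp U a) h j *: (val (phi F m h : Um U) * kU U a).
  apply: eq_sum_support => // h.
  have [->|/phi_quantum_path mh _] := eqVneq (val (phi F m h : Um U)) 0.
    by rewrite mul0r scaler0 eqxx.
  by rewrite mD // mD1 //; right.
set S := \sum_(h <- D) _; set T := \sum_(h <- D) _; move=> E.
have Rmj : Rentry b m j = qd *: val (phi F m j : Um U) + ((b == 0) && (m == j))%:R *: 1.
  by rewrite Rentry_phi (phi_term_single mjb).
move: E; rewrite Rmj mulrDl mulrDr -!scalerAl -!scalerAr mul1r mulr1.
rewrite !addrA => /addIr.
rewrite (qbrU_quantum presE) qexpU_alpha qexpU_alphaN => E.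
have Ex : qd *: (eU U a * val (phi F m j : Um U)) = qd *: S + pimat (eUp U a) m j *: kU U a
    + qd *: (val (phi F m j : Um U) * eU U a)
    - (qd *: T + pimat (eUp U a) m j *: kVU U a).
  by rewrite E [RHS]addrC addKr.
apply: (scalerI qd0); rewrite [LHS]scalerBr [X in X - _ = _]Ex.
rewrite [LHS]addrAC addrK opprD addrA [LHS](ACl (2*4*1*3)%AC) /=.
rewrite [RHS]scalerBr scalerDr; congr (_ + _ - _).
by rewrite -scalerBr !scalerA mulrAC mulfV // mul1r.
Qed.

End QuantumPhi.

(** * Both cases of phi together, and its annihilation by the projector *)

Section PhiProperties.
Variables (R : realType) (L : ssLie R[i]) (U : envelope L) (X : gradedMod U).
Variables (F : ctens L (Up U) (Um U)) (calF : is_calF F).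
Local Notation C := (R[i]).
Local Notation I := 'I_(rk L).
Local Notation hs := (hstar L).
Local Notation IX := (gmI X).
Implicit Types (i j : IX).
Local Notation phU i j := (val (phi F i j : Um U)).

Lemma phi_path i j : phU i j != 0 -> succ i j.
Proof.
case E: (pres U) => [iota|hb e f k k'].
  exact: (phi_classical_path E calF).
have := calF; rewrite /is_calF E => -[Rc RcP FP].
exact: (phi_quantum_path E RcP FP).
Qed.

Lemma phi_weight i j : Uweight (nu j - nu i) (phU i j).
Proof.
case E: (pres U) => [iota|hb e f k k'].
  exact: (phi_classical_weight E calF).
have := calF; rewrite /is_calF E => -[Rc RcP FP].
exact: (phi_quantum_weight E RcP FP).
Qed.

Lemma phi_comm : phi_commutes (X := X) (fun i j => phU i j).
Proof.
case E: (pres U) => [iota|hb e f k k'].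
  exact: (phi_classical_commutes E calF).
have := calF; rewrite /is_calF E => -[Rc RcP FP].
exact: (phi_quantum_commutes E RcP FP).
Qed.

Variables (A : ambient U) (H : extension A) (P : projector H).
Local Notation hat u := (kA P (hatU H u)).

Lemma wp_rideal u : u \in rideal (@fU _ _ U) -> wp P * hat u = 0.
Proof. by move=> uJ; apply: wp_Jm; exact: rideal_morph. Qed.

(** The constant term of an element of U^-. It is multiplicative because x y - c d = (x - c) y + c
    (y - d) and the right ideal absorbs y. *)
Lemma gensm_augmentation hb e f k k' u : pres U = Quantum hb e f k k' ->
  u \in gensub (gensm U) -> exists c : C, u - c%:A \in rideal (@fU _ _ U).
Proof.
move=> E; move: u; apply: gensub_ind => [|a x y [c xc] [d yd]|x y [c xc] [d yd]|g].
- by exists 1; rewrite scale1r subrr rideal0.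
- exists (a * c + d); rewrite scalerDl opprD addrACA -scalerA -scalerBr.
  by rewrite ridealD ?ridealZ.
- exists (c * d).
  have -> : x * y - (c * d)%:A = (x - c%:A) * y + c *: (y - d%:A).
    by rewrite mulrBl mulr_algl scalerBr scalerA addrA subrK.
  by rewrite ridealD ?ridealZ ?ridealMr.
- rewrite /gensm E => -[a _ <-]; exists 0; rewrite scale0r subr0.
  by rewrite -(fU_quantum E); exact: rideal_gen.
Qed.

Lemma wp_phi i j : wp P * hat (phU i j) = 0.
Proof.
case E: (pres U) => [iota|hb e f k k'].
  by apply: wp_rideal; exact: (phi_classical_rideal E calF).
have [->|ph0] := eqVneq (phU i j) 0; first by rewrite hatU0 rmorph0 mulr0.
have [n [[a na] ijn]] := succ_wt (phi_path ph0).
have n0 : rpos n != 0 :> rlat L.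
  apply: contra_neq na => /(congr1 (fun b : rlat L => b a)).
  by rewrite !ffunE => -[].
(* Pick a simple root that is not orthogonal to the weight of phi_ij: its k commutes with wp but not
   with phi_ij. *)
have [b fb] := exists_form_alpha_neq0 n0.
have q1 : qpw hb (form (alpha b) (nu j - nu i)) != 1.
  rewrite -opprB ijn formNr.
  have [c [d [d0 cd]]] := form_alpha_rational b (rpos n : rlat L).
  apply: (@qpw_rational_neq1 _ _ _ (- c) d) => //; last by rewrite oppr_eq0.
    exact: (quantum_root1 E).
  by rewrite mulNr cd rmorphN.
have [c uc] := gensm_augmentation E (valP (phi F i j : Um U)).
have W : wp P * hat (phU i j) = c *: wp P.
  have hD x y : hat (x + y) = hat x + hat y by rewrite hatUD raddfD.
  have hc : hat c%:A = c%:A by rewrite hatUZ hatU1 linearZ /= rmorph1.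
  by rewrite -[phU i j](subrK c%:A) hD hc mulrDr wp_rideal // add0r mulr_algr.
have kwp : hat (k b) * wp P = wp P * hat (k b).
  have := wp_weight P; rewrite /ad_weight E => /(_ b) ->.
  by rewrite formC form0l qpw0 scale1r.
have kphi : k b * phU i j = phU i j * (qpw hb (form (alpha b) (nu j - nu i)) *: k b).
  by have := phi_weight i j; rewrite /Uweight /ad_weight E; apply.
set q := qpw hb _ in q1 kphi.
(* Evaluate wp k phi_ij by moving k to the left of wp or to the right of phi_ij. Here [q] denotes
   the factor picked up on the way, which differs from 1, so c wp k = 0; then k is cancelled. *)
have E1 : c *: (wp P * hat (k b)) = (q * c) *: (wp P * hat (k b)).
  have := congr1 (fun x => wp P * hat x) kphi.
  rewrite -scalerAr hatUZ !hatUM linearZ /= !rmorphM mulrA -kwp -mulrA W.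
  by rewrite -!scalerAr kwp mulrA W -scalerAl scalerA.
have : ((1 - q) * c) *: (wp P * hat (k b)) = 0.
  by rewrite mulrBl mul1r scalerBl -E1 subrr.
move=> /(congr1 (fun x => x * hat (k' b))).
rewrite mul0r -scalerAl -mulrA -rmorphM -hatUM (kk' E) hatU1 rmorph1 mulr1.
rewrite W -scalerA => /(congr1 (fun x => (1 - q)^-1 *: x)).
by rewrite scaler0 [_ *: (_ *: (_ *: _))]scalerA mulVf ?scale1r // subr_eq0 eq_sym.
Qed.

End PhiProperties.

Lemma fsum_seq (V : nmodType) (T : choiceType) (S : set T) (r : seq T) (f : T -> V) :
  uniq r -> (forall t, S t <-> t \in r) ->
  \sum_(t \in S) f t = \sum_(t <- r) f t.
Proof.
move=> ur Sr; apply: eq_sum_support => // t ft.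
rewrite in_finite_support.
  by apply/idP/idP => [/set_mem[/Sr]//|tr]; apply: mem_set; split; [exact/Sr|exact/eqP].
by apply: (sub_finite_set _ (finite_seq r)) => u [/Sr].
Qed.

(** The bound allows a duplicate-free list in Q of maximal length, and an element of Q missing from
    it would lengthen it. *)
Lemma enumerate_bounded (T : eqType) (Q : T -> Prop) (n : nat) :
  (forall t : seq T, uniq t -> (forall k, k \in t -> Q k) -> (size t <= n)%N) ->
  exists2 D : seq T, uniq D & forall k, Q k <-> k \in D.
Proof.
move=> bnd.
pose S m := `[< exists t : seq T, [/\ uniq t, forall k, k \in t -> Q k & size t = m] >].
have S0 : exists m, S m by exists 0%N; apply/asboolP; exists [::].
have Sn m : S m -> (m <= n)%N by move=> /asboolP[t [ut tQ <-]]; exact: bnd.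
case: (ex_maxnP S0 Sn) => m /asboolP[D [uD DQ szD]] maxm.
exists D => // k; split=> [Qk|]; last exact: DQ.
apply: contraT => kD; suff /maxm : S m.+1 by rewrite ltnn.
apply/asboolP; exists (k :: D); split=> /=; [by rewrite kD| |by rewrite szD].
by move=> h; rewrite inE => /orP[/eqP->|/DQ].
Qed.

(** * Finiteness and the recursion for z_i *)

Section Below.
Variables (R : realType) (L : ssLie R[i]) (U : envelope L) (X : gradedMod U).
Local Notation C := (R[i]).
Local Notation I := 'I_(rk L).
Local Notation hs := (hstar L).
Local Notation IX := (gmI X).
Implicit Types (i j k : IX).

(* More basis vectors of weight l than spanning vectors of the weight space
   would be linearly dependent. *)
Lemma weight_finite (l : hs) :
  exists2 D : seq IX, uniq D & forall k, nu k = l <-> k \in D.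
Proof.
have [s sP] := Xwt_fin X l.
apply: (@enumerate_bounded _ _ (size s)) => t ut tl; rewrite leqNgt; apply/negP => st.
have [k0 k0t] : exists k0, k0 \in t.
  by case: t {ut tl} st => [//|k0 t] _; exists k0; rewrite inE eqxx.
pose x (a : 'I_(size t)) := nth k0 t a.
have ex a : exists c : 'I_(size s) -> C, xvec (x a) = \sum_(k < size s) c k *: s`_k.
  by apply: sP; have := xvec_wt (x a); rewrite tl // mem_nth.
pose M : 'M[C]_(size t, size s) := \matrix_(a, k) projT1 (cid (ex a)) k.
have xE a : xvec (x a) = \sum_(k < size s) M a k *: s`_k.
  by rewrite {1}(projT2 (cid (ex a))); apply: eq_bigr => k _; rewrite mxE.
have : kermx M != 0.
  by rewrite kermx_eq0 /row_free neq_ltn (leq_ltn_trans (rank_leq_col M)).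
move=> /rowV0Pn[v /sub_kermxP vM /eqP v0]; apply: v0; apply/rowP => a; rewrite mxE.
have : \sum_b v 0 b *: (xvec (x b) : gmX X) = 0.
  under eq_bigr => b _ do rewrite xE scaler_sumr.
  rewrite exchange_big big1 //= => k _.
  under eq_bigr => b _ do rewrite scalerA.
  by rewrite -scaler_suml; have /rowP/(_ k) := vM; rewrite !mxE => ->; rewrite scale0r.
move=> /(congr1 (xcoord (x a))); rewrite linear_sum linear0 (bigD1 a) //= big1 => [|b ba].
  by rewrite linearZ /= xcoord_xvec eqxx addr0 => <-; rewrite /GRing.scale /= mulr1.
rewrite linearZ /= xcoord_xvec /x nth_uniq // (inj_eq val_inj) eq_sym (negPf ba).
exact: mulr0.
Qed.

Lemma succ_component i j : succ i j -> same_component i j.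
Proof.
by elim=> {i j} [i j ij|i j k _ ij _ jk]; [exact: rst_step|exact: rst_trans jk].
Qed.

(** Let lambda bound the component. For k below i, both nu_k - lambda and nu_i - nu_k have
    nonnegative coordinates with sum nu_i - lambda, which leaves finitely many weights nu_k, each
    carried by finitely many nodes. *)
Lemma below_finite i : bounded_below X ->
  exists2 D : seq IX, uniq D & forall k, succ i k <-> k \in D.
Proof.
move=> /(_ i)[l lP]; have [n nE] := lP i (rst_refl _ _ i).
(* A crude common bound for all coordinates of nu_k - lambda. *)
pose N := (\sum_a n a)%N.
pose W := [seq l + wt_of (rpos (fun a => m a : nat)) | m : {ffun I -> 'I_N.+1}].
have [DD DDP] := choice (fun w : hs => let: ex_intro2 D uD DP := weight_finite w in
  ex_intro (fun D : seq IX => forall k, nu k = w <-> k \in D) D DP).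
pose E := flatten [seq DD w | w <- W].
have succE k : succ i k -> k \in E.
  move=> ik; have [m mE] := lP k (succ_component ik).
  have [p [_ pE]] := succ_wt ik.
  have mn a : (m a <= N)%N.
    have : wt_of (rpos n) = wt_of (rpos p + rpos m) :> hs.
      by rewrite [RHS]raddfD /= -pE !wt_of_rpos -nE -mE addrA subrK.
    move=> /wt_of_inj /(congr1 (fun b : rlat L => b a)); rewrite !ffunE -PoszD => -[npm].
    by rewrite /N (bigD1 a) //= npm -addnA addnCA leq_addr.
  apply/flattenP; exists (DD (nu k)); last by apply/DDP.
  apply: map_f; apply/mapP; exists [ffun a => inord (m a)]; first by rewrite mem_enum.
  rewrite -[LHS](subrK l) mE -wt_of_rpos addrC; congr (_ + wt_of _).
  by apply/ffunP => a; rewrite !ffunE inordK ?ltnS ?mn.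
apply: (@enumerate_bounded _ _ (size E)) => t ut tP.
by apply: uniq_leq_size => // k /tP/succE.
Qed.

End Below.

(** * Identities between Cartan factors *)

Section CartanRatios.
Variables (R : realType) (L : ssLie R[i]) (U : envelope L) (A : ambient U).
Variables (H : extension A).
Implicit Types (x y : affh L).

(** To be read with x = eta_i - eta_k and y = eta_k - eta_j for an arrow from j to k: it is the
    condition under which the double sums of the recursion cancel. *)
Lemma qexph_ratio x y : root_lattice x -> root_lattice y ->
  qbrh H x \is a GRing.unit ->
  qexph H y * (qexph H (- (x + y)) / qbrh H (x + y)) =
  qbrh H x / qbrh H (x + y) * (qexph H (- x) / qbrh H x).
Proof.
move=> lx ly ux; rewrite opprD qexphD; [|exact: root_latticeN|exact: root_latticeN].
have yV := qexphN H ly; move: (qexph H y) (qexph H (- y)) yV => e e' ee'.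
move: (qexph H (- x)) (qbrh H x) ux (qbrh H (x + y)) => d b ub c.
rewrite !mulrA [e * d]mulrC -[d * e * e']mulrA ee' mulr1.
by rewrite [RHS]mulrC !mulrA mulVr // mul1r [RHS]mulrC.
Qed.

(** Only [x + y] is inverted: with x = eta_i - eta_m, the node m = i has to be covered, and there x
    = 0. *)
Lemma qbrh_ratio x y : root_lattice x -> root_lattice y ->
  qbrh H (x + y) \is a GRing.unit ->
  qbrh H y * (qexph H (- (x + y)) / qbrh H (x + y)) - qexph H (- y) =
  - (qbrh H x / qbrh H (x + y)).
Proof.
move=> lx ly u; apply: (mulIr u); rewrite mulrBl mulrA divrK // mulNr divrK //.
have yV := qexphN H ly; have := qbrhD H lx ly => /eqP; rewrite subr_eq => /eqP ->.
rewrite opprD qexphD; [|exact: root_latticeN|exact: root_latticeN].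
move: (qexph H y) (qexph H (- y)) yV (qexph H (- x)) (qbrh H x) (qbrh H y).
move=> e e' ee' d b c; rewrite mulrDr [e' * (e * b)]mulrA [e' * e]mulrC ee' mul1r.
ring.
Qed.

Lemma qbrh_diag_scale x (c d : U0hat H) (v : Vmod H) :
  (c * (qbrh H (x - x) / d)) *: v = 0.
Proof. by rewrite subrr qbrh0 mul0r mulr0 scale0r. Qed.

End CartanRatios.

(** * The family Z_m below a fixed node *)

Section Invariants.
Variables (R : realType) (L : ssLie R[i]) (U : envelope L) (A : ambient U).
Variables (H : extension A) (X : gradedMod U).
Variables (F : ctens L (Up U) (Um U)) (psi : gmI X -> Vmod H).
Hypotheses (calF : is_calF F) (dual : is_dual_basis psi).
Local Notation C := (R[i]).
Local Notation I := 'I_(rk L).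
Local Notation hs := (hstar L).
Local Notation aff := (affh L).
Local Notation IX := (gmI X).
Local Notation K := (U0hat H).
Local Notation V := (Vmod H).
Local Notation phU i j := (val (phi (X := X) F i j : Um U)).

Variables (i : IX) (D : seq IX).
Hypotheses (uD : uniq D) (DP : forall k, succ i k <-> k \in D).

Let M : pred IX := fun m => m \in i :: D.

Let M_succ m k : M m -> succ m k -> k \in D.
Proof.
rewrite /M inE => /orP[/eqP->|/DP im] mk; apply/DP => //; exact: succ_trans mk.
Qed.

(** The induction measure: it drops strictly along paths, because j is below m but not below
    itself. *)
Let height m := count (fun j => `[< succ m j >]) D.

Let height_succ m j : M m -> succ m j -> (height j < height m)%N.
Proof.
move=> Mm mj; have jD := M_succ Mm mj; pose a h := `[< succ j h >].
have := count_predUI a (pred1 j) D; rewrite (count_uniq_mem j uD) jD.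
have -> : count (predI a (pred1 j)) D = 0%N.
  apply/eqP; rewrite -leqn0 leqNgt -has_count; apply/hasPn => h _ /=.
  by apply/negP => /andP[/asboolP jh /eqP hj]; apply: (@succ_irrefl _ _ _ X j); rewrite -{2}hj.
rewrite addn0 addn1 => <-; apply: sub_count => h /= /orP[/asboolP jh|/eqP->].
  by apply/asboolP; exact: succ_trans jh.
exact/asboolP.
Qed.

(** Z_m cut off at chains of length N, with the Cartan factors of the fixed node i at every level.
    It is stationary from N = [height m] on, so [size D] is always enough. *)
Fixpoint ztrunc (N : nat) (m : IX) : V :=
  if N is N'.+1 then
    psi m + \sum_(j <- D) Bfac H i j *: Vlact (hatU H (phU m j)) (ztrunc N' j)
  else psi m.

Lemma phU_eq0 m j : ~ succ m j -> phU m j = 0.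
Proof. by apply: contra_notP => /eqP /(phi_path calF). Qed.

Lemma ztrunc_stable N m : M m -> (height m <= N)%N -> ztrunc N.+1 m = ztrunc N m.
Proof.
elim: N m => [|N IH] m Mm hm.
  rewrite /= big1 ?addr0 // => j _; rewrite phU_eq0 ?hatU0 ?Vlact0l ?scaler0 //.
  by move=> /(height_succ Mm); rewrite (eqP (_ : height m == 0%N)) // -leqn0.
rewrite [LHS]/= [RHS]/=; congr (_ + _); apply: eq_big_seq => j jD; congr (_ *: _).
have [mj|nmj] := pselect (succ m j); last by rewrite phU_eq0 // hatU0 !Vlact0l.
have := IH j _ _ => /= <- //; first by rewrite /M inE jD orbT.
by rewrite -ltnS (leq_trans (height_succ Mm mj)).
Qed.

Definition zfun := ztrunc (size D).

Lemma zfun_rec m : M m ->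
  zfun m = psi m + \sum_(j <- D) Bfac H i j *: Vlact (hatU H (phU m j)) (zfun j).
Proof. by move=> Mm; rewrite {1}/zfun -ztrunc_stable // count_size. Qed.

(** A list of the chains of length at most N, which replaces the set-indexed sum in [zvec]. *)
Fixpoint chains (N : nat) (m : IX) : seq (seq IX) :=
  if N is N'.+1 then
    [::] :: [seq j :: s | j <- [seq j <- D | `[< succ m j >]], s <- chains N' j]
  else [:: [::]].

Lemma chains_uniq N m : uniq (chains N m).
Proof.
elim: N m => [|N IH] m //=; apply/andP; split.
  by apply/negP => /allpairsPdep[j [s [_ _]]].
apply: allpairs_uniq_dep => [|j _|[j s] [j' s'] _ _ /= [-> ->] //].
  by rewrite filter_uniq.
exact: IH.
Qed.

Lemma mem_chains N m s : M m ->
  s \in chains N m <-> chain m s /\ (size s <= N)%N.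
Proof.
elim: N m s => [|N IH] m s Mm.
  rewrite inE; split=> [/eqP->//|[_]]; by rewrite leqn0 size_eq0.
rewrite [chains _ _]/= inE; split.
  move=> /orP[/eqP->//|/allpairsPdep[j [t [+ tj ->]]]].
  rewrite mem_filter => /andP[/asboolP mj jD] /=.
  have Mj : M j by rewrite /M inE jD orbT.
  by have [] := fst (IH j t Mj) tj.
case: s => [//|j s] [/= [mj js] sN].
have jD := M_succ Mm mj; have Mj : M j by rewrite /M inE jD orbT.
apply/allpairsPdep; exists j, s; split=> //.
  by rewrite mem_filter jD andbT; apply/asboolP.
by apply/(IH j s Mj).
Qed.

Lemma chain_size s m : M m -> chain m s -> (size s <= height m)%N.
Proof.
elim: s m => [//|j s IH] m Mm [mj js] /=.
have Mj : M j by rewrite /M inE (M_succ Mm mj) orbT.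
exact: leq_ltn_trans (IH j Mj js) (height_succ Mm mj).
Qed.

(** [zterm] with the chain started at m but the Cartan factors still those of i; the two agree for m
    = i. *)
Let zt m s : V :=
  Vract (Vlact (hatU H (val (\prod_(u <- pairmap (phi (X := X) F) m s) u))) (psi (last m s)))
    (\prod_(n <- s) Bfac H i n).

Lemma ztrunc_chains N m : M m -> ztrunc N m = \sum_(s <- chains N m) zt m s.
Proof.
have zt0 h : zt h [::] = psi h.
  by rewrite /zt /= !big_nil hatU1 Vlact1 VractE scale1r.
elim: N m => [|N IH] m Mm; first by rewrite big_seq1 zt0.
rewrite [chains _ _]/= big_cons zt0 [LHS]/=; congr (_ + _).
rewrite big_allpairs_dep big_filter [RHS]big_mkcond; apply: eq_big_seq => j jD.
have Mj : M j by rewrite /M inE jD orbT.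
case: asboolP => [mj|nmj]; last by rewrite phU_eq0 // hatU0 Vlact0l scaler0.
rewrite IH // linear_sum scaler_sumr; apply: eq_bigr => s _.
by rewrite /zt /= !big_cons subalg_valM hatUM VlactM !VractE linearZ /= scalerA.
Qed.

Lemma zvec_zfun : zvec F psi i = zfun i.
Proof.
have Mi : M i by rewrite /M inE eqxx.
rewrite /zfun -ztrunc_stable ?count_size // ztrunc_chains // [chains _ _]/= big_cons.
congr (_ + _); first by rewrite /zt /= !big_nil hatU1 Vlact1 VractE scale1r.
apply: fsum_seq => [|s].
  by have := chains_uniq (size D).+1 i => /andP[].
have := mem_chains (size D).+1 s Mi; rewrite [chains _ _]/= inE => E.
split=> [[s0 si]|sC].
  have [_] := E; rewrite (negPf s0) /=; apply; split=> //.
  exact: leq_trans (chain_size Mi si) (leq_trans (count_size _ _) (leqnSn _)).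
have [] := fst E; first by rewrite sC orbT.
move=> si _; split=> //; apply/eqP => s0; move: sC; rewrite s0.
by move=> /allpairsPdep[j [t [_ _]]].
Qed.

Lemma ztrunc_weight N m : Vweight (- nu m) (ztrunc N m).
Proof.
have [_ psiW _] := dual; elim: N m => [|N IH] m /=; first exact: psiW.
apply: VweightD; first exact: psiW.
apply: Vweight_sum => j; apply: VweightZ.
have -> : - nu m = (nu j - nu m) - nu j by rewrite addrAC subrr add0r.
by apply: Vweight_mul; [exact: phi_weight|exact: IH].
Qed.

Let lattice_eta (m j : IX) : (m = j \/ succ m j) -> root_lattice (eta (nu m) - eta (nu j)).
Proof.
move=> [->|/succ_wt[n [_ nE]]]; first by exists 0; rewrite subrr [RHS]raddf0.
by exists (rpos n); rewrite -nE.
Qed.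

(** For j below i the difference nu_i - nu_j is a nonzero element of the root lattice, hence an
    admissible weight of a denominator. *)
Let eta_unit (j : IX) : j \in D -> qbrh H (eta (nu i) - eta (nu j)) \is a GRing.unit.
Proof.
move=> /DP/succ_wt[n [[a na] nE]]; rewrite [_ - _]surjective_pairing.
apply: qbrh_unit; have -> : (eta (nu i) - eta (nu j)).1 = wt_of (rpos n) by rewrite -nE.
apply: denom_wt_of; apply: contra_neq na => /(congr1 (fun b : rlat L => b a)).
by rewrite !ffunE => -[].
Qed.

Definition hatpi a (m k : IX) : K := (pimat (eUp U a) m k)%:A.

Lemma hatpi0 a (m k : IX) : pimat (eUp U a) m k = 0 -> hatpi a m k = 0.
Proof. by rewrite /hatpi => ->; exact: scale0r. Qed.

Lemma zfun_annihilated a m : M m -> Vlact (ehat H a) (zfun m) =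
  - \sum_(k <- D) (hatpi a m k *
      (qbrh H (eta (nu i) - eta (nu m)) / qbrh H (eta (nu i) - eta (nu k)))) *: zfun k.
Proof.
(* The element h_alpha - (alpha, nu_j), by which h_alpha acts on Z_j from the right. For an arrow
   from j to m' it equals eta_m' - eta_j, which links the action of U^0 to the Cartan factors. *)
pose x (j : IX) : aff := (alpha a, form (alpha a) (- nu j)).
have latx (j : IX) : root_lattice (x j) by exact: root_lattice_alpha.
have etax (m' j : IX) : pimat (eUp U a) m' j != 0 -> x j = eta (nu m') - eta (nu j).
  by move=> /arrow_wt ->; rewrite eta_alpha.
apply: (@triangular_recursion K V IX D M height
  (@Vlact _ _ _ _ H (ehat H a)) (@Vlact _ _ _ _ H (hatU H (kU U a)))
  (@Vlact _ _ _ _ H (hatU H (kVU U a)))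
  (@Vlact _ _ _ _ H (hatU H (qbrU U (alpha a, 0))))
  (fun m j => @Vlact _ _ _ _ H (hatU H (phU m j)))
  (hatpi a)
  (fun m k => qbrh H (eta (nu i) - eta (nu m)) / qbrh H (eta (nu i) - eta (nu k)))
  psi zfun (Bfac H i) (fun j => qexph H (x j)) (fun j => qexph H (- x j))
  (fun j => qbrh H (x j))).
- by move=> j jD; rewrite /M inE jD orbT.
- exact: zfun_rec.
- move=> m' Mm; have [_ _ dualE] := dual.
  rewrite -[LHS]/(Vlact (ehat H a) (psi m')) dualE; congr (- _).
  rewrite (@fsum_support _ _ D) // => [|k].
    by apply: eq_bigr => k _; rewrite hatUZ VlactZl.
  have [->|/arrow_succ/(M_succ Mm)//] := eqVneq (pimat (eUp U a) m' k) 0.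
  by rewrite scale0r hatU0 Vlact0l eqxx.
- move=> m' j v Mm jD.
  have E := @phi_comm _ _ _ X _ calF m' j a D uD (fun k => @M_succ m' k Mm).
  suff : Vlact (ehat H a) (Vlact (hatU H (phU m' j)) v) =
      Vlact (hatU H (phU m' j)) (Vlact (ehat H a) v)
      + hatpi a m' j *: Vlact (hatU H (qbrU U (alpha a, 0))) v
      + \sum_(k <- D) hatpi a k j *:
          Vlact (hatU H (phU m' k)) (Vlact (hatU H (kU U a)) v)
      - \sum_(k <- D) hatpi a m' k *:
          Vlact (hatU H (kVU U a)) (Vlact (hatU H (phU k j)) v) by [].
  have -> : Vlact (ehat H a) (Vlact (hatU H (phU m' j)) v) =
      Vlact (hatU H (eU U a * phU m' j)) v by rewrite hatUM VlactM.
  have -> : Vlact (hatU H (phU m' j)) (Vlact (ehat H a) v) =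
      Vlact (hatU H (phU m' j * eU U a)) v by rewrite hatUM VlactM.
  move/eqP: E; rewrite subr_eq => /eqP ->.
  rewrite addrC !addrA !hatUD !VlactDl hatUN VlactNl hatUZ VlactZl !hatU_sum !Vlact_suml.
  congr (_ + _ + _ - _); apply: eq_bigr => k _; by rewrite hatUZ VlactZl hatUM VlactM.
- move=> m' j v Mm jD hmj.
  have ph0 : phU m' j = 0.
    by apply: phU_eq0 => /(height_succ Mm); rewrite ltnNge hmj.
  suff : Vlact (hatU H (phU m' j)) v = 0 by [].
  by rewrite ph0 hatU0 Vlact0l.
- by move=> j _; apply: Vweight_kU; exact: ztrunc_weight.
- by move=> j _; apply: Vweight_kVU; exact: ztrunc_weight.
- by move=> j _; apply: Vweight_qbrU; exact: ztrunc_weight.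
- move=> k j kD jD; have [k0|kj] := eqVneq (pimat (eUp U a) k j) 0.
    by rewrite (hatpi0 k0); exact: etrans (mul0r _) (esym (mul0r _)).
  have xE := etax k j kj.
  have ij : eta (nu i) - eta (nu j) = (eta (nu i) - eta (nu k)) + x j.
    by rewrite xE; exact: esym (subrKA _ _ _).
  have latk : root_lattice (eta (nu i) - eta (nu k)).
    by apply: lattice_eta; right; apply/DP.
  have := qexph_ratio latk (latx j) (eta_unit kD); rewrite -ij.
  exact: (congr1 (fun z => hatpi a k j * z)).
- move=> m' j Mm jD; have [m0|mj] := eqVneq (pimat (eUp U a) m' j) 0.
    rewrite (hatpi0 m0) (mul0r (_ / _)) oppr0; exact: mul0r.
  have xE := etax m' j mj.
  have ij : eta (nu i) - eta (nu j) = (eta (nu i) - eta (nu m')) + x j.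
    by rewrite xE; exact: esym (subrKA _ _ _).
  have latm : root_lattice (eta (nu i) - eta (nu m')).
    by apply: lattice_eta; move: Mm; rewrite /M inE => /orP[/eqP->|/DP]; [left|right].
  have uj := eta_unit jD; rewrite ij in uj.
  have := qbrh_ratio latm (latx j) uj; rewrite -ij -(mulrN (hatpi a m' j)).
  exact: (congr1 (fun z => hatpi a m' j * z)).
Qed.

End Invariants.

(** * The extremal projector on V *)

Section Projector.
Variables (R : realType) (L : ssLie R[i]) (U : envelope L) (A : ambient U).
Variables (H : extension A) (P : projector H).
Local Notation V := (Vmod H).

Lemma Vbrv_class x : Vbrv P (lclass (ehat H) x : V) = lclass (ebrv P) (kA P x).
Proof.
apply/lclass_eq; rewrite -rmorphB.
exact: (lideal_morph (kA P) (repr_lclass (ehat H) x)).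
Qed.

Lemma VbrvD (v w : V) : Vbrv P (v + w) = Vbrv P v + Vbrv P w.
Proof.
have [x ->] := lclassP v; have [y ->] := lclassP w.
by rewrite -lclassD !Vbrv_class raddfD lclassD.
Qed.

Lemma Vbrv0 : Vbrv P (0 : V) = 0.
Proof. by rewrite -(lclass0 (ehat H)) Vbrv_class rmorph0 lclass0. Qed.

Lemma wp_Vplus (v : V) : Vplus v -> lact (wp P) (Vbrv P v) = Vbrv P v.
Proof.
have [x ->] := lclassP v => ex; rewrite Vbrv_class lact_class.
apply/lclass_eq; rewrite -[X in _ - X]mul1r -mulrBl.
have [_ /asboolP[b ->]] := wp_1 P; rewrite mulr_suml; apply: rpred_sum => a _.
rewrite -mulrA -rmorphM; apply: lidealMl; apply: (lideal_morph (kA P)).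
by apply/lclass_eq0; rewrite -lact_class; exact: ex.
Qed.

(** The scalar y multiplies on the right, so wp still meets u first. *)
Lemma wp_Vbrv (u : H) (v : V) y : wp P * kA P u = 0 ->
  lact (wp P) (Vbrv P (y *: Vlact u v)) = 0.
Proof.
move=> wu; have [x ->] := lclassP v.
rewrite /Vlact lact_class -VractE Vract_class Vbrv_class lact_class.
by rewrite !rmorphM !mulrA wu !mul0r lclass0.
Qed.

End Projector.

Theorem theorem7p3 (R : realType) (L : ssLie R[i]) (U : envelope L)
    (A : ambient U) (H : extension A) (P : projector H)
    (X : gradedMod U) (F : ctens L (Up U) (Um U)) (psi : gmI X -> Vmod H) :
  bounded_below X -> is_calF F -> is_dual_basis psi ->
  forall i : gmI X,
    Vplus (zvec F psi i) /\
    Vbrv P (zvec F psi i) = lact (wp P) (Vbrv P (psi i)).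
Proof.
move=> bdd calF dual i; have [D uD DP] := below_finite i bdd.
have Mi : i \in i :: D by rewrite inE eqxx.
have zi := zvec_zfun psi calF uD DP.
have zplus : Vplus (zvec F psi i).
  move=> a; rewrite zi (zfun_annihilated calF dual uD DP a Mi).
  rewrite big1 ?oppr0 // => k _.
  exact: qbrh_diag_scale.
(* Since wp fixes z_i, it may be applied to the recursion for z_i, where every summand except psi_i
   begins with an entry of phi. *)
split=> //; rewrite -(wp_Vplus P zplus) zi (zfun_rec psi calF uD DP Mi).
rewrite VbrvD lactDr (big_morph _ (@VbrvD _ _ _ _ _ P) (Vbrv0 P)) lact_sumr.
rewrite big1 ?addr0 // => k _; apply: wp_Vbrv; exact: wp_phi.
Qed.
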